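(* Let $\Omega\subseteq\mathbb{R}^d$ be a bounded domain with Lipschitz boundary and let $v\in\mathcal{A}(\Omega)$. Then, as $s\to0^+$, the family of functionals $F_s(\cdot,\Omega)$ $\Gamma$-converges with respect to the weak-$L^2(\Omega)$ topology to the functional $$F_0(u,\Omega):=\begin{cases}\displaystyle\sum_{k=0}^2(-1)^k\binom{2}{k}\,\alpha(v^k)\int_\Omega u^{2-k}(x)\,dx & \text{if }u\in L^2(\Omega),\\ +\infty&\text{otherwise.}\end{cases}$$
   Context: $\Omega^c=\mathbb{R}^d\setminus\Omega$, $Q_\Omega=(\mathbb{R}^d\times\mathbb{R}^d)\setminus(\Omega^c\times\Omega^c)$, and for $s\in(0,1)$ $$[u]^2_{H^s(Q_\Omega)}=\iint_{Q_\Omega}\frac{|u(x)-u(y)|^2}{|x-y|^{d+2s}}\,dx\,dy\in[0,+\infty].$$ Mass at infinity: for a measurable function $w$, $$\alpha(w):=\lim_{s\to0^+}s\int_{B_1^c(0)}\frac{w(y)}{|y|^{d+2s}}\,dy$$ whenever this is well defined, where $B_1^c(0)=\{|y|\ge1\}$; functions defined only on $\Omega^c$ are extended by zero to $\Omega$ (the values on a bounded set do not affect $\alpha$). By convention $v^0=1$, with $\alpha(1)=d\omega_d/2$, $\omega_d$ being the Lebesgue measure of the unit ball. $v^+=\max\{v,0\}$, $v^-=\max\{-v,0\}$. Admissible boundary data: $\mathcal{A}(\Omega)=\{v\in L^\infty(\Omega^c): \alpha(v^+),\alpha(v^-),\alpha(v^2)\text{ exist}\}$. For $v\in\mathcal{A}(\Omega)$,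 $L^2_{loc}(Q_\Omega,v)=\{u\in L^2_{loc}(\mathbb{R}^d): u=v\text{ on }\Omega^c\}$, and for $s\in(0,1)$ and $u\in L^2_{loc}(\mathbb{R}^d)$, $$F_s(u,\Omega)=\begin{cases}\frac{s}{2}[u]^2_{H^s(Q_\Omega)}&\text{if }u\in L^2_{loc}(Q_\Omega,v),\\+\infty&\text{otherwise.}\end{cases}$$ Functions in $L^2_{loc}(Q_\Omega,v)$ are identified with their restrictions to $\Omega$, i.e. a function $u\in L^2(\Omega)$ is extended by $v$ on $\Omega^c$. $\Gamma$-convergence as $s\to0^+$ means: for every sequence $s_j\to0^+$, (i) if $u_j\rightharpoonup u$ weakly in $L^2(\Omega)$ then $\liminf_j F_{s_j}(u_j,\Omega)\ge F_0(u,\Omega)$; (ii) for every $u\in L^2(\Omega)$ there is a sequence $u_j\rightharpoonup u$ weakly in $L^2(\Omega)$ with $\limsup_j F_{s_j}(u_j,\Omega)\le F_0(u,\Omega)$. *)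

(* Defs.v *)
From HB Require Import structures.
From mathcomp Require Import all_boot all_order all_algebra.
From mathcomp Require Import all_classical all_reals all_analysis.

Set Implicit Arguments.
Unset Strict Implicit.
Unset Printing Implicit Defensive.

Import Order.TTheory GRing.Theory Num.Theory.
Import numFieldNormedType.Exports.

Local Open Scope classical_set_scope.
Local Open Scope ring_scope.

(* The sigma-algebra on row vectors generated by the coordinates; over the
   reals it is the Borel sigma-algebra. *)
Definition measure_rV_display : measure_display -> measure_display.
Proof. exact. Qed.

Section measurable_rV.
Context {d} {T : sigmaRingType d}.
Variable n : nat.

Let coor : 'I_n -> 'rV[T]_n -> T := fun i x => x ord0 i.

Let rV_set0 : g_sigma_preimage coor set0.
Proof. exact: sigma_algebra0. Qed.

Let rV_setC A : g_sigma_preimage coor A -> g_sigma_preimage coor (~` A).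
Proof. exact: sigma_algebraC. Qed.

Let rV_bigcup (F : _^nat) : (forall i, g_sigma_preimage coor (F i)) ->
  g_sigma_preimage coor (\bigcup_i (F i)).
Proof. exact: sigma_algebra_bigcup. Qed.

HB.instance Definition _ := @isMeasurable.Build (measure_rV_display d)
  'rV[T]_n (g_sigma_preimage coor) rV_set0 rV_setC rV_bigcup.

End measurable_rV.

Lemma measurable_coor d (T : sigmaRingType d) n (i : 'I_n) :
  measurable_fun [set: 'rV[T]_n] (fun x => x ord0 i).
Proof.
move=> _ Y mY; rewrite setTI; apply: sub_sigma_algebra => /=.
rewrite -bigcup_seq/=; exists i => /=; first by rewrite mem_index_enum.
by exists Y => //; rewrite setTI.
Qed.

Lemma measurable_fun_rVP d1 d2 (T1 : measurableType d1) (T2 : measurableType d2)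
    n (f : T1 -> 'rV[T2]_n) :
  measurable_fun [set: T1] f <->
  forall i, measurable_fun [set: T1] (fun x => f x ord0 i).
Proof.
split=> [mf i|mf].
  apply: (@measurableT_comp _ _ _ _ _ _ (fun x : 'rV[T2]_n => x ord0 i)) => //.
  exact: measurable_coor.
move=> _; apply: smallest_sub.
  split=> [|A|A] /=.
  - by rewrite preimage_set0 setI0.
  - by rewrite !setTI setTD => mA; rewrite preimage_setC; exact: measurableC.
  - move=> mA; rewrite preimage_bigcup setI_bigcupr.
    exact: bigcupT_measurable.
move=> A; rewrite -bigcup_seq/= => -[i _ [B mB <-]].
have := mf i measurableT B mB; rewrite /= !setTI.
exact.
Qed.

(* Lebesgue measure on R^n, by induction: Dirac mass on R^0, and the image of
   the product measure under R * R^n -> R^(n+1) otherwise. *)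
Section lebesgue_rV.
Context {R : realType}.

Definition rV_cons n (p : R * 'rV[R]_n) : 'rV[R]_n.+1 :=
  row_mx (const_mx p.1 : 'rV_1) p.2.

Lemma rV_consl n (p : R * 'rV[R]_n) : rV_cons p ord0 ord0 = p.1.
Proof.
transitivity (row_mx (const_mx p.1 : 'rV_1) p.2 ord0 (lshift n ord0)).
  by congr (row_mx _ _ _ _); exact/val_inj.
by rewrite row_mxEl mxE.
Qed.

Lemma rV_consr n (p : R * 'rV[R]_n) i :
  rV_cons p ord0 (lift ord0 i) = p.2 ord0 i.
Proof.
transitivity (row_mx (const_mx p.1 : 'rV_1) p.2 ord0 (rshift 1 i)).
  by congr (row_mx _ _ _ _); exact/val_inj.
by rewrite row_mxEr.
Qed.

Lemma measurable_rV_cons n : measurable_fun [set: R * 'rV[R]_n] (@rV_cons n).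
Proof.
apply/measurable_fun_rVP => i; case: (unliftP ord0 i) => [j|] ->.
  under eq_fun do rewrite rV_consr.
  apply: (@measurableT_comp _ _ _ _ _ _ (fun x : 'rV[R]_n => x ord0 j)) => //.
  exact: measurable_coor.
by under eq_fun do rewrite rV_consl; exact: measurable_fst.
Qed.

Definition rV_uncons n (x : 'rV[R]_n.+1) : R * 'rV[R]_n :=
  (x ord0 ord0, \row_i x ord0 (lift ord0 i)).

Lemma rV_consK n : cancel (@rV_cons n) (@rV_uncons n).
Proof.
move=> [a x]; rewrite /rV_uncons rV_consl/=; congr pair.
by apply/rowP => i; rewrite mxE rV_consr.
Qed.

Lemma measurable_rV_uncons n : measurable_fun [set: 'rV[R]_n.+1] (@rV_uncons n).
Proof.
apply: measurable_fun_pair; first exact: measurable_coor.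
apply/measurable_fun_rVP => i /=.
under eq_fun do rewrite mxE.
exact: measurable_coor.
Qed.

Section step.
Variables (n : nat) (mu : {sigma_finite_measure set 'rV[R]_n -> \bar R}).

Definition lebesgue_rV_step : set 'rV[R]_n.+1 -> \bar R :=
  pushforward (@lebesgue_measure R \x mu)%E (@rV_cons n).

Let step0 : lebesgue_rV_step set0 = 0%E.
Proof. by rewrite /lebesgue_rV_step /pushforward preimage_set0 measure0. Qed.

Let step_ge0 A : (0 <= lebesgue_rV_step A)%E.
Proof. by rewrite /lebesgue_rV_step /pushforward; exact: measure_ge0. Qed.

Let step_sigma_additive : semi_sigma_additive lebesgue_rV_step.
Proof.
exact: (@measure_semi_sigma_additive _ _ _
  (measure_function_pushforward__canonical__measure_function_Measure
    (@lebesgue_measure R \x mu)%E (@measurable_rV_cons n))).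
Qed.

HB.instance Definition _ := isMeasure.Build _ _ _
  lebesgue_rV_step step0 step_ge0 step_sigma_additive.

Let step_sigma_finite : sigma_finite setT lebesgue_rV_step.
Proof.
have /sigma_finiteP[F [FT ndF mF]] := sigma_finiteT (@lebesgue_measure R).
have /sigma_finiteP[G [GT ndG mG]] := sigma_finiteT mu.
exists (fun k => @rV_uncons n @^-1` (F k `*` G k)).
  rewrite -preimage_bigcup (_ : \bigcup_k _ = setT) ?preimage_setT//.
  rewrite -subTset => -[a x] _.
  have [i _ Fia] : (\bigcup_k F k) a by rewrite -FT.
  have [j _ Gjx] : (\bigcup_k G k) x by rewrite -GT.
  exists (maxn i j) => //; split.
  - by move: a Fia; exact/subsetPset/ndF/leq_maxl.
  - by move: x Gjx; exact/subsetPset/ndG/leq_maxr.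
move=> k; have [mFk Fkoo] := mF k; have [mGk Gkoo] := mG k; split.
  rewrite -[X in measurable X]setTI; apply: measurable_rV_uncons => //.
  exact: measurableX.
rewrite /lebesgue_rV_step /pushforward -comp_preimage.
rewrite (_ : _ \o _ = id) ?preimage_id; last exact/funext/rV_consK.
by rewrite product_measure1E// lte_mul_pinfty// ge0_fin_numE.
Qed.

HB.instance Definition _ := Measure_isSigmaFinite.Build _ _ _
  lebesgue_rV_step step_sigma_finite.

End step.

Fixpoint lebesgue_rV n : {sigma_finite_measure set 'rV[R]_n -> \bar R} :=
  match n with
  | 0 => dirac (0 : 'rV[R]_0)
  | m.+1 => lebesgue_rV_step (lebesgue_rV m)
  end.

Lemma lebesgue_rV_box n (A : 'I_n -> set R) :
  (forall i, measurable (A i)) ->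
  (lebesgue_rV n [set x : 'rV[R]_n | forall i, A i (x ord0 i)] =
   \prod_(i < n) lebesgue_measure (A i))%E.
Proof.
elim: n A => [|n IH] A mA.
  rewrite big_ord0 /= diracE mem_set//= => -[]//.
rewrite big_ord_recl -IH//= /lebesgue_rV_step /pushforward.
have mB : measurable
    [set x : 'rV[R]_n | forall i, A (lift ord0 i) (x ord0 i)].
  have -> : [set x : 'rV[R]_n | forall i, A (lift ord0 i) (x ord0 i)] =
      \bigcap_(i in [set: 'I_n])
        ((fun x : 'rV[R]_n => x ord0 i) @^-1` A (lift ord0 i)).
    by apply/seteqP; split=> [x Ax i _|x Ax i]; exact: Ax.
  apply: fin_bigcap_measurable => // i _.
  by rewrite -[X in measurable X]setTI; exact: measurable_coor.
rewrite -product_measure1E//; last exact: mA.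
congr (_ \x _)%E; apply/seteqP; split=> -[a x] /=.
  by move=> Aax; split=> [|i]; [have := Aax ord0; rewrite rV_consl
                               |have := Aax (lift ord0 i); rewrite rV_consr].
by move=> [Aa Ax] i; case: (unliftP ord0 i) => [j|] ->;
  rewrite ?rV_consr ?rV_consl.
Qed.

End lebesgue_rV.

(* The norm of the normed space 'rV[R]_n is the sup norm, hence: *)
Definition eucl_norm {R : realType} n (x : 'rV[R]_n) : R :=
  Num.sqrt (\sum_(i < n) x ord0 i ^+ 2).

Section domains.
Context {R : realType}.

Definition bounded_domain n (Omega : set 'rV[R]_n) : Prop :=
  [/\ open Omega, connected Omega, Omega !=set0 & bounded_set Omega].

(* Around each boundary point, in suitable orthonormal coordinates
   [x *m O], [Omega] is the strict epigraph, in the direction of the last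
   coordinate, of a Lipschitz function of the other coordinates. *)
Definition lipschitz_boundary n (Omega : set 'rV[R]_n.+1) : Prop :=
  forall x0, (closure Omega `\` interior Omega) x0 ->
  exists (r : R) (O : 'M[R]_n.+1) (g : 'rV[R]_n -> R),
    [/\ 0 < r,
        O *m O^T = 1%:M,
        exists L : R, forall a b, `|g a - g b| <= L * eucl_norm (a - b) &
        forall x, eucl_norm (x - x0) < r ->
          let y := x *m O in
          Omega x <-> g (col' ord_max y) < y ord0 ord_max].

End domains.

Section functionals.
Context {R : realType} {d : nat}.
Local Notation E := 'rV[R]_d.
Local Notation leb := (lebesgue_rV d).

Definition square_integrable (A : set E) (u : E -> R) : Prop :=
  measurable_fun A u /\ (\int[leb]_(x in A) (`|u x| ^+ 2)%R%:E < +oo)%E.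

Definition locally_square_integrable (u : E -> R) : Prop :=
  measurable_fun setT u /\
  forall K : set E, compact K -> (\int[leb]_(x in K) (`|u x| ^+ 2)%R%:E < +oo)%E.

Definition essentially_bounded (A : set E) (u : E -> R) : Prop :=
  measurable_fun A u /\
  exists M : R, {ae leb, forall x, A x -> `|u x| <= M}.

Definition mass (w : E -> R) (s : R) : \bar R :=
  (s%:E * \int[leb]_(y in [set y | (1 <= eucl_norm y)%R])
            (w y / eucl_norm y `^ (d%:R + 2 * s))%R%:E)%E.

Definition has_alpha (w : E -> R) : Prop := cvg (mass w s @[s --> 0^'+]).

Definition alpha (w : E -> R) : \bar R := lim (mass w s @[s --> 0^'+]).

(* Boundary data are total functions of which only the values outside [Omega]
   matter. The pointwise powers of [zero_ext Omega v] are the extensions by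
   zero of those of [v], except that its power 0 is 1 on the whole space. *)
Definition zero_ext (Omega : set E) (v : E -> R) : E -> R :=
  patch (fun=> 0) (~` Omega) v.

Definition admissible (Omega : set E) (v : E -> R) : Prop :=
  [/\ essentially_bounded (~` Omega) v,
      has_alpha (fun y => Num.max (zero_ext Omega v y) 0),
      has_alpha (fun y => Num.max (- zero_ext Omega v y) 0) &
      has_alpha (fun y => zero_ext Omega v y ^+ 2)].

Definition Qset (Omega : set E) : set (E * E) :=
  ~` ((~` Omega) `*` (~` Omega)).

Definition seminorm2 (Omega : set E) (s : R) (u : E -> R) : \bar R :=
  (\int[leb \x leb]_(p in Qset Omega)
     (`|u p.1 - u p.2| ^+ 2 / eucl_norm (p.1 - p.2) `^ (d%:R + 2 * s))%R%:E)%E.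

Definition L2loc_Q (Omega : set E) (v u : E -> R) : Prop :=
  locally_square_integrable u /\
  {ae leb, forall x, (~` Omega) x -> u x = v x}.

Definition F_ (Omega : set E) (v : E -> R) (s : R) (u : E -> R) : \bar R :=
  if `[< L2loc_Q Omega v u >] then ((s / 2)%R%:E * seminorm2 Omega s u)%E
  else +oo%E.

Definition F0 (Omega : set E) (v : E -> R) (u : E -> R) : \bar R :=
  if `[< square_integrable Omega u >] then
    (\sum_(k < 3) ((-1) ^+ k * 'C(2, k)%:R)%R%:E
       * alpha (fun y => (zero_ext Omega v y ^+ k)%R)
       * \int[leb]_(x in Omega) (u x ^+ (2 - k))%R%:E)%E
  else +oo%E.

(* The functional on functions on [Omega]: [patch v Omega u] is [u] on [Omega]
   and [v] elsewhere. *)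
Definition F_on (Omega : set E) (v : E -> R) (s : R) (u : E -> R) : \bar R :=
  F_ Omega v s (patch v Omega u).

Definition weakL2_cvg (Omega : set E) (u_ : nat -> E -> R) (u : E -> R) : Prop :=
  [/\ forall j, square_integrable Omega (u_ j),
      square_integrable Omega u &
      forall phi, square_integrable Omega phi ->
        \int[leb]_(x in Omega) (u_ j x * phi x) @[j --> \oo] -->
        \int[leb]_(x in Omega) (u x * phi x)].

Definition Gamma_cvg_weakL2 (Omega : set E)
    (F : R -> (E -> R) -> \bar R) (G : (E -> R) -> \bar R) : Prop :=
  forall s_ : nat -> R, (forall j, 0 < s_ j < 1) -> s_ j @[j --> \oo] --> 0 ->
  (forall u_ u, weakL2_cvg Omega u_ u ->
     (G u <= limn_einf (fun j => F (s_ j) (u_ j)))%E) /\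
  (forall u, square_integrable Omega u ->
     exists2 u_, weakL2_cvg Omega u_ u &
       (limn_esup (fun j => F (s_ j) (u_ j)) <= G u)%E).

End functionals.

(* Main.v *)
Require Import Defs.
From mathcomp Require Import all_boot all_order all_algebra.
From mathcomp Require Import all_classical all_reals all_analysis.
From mathcomp Require Import measurable_realfun ring lra.

(** As s tends to 0 the factor s kills every interaction at bounded distance,
    and what survives of F_s(u) is the interaction of Omega with infinity.
    There, for x in the bounded set Omega, the kernel |x - y|^(-d-2s) may be
    replaced by |y|^(-d-2s), so that for every real number a

      s * int_(|y| >= rho) (a - v y)^2 |x - y|^(-d-2s) dy

    is close to q(a) := alpha(1) a^2 - 2 alpha(v) a + alpha(v^2). The crucial
    point is that the closeness is uniform: the error is at most e (1 + a^2)
    for all x in Omega and all a, once rho is large and s small (far_limit).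
    Integrating at a = u(x) over Omega gives the limit functional. The kernel
    is symmetric, so the pairs Omega x far and far x Omega contribute equally
    and absorb the factor 1/2 of F_s.

    Lower bound. All terms being nonnegative, the near interactions are
    discarded, whence F_s(w) >= G(w) - e (|Omega| + int w^2), where G is the
    integral of q(w) and the error is uniform in w (energy_lower). If u_j
    tends to u weakly, then int u_j^2 >= 2 int u_j u - int u^2, and since
    alpha(1) > 0 (mass_tends1) this gives the liminf inequality; choosing
    e <= alpha(1) absorbs the error term in int u_j^2, which then needs no
    a priori bound (energy_liminf).

    Upper bound. The near interactions are O(s) for a bounded function w that
    changes little under translations, in the sense that
    |{x in Omega : w x <> w (x + z)}| <= C |z|: by Tonelli they are at most
    4 M^2 C int_(|z| < 2 rho) |z|^(1-d-2s) dz, which is bounded for s <= 1/4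
    (near_bound). Two facts make such functions usable.
    - They are dense in L^2(Omega). They are stable under the pointwise
      operations and contain the indicators of coordinate half-spaces; the
      sets whose indicator they approximate form a sigma-algebra, hence are
      all the Borel sets (approximable_L2).
    - Gluing w to v across the boundary preserves the property, because
      |{x in Omega : x + z outside Omega}| <= C |z| for a bounded Lipschitz
      domain (exits_bound). Near a boundary point the points which exit lie
      in a layer of thickness t = O(|z|) above the Lipschitz graph. No
      coordinates of the graph need to be integrated out: about 1/t
      translates of that layer along the axis of the graph are disjoint and
      remain in a fixed ball, so the layer has measure O(t)
      (stacked_translates). Compactness of the closure concludes.
    A recovery sequence for u is then a diagonal sequence of such functions,
    which converges strongly, hence weakly, to u (energy_limsup).

    The masses alpha are computed from dyadic shells: scaling the kernel
    |x|^(-p) turns integrals inside and outside a ball into geometric series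
    of ratio 2^(-|d - p|), with no use of polar coordinates
    (integral_riesz_far, integral_riesz_near, mass_one). *)

Set Implicit Arguments.
Unset Strict Implicit.
Unset Printing Implicit Defensive.

Import Order.TTheory GRing.Theory Num.Theory.
Import numFieldNormedType.Exports.

Local Open Scope classical_set_scope.
Local Open Scope ring_scope.

(** * The Euclidean norm *)

Section euclidean_norm.
Context {R : realType}.

Lemma eucl_norm_ge0 n (x : 'rV[R]_n) : 0 <= eucl_norm x.
Proof. exact: sqrtr_ge0. Qed.

Lemma eucl_norm_sqr n (x : 'rV[R]_n) :
  eucl_norm x ^+ 2 = \sum_(i < n) x ord0 i ^+ 2.
Proof. by rewrite sqr_sqrtr// sumr_ge0// => i _; exact: sqr_ge0. Qed.

Lemma eucl_norm_le n (x : 'rV[R]_n) (a : R) :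
  0 <= a -> \sum_(i < n) x ord0 i ^+ 2 <= a ^+ 2 -> eucl_norm x <= a.
Proof.
by move=> a0; rewrite -eucl_norm_sqr ler_pXn2r// nnegrE// eucl_norm_ge0.
Qed.

Lemma eucl_normZ n (a : R) (x : 'rV[R]_n) :
  eucl_norm (a *: x) = `|a| * eucl_norm x.
Proof.
rewrite -[`|a|]sqrtr_sqr -sqrtrM ?sqr_ge0// mulr_sumr; congr Num.sqrt.
by apply: eq_bigr => i _; rewrite mxE exprMn.
Qed.

Lemma eucl_normN n (x : 'rV[R]_n) : eucl_norm (- x) = eucl_norm x.
Proof. by rewrite -scaleN1r eucl_normZ normrN1 mul1r. Qed.

Lemma eucl_normBC n (x y : 'rV[R]_n) : eucl_norm (x - y) = eucl_norm (y - x).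
Proof. by rewrite -eucl_normN opprB. Qed.

Lemma coord_le_eucl_norm n (x : 'rV[R]_n) i : `|x ord0 i| <= eucl_norm x.
Proof.
rewrite -sqrtr_sqr ler_sqrt; last by rewrite sumr_ge0// => j _; exact: sqr_ge0.
by rewrite (bigD1 i)//= lerDl sumr_ge0// => j _; exact: sqr_ge0.
Qed.

Lemma eucl_norm_le_coord n (x : 'rV[R]_n) (m : R) : 0 <= m ->
  (forall i, `|x ord0 i| <= m) -> eucl_norm x <= n%:R * m.
Proof.
move=> m0 xm; apply: eucl_norm_le; first exact: mulr_ge0.
apply: (@le_trans _ _ (\sum_(i < n) m ^+ 2)).
  by apply: ler_sum => i _; rewrite -real_normK ?num_real// ler_pXn2r// nnegrE.
rewrite sumr_const card_ord exprMn -[leLHS]mulr_natl ler_wpM2r ?sqr_ge0//.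
by rewrite -natrX ler_nat; case: n {x xm} => // n; exact: leq_pmulr.
Qed.

Lemma eucl_norm_eq0 n (x : 'rV[R]_n) : eucl_norm x = 0 -> x = 0.
Proof.
move=> x0; apply/rowP => i; apply/eqP; rewrite mxE -normr_le0 -x0.
exact: coord_le_eucl_norm.
Qed.

Lemma eucl_cauchy_schwarz n (x y : 'rV[R]_n) :
  \sum_(i < n) x ord0 i * y ord0 i <= eucl_norm x * eucl_norm y.
Proof.
set a := eucl_norm x; set b := eucl_norm y.
have [a0|a0] := eqVneq a 0.
  rewrite a0 mul0r big1// => i _; rewrite (eucl_norm_eq0 a0) mxE mul0r//.
have [b0|b0] := eqVneq b 0.
  rewrite b0 mulr0 big1// => i _; rewrite (eucl_norm_eq0 b0) mxE mulr0//.
have apos : 0 < a by rewrite lt_neqAle eq_sym a0 eucl_norm_ge0.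
have bpos : 0 < b by rewrite lt_neqAle eq_sym b0 eucl_norm_ge0.
have : 0 <= \sum_(i < n) (b * x ord0 i - a * y ord0 i) ^+ 2.
  by rewrite sumr_ge0// => i _; exact: sqr_ge0.
have -> : \sum_(i < n) (b * x ord0 i - a * y ord0 i) ^+ 2 =
    b ^+ 2 * (\sum_(i < n) x ord0 i ^+ 2)
    + a ^+ 2 * (\sum_(i < n) y ord0 i ^+ 2)
    - 2 * a * b * \sum_(i < n) x ord0 i * y ord0 i.
  rewrite !mulr_sumr -sumrN -!big_split/=.
  by apply: eq_bigr => i _; ring.
rewrite -!eucl_norm_sqr -/a -/b; set S := \sum_(i < n) _ => H.
have ab0 : 0 < a * b by rewrite mulr_gt0.
by rewrite -(ler_pM2l ab0); nra.
Qed.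

Lemma eucl_normD n (x y : 'rV[R]_n) :
  eucl_norm (x + y) <= eucl_norm x + eucl_norm y.
Proof.
apply: eucl_norm_le; first by rewrite addr_ge0// eucl_norm_ge0.
have -> : \sum_(i < n) (x + y) ord0 i ^+ 2 = eucl_norm x ^+ 2 +
    eucl_norm y ^+ 2 + 2 * \sum_(i < n) x ord0 i * y ord0 i.
  rewrite !eucl_norm_sqr mulr_sumr -!big_split/=.
  by apply: eq_bigr => i _; rewrite mxE; ring.
by have := eucl_cauchy_schwarz x y; nra.
Qed.

Lemma eucl_normB n (x y : 'rV[R]_n) :
  eucl_norm x - eucl_norm y <= eucl_norm (x - y).
Proof. by rewrite lerBlDr -{1}(subrK y x); exact: eucl_normD. Qed.

(** Lets the graph coordinates of a Lipschitz domain be rotated freely. *)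
Lemma eucl_norm_mulmx n (O : 'M[R]_n) (x : 'rV[R]_n) : O *m O^T = 1%:M ->
  eucl_norm (x *m O) = eucl_norm x.
Proof.
have E (y : 'rV[R]_n) : \sum_(i < n) y ord0 i ^+ 2 = (y *m y^T) ord0 ord0.
  by rewrite mxE; apply: eq_bigr => i _; rewrite !mxE expr2.
move=> OO; rewrite /eucl_norm !E trmx_mul -mulmxA (mulmxA O) OO mul1mx//.
Qed.

Lemma measurable_eucl_norm n :
  measurable_fun [set: 'rV[R]_n] (@eucl_norm R n).
Proof.
apply: (@measurableT_comp _ _ _ _ _ _ (@Num.sqrt R)).
  exact: continuous_measurable_fun (@sqrt_continuous R).
apply: measurable_sum => i; apply: measurable_funX; exact: measurable_coor.
Qed.

End euclidean_norm.

(** * Lebesgue measure on row vectors *)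

#[global] Arguments lebesgue_rV : simpl never.

Section lebesgue_rV_theory.
Context {R : realType}.
Local Open Scope ereal_scope.

Definition box n (B : 'I_n -> set R) : set 'rV[R]_n :=
  [set x | forall i, B i (x ord0 i)].

Lemma measurable_box n (B : 'I_n -> set R) :
  (forall i, measurable (B i)) -> measurable (box B).
Proof.
move=> mB.
have -> : box B = \bigcap_(i in [set: 'I_n])
    ((fun x : 'rV[R]_n => x ord0 i) @^-1` B i).
  by apply/seteqP; split=> [x Bx i _|x Bx i]; exact: Bx.
apply: fin_bigcap_measurable => // i _.
by rewrite -[X in measurable X]setTI; exact: measurable_coor.
Qed.

Lemma lebesgue_box n (B : 'I_n -> set R) :
  (forall i, measurable (B i)) ->
  lebesgue_rV n (box B) = \prod_(i < n) lebesgue_measure (B i).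
Proof. exact: lebesgue_rV_box. Qed.

(** Induction over the Borel sets, starting from the cylinders over one
    coordinate. *)
Lemma measurable_rV_ind n (P : set (set 'rV[R]_n)) : sigma_algebra setT P ->
    (forall i (B : set R), measurable B -> P [set x | B (x ord0 i)]) ->
  forall A, measurable A -> P A.
Proof.
move=> sP PB; apply: smallest_sub => // A.
rewrite -bigcup_seq/= => -[i _ [B mB <-]].
by rewrite setTI; exact: PB.
Qed.

(** Boxes are stable under intersection, generate the sigma-algebra, and
    exhaust the space by boxes of finite measure. *)
Lemma lebesgue_rV_unique n (mu : {measure set 'rV[R]_n -> \bar R}) :
    (forall B : 'I_n -> set R, (forall i, measurable (B i)) ->
      mu (box B) = \prod_(i < n) lebesgue_measure (B i)) ->
  forall A, measurable A -> mu A = lebesgue_rV n A.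
Proof.
move=> muB A mA.
pose G := [set A | exists2 B : 'I_n -> set R,
  (forall i, measurable (B i)) & A = box B].
pose g k : set 'rV[R]_n := box (fun=> `[- k%:R, k%:R]%classic%R).
have Gg k : G (g k) by exists (fun=> `[- k%:R, k%:R]%classic%R).
apply/esym; apply: (@measure_unique _ _ _ G g _ _ _ _
    (lebesgue_rV n) mu _ _ _ mA).
- apply/seteqP; split.
    apply: measurable_rV_ind; first exact: smallest_sigma_algebra.
    move=> i B mB; apply: sub_sigma_algebra.
    exists (fun j => if j == i then B else setT).
      by move=> j; case: ifP.
    apply/seteqP; split => [x Bx j|x /(_ i)]; last by rewrite eqxx.
    by case: ifPn => // /eqP ->.
  apply: smallest_sub; first exact: sigma_algebra_measurable.
  by move=> _ [B mB ->]; exact: measurable_box.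
- move=> _ _ [B mB ->] [C mC ->]; exists (fun i => B i `&` C i).
    by move=> i; exact: measurableI.
  apply/seteqP; split => [x [Bx Cx] i//|x BCx].
  by split => i; have [] := BCx i.
- exact: Gg.
- rewrite -subTset => x _.
  exists (Num.bound (eucl_norm x)) => // i /=; rewrite in_itv/= -ler_norml.
  apply: (le_trans (coord_le_eucl_norm x i)).
  exact/ltW/archi_boundP/eucl_norm_ge0.
- by move=> _ [B mB ->]; exact: etrans (lebesgue_box mB) (esym (muB _ mB)).
- move=> k; rewrite /g/= lebesgue_box// ltey_eq.
  rewrite (_ : _ \is a fin_num)//.
  apply: (big_ind (fun x => x \is a fin_num)) => //.
    exact: fin_numM.
  by move=> i _; rewrite lebesgue_measure_itv/=; case: ifP.
Qed.

Lemma affine_preimage_itv (c z a b : R) : (0 < c)%R ->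
  (fun x => c * x + z)%R @^-1` `]a, b]%classic =
  `](a - z) / c, (b - z) / c]%classic%R.
Proof.
move=> c0; apply/seteqP; split => x /=;
  by rewrite !in_itv/= ltr_pdivrMr// ler_pdivlMr// ltrBlDr lerBrDr (mulrC x).
Qed.

Lemma measurable_affine (c z : R) :
  measurable_fun setT (fun x => c * x + z : measurableTypeR R)%R.
Proof. exact: measurable_funD. Qed.

Lemma lebesgue_measure_affine (c z : R) (A : set R) : (0 < c)%R ->
  measurable A ->
  c%:E * lebesgue_measure ((fun x => c * x + z)%R @^-1` A) =
  lebesgue_measure A.
Proof.
move=> c0 mA; apply/esym.
have mphi := measurable_affine c z.
pose nu := mscale (NngNum (ltW c0)) (
  measure_function_pushforward__canonical__measure_function_Measure
  (@lebesgue_measure R) mphi).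
apply: (@lebesgue_measure_unique _ nu) mA => _ [[a b]] _ <-.
transitivity (c%:E * lebesgue_measure ((fun x => c * x + z)%R @^-1` `]a, b]));
  last by [].
rewrite affine_preimage_itv//.
rewrite !lebesgue_measure_itv/= !lte_fin ltr_pM2r ?invr_gt0//.
rewrite ltrD2r; case: ifPn => ab; last by rewrite mule0.
rewrite -!EFinB -EFinM; congr EFin.
by rewrite -mulrBl mulrC divfK ?gt_eqF//; ring.
Qed.

Lemma measurable_rV_affine n (c : R) (z : 'rV[R]_n) :
  measurable_fun setT (fun x : 'rV[R]_n => c *: x + z)%R.
Proof.
apply/measurable_fun_rVP => i.
under eq_fun do rewrite !mxE.
apply: measurable_funD => //; apply: measurable_funM => //.
exact: measurable_coor.
Qed.

(** Both sides are measures that agree on boxes, where the one-dimensional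
    change of variables applies in each coordinate. *)
Lemma lebesgue_rV_affine n (c : R) (z : 'rV[R]_n) A : (0 < c)%R ->
  measurable A ->
  (c ^+ n)%:E * lebesgue_rV n ((fun x : 'rV[R]_n => c *: x + z)%R @^-1` A) =
  lebesgue_rV n A.
Proof.
move=> c0 mA.
have mphi := measurable_rV_affine c z.
have cn0 : (0 <= c ^+ n)%R by rewrite exprn_ge0// ltW.
pose nu := mscale (NngNum cn0) (
  measure_function_pushforward__canonical__measure_function_Measure
  (lebesgue_rV n) mphi).
apply: (@lebesgue_rV_unique _ nu _ _ mA) => B mB.
transitivity ((c ^+ n)%:E *
  lebesgue_rV n ((fun x : 'rV[R]_n => c *: x + z)%R @^-1` box B)); first by [].
have -> : (fun x : 'rV[R]_n => c *: x + z)%R @^-1` box B =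
    box (fun i => (fun x => c * x + z ord0 i)%R @^-1` B i).
  by apply/seteqP; split => x /= Bx i; have := Bx i; rewrite !mxE.
rewrite lebesgue_box; last first.
  move=> i; rewrite -[X in measurable X]setTI.
  by apply: measurable_affine => //; exact: mB.
have -> : (c ^+ n)%:E = \prod_(i < n) c%:E :> \bar R.
  by rewrite prodEFin prodr_const card_ord.
rewrite -big_split/=.
by apply: eq_bigr => i _; rewrite lebesgue_measure_affine.
Qed.

Lemma ge0_integral_affine n (c : R) (z : 'rV[R]_n) D
    (f : 'rV[R]_n -> \bar R) : (0 < c)%R ->
  measurable D -> measurable_fun D f -> (forall x, D x -> 0 <= f x) ->
  \int[lebesgue_rV n]_(x in D) f x = (c ^+ n)%:E *
  \int[lebesgue_rV n]_(x in [set x : 'rV[R]_n | D (c *: x + z)%R])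
     f (c *: x + z)%R.
Proof.
move=> c0 mD mf f0.
have mphi := measurable_rV_affine c z.
have cn0 : (0 <= c ^+ n)%R by rewrite exprn_ge0// ltW.
pose nu := measure_function_pushforward__canonical__measure_function_Measure
  (lebesgue_rV n) mphi.
transitivity (\int[mscale (NngNum cn0) nu]_(x in D) f x).
  apply: eq_measure_integral => A mA _.
  exact: esym (lebesgue_rV_affine z c0 mA).
rewrite ge0_integral_mscale//; congr (_ * _).
by apply: ge0_integral_pushforward => // x /set_mem; exact: f0.
Qed.

Lemma ge0_integral_translation n (z : 'rV[R]_n) D (f : 'rV[R]_n -> \bar R) :
  measurable D -> measurable_fun D f -> (forall x, D x -> 0 <= f x) ->
  \int[lebesgue_rV n]_(x in D) f x =
  \int[lebesgue_rV n]_(x in [set x : 'rV[R]_n | D (x + z)%R]) f (x + z)%R.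
Proof.
move=> mD mf f0; rewrite (ge0_integral_affine z (@ltr01 R) mD mf f0).
rewrite expr1n mul1e.
have -> : [set x : 'rV[R]_n | D (1 *: x + z)%R] = [set x | D (x + z)%R].
  by apply/seteqP; split => x /=; rewrite scale1r.
by apply: eq_integral => x _; rewrite scale1r.
Qed.

Lemma lebesgue_rV_translation n (z : 'rV[R]_n) A : measurable A ->
  lebesgue_rV n [set x : 'rV[R]_n | A (x + z)%R] = lebesgue_rV n A.
Proof.
move=> mA; rewrite -[RHS](lebesgue_rV_affine z (@ltr01 R) mA).
rewrite expr1n mul1e; congr (lebesgue_rV n _).
by apply/seteqP; split => x /=; rewrite scale1r.
Qed.

End lebesgue_rV_theory.

(** * Topology and measurability of row vectors *)

Section rV_sets.
Context {R : realType}.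

Lemma measurable_preimageT d d' (T : measurableType d) (T' : measurableType d')
    (f : T -> T') (B : set T') :
  measurable_fun setT f -> measurable B -> measurable (f @^-1` B).
Proof. by move=> mf mB; rewrite -[X in measurable X]setTI; exact: mf. Qed.

Lemma measurable_ltr d (T : measurableType d) (f g : T -> R) :
  measurable_fun setT f -> measurable_fun setT g ->
  measurable [set x | f x < g x].
Proof.
move=> mf mg.
exact: (measurable_preimageT (measurable_fun_ltr mf mg) (B := [set true])).
Qed.

Lemma measurable_ler d (T : measurableType d) (f g : T -> R) :
  measurable_fun setT f -> measurable_fun setT g ->
  measurable [set x | f x <= g x].
Proof.
move=> mf mg.
exact: (measurable_preimageT (measurable_fun_ler mf mg) (B := [set true])).
Qed.

Lemma open_eucl_norm n (A : set 'rV[R]_n) x : open A -> A x ->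
  exists2 e : R, 0 < e & forall y, eucl_norm (y - x) < e -> A y.
Proof.
rewrite openE => oA /oA /nbhs_ballP[e /= e0 eA]; exists e => // y yx.
apply: eA; split => // i j; rewrite ord1 /ball/= distrC.
apply: le_lt_trans yx; have := coord_le_eucl_norm (y - x) j.
by rewrite !mxE.
Qed.

(** The topology comes from the sup norm, which is at least 1/n times the
    Euclidean norm. *)
Lemma nbhs_eucl_norm n (x : 'rV[R]_n) (e : R) : 0 < e ->
  nbhs x [set y | eucl_norm (y - x) < e].
Proof.
move=> e0; apply/nbhs_ballP; exists (e / n.+1%:R) => /=.
  by rewrite divr_gt0.
move=> y [_ xy] /=.
apply: (@le_lt_trans _ _ (n%:R * (e / n.+1%:R))).
  apply: eucl_norm_le_coord => [|i]; first by rewrite ltW// divr_gt0.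
  by have := xy ord0 i; rewrite /ball/= !mxE distrC => /ltW.
rewrite mulrC -mulrA gtr_pMr// mulrC ltr_pdivrMr// mul1r.
by rewrite ltr_nat.
Qed.

(** An open set is the union of the boxes with rational centre and width
    2/(k+1) that it contains, and there are countably many of them. *)
Lemma open_measurable_rV n (A : set 'rV[R]_n) : open A -> measurable A.
Proof.
move=> oA.
pose I := ('rV[rat]_n * nat)%type.
pose C (p : I) : set 'rV[R]_n :=
  box (fun i => [set t : R | `|t - ratr (p.1 ord0 i)| < p.2.+1%:R^-1]).
pose B (p : I) := if `[< C p `<=` A >] then C p else set0.
have -> : A = \bigcup_p B p.
  apply/seteqP; split => [x Ax|x [p _]]; last first.
    by rewrite /B; case: ifPn => // /asboolP; exact.
  move: oA; rewrite openE => /(_ _ Ax)/nbhs_ballP[e /= e0 eA].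
  pose k := Num.bound (2 / e).
  (* Twice the half-width of the box, which contains x off its centre. *)
  have k2 : k.+1%:R^-1 + k.+1%:R^-1 < e.
    have : 2 / e < k.+1%:R.
      apply: (@lt_le_trans _ _ k%:R); last by rewrite ler_nat.
      by apply: archi_boundP; rewrite divr_ge0// ltW.
    rewrite ltr_pdivrMr// => ke.
    rewrite -(ltr_pM2l (ltr0Sn R k)) mulrDr divff ?pnatr_eq0//.
  have /choice[q qP] : forall i : 'I_n, exists q : rat,
      `|x ord0 i - ratr q| < k.+1%:R^-1.
    move=> i.
    have [q] : exists q, ratr q \in
        `]x ord0 i - k.+1%:R^-1, x ord0 i + k.+1%:R^-1[.
      apply: rat_in_itvoo.
      by rewrite ltrBlDr -addrA ltrDl addr_gt0.
    rewrite in_itv/= => /andP[q1 q2]; exists q.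
    move: q1 q2; set dl := k.+1%:R^-1 => q1 q2.
    by rewrite distrC ltr_norml; apply/andP; split; lra.
  exists (\row_i q i, k) => //; rewrite /B asboolT.
    by move=> i /=; rewrite mxE.
  move=> y Cy; apply: eA; split => // i j; rewrite ord1 /ball/=.
  apply: le_lt_trans k2.
  rewrite -(subrKA (ratr (q j))); apply: (le_trans (ler_normD _ _)).
  rewrite lerD ?(ltW (qP _))// distrC.
  by have := Cy j; rewrite /= mxE => /ltW.
apply: countable_bigcupT_measurable => [|p]; first exact: countableP.
rewrite /B; case: ifPn => // _; apply: measurable_box => i.
apply: measurable_ltr => //; apply: measurableT_comp => //.
exact: measurable_funB.
Qed.

Lemma closed_measurable_rV n (A : set 'rV[R]_n) : closed A -> measurable A.
Proof.
by move=> cA; rewrite -[A]setCK; apply: measurableC;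
  apply: open_measurable_rV; rewrite openC.
Qed.

Definition eball n (r : R) : set 'rV[R]_n := [set x | eucl_norm x < r].
Arguments eball : clear implicits.

Lemma measurable_eball n r : measurable (eball n r).
Proof. by apply: measurable_ltr => //; exact: measurable_eucl_norm. Qed.

Lemma lebesgue_eball n r : (lebesgue_rV n (eball n r) < +oo)%E.
Proof.
have mB : forall i : 'I_n, measurable (`[- r, r]%classic : set R) by [].
apply: (@le_lt_trans _ _ (lebesgue_rV n (box (fun=> `[- r, r]%classic)))).
  apply: le_measure; rewrite ?inE//=.
  - exact: measurable_eball.
  - exact: measurable_box.
  - move=> x /ltW xr i /=; rewrite in_itv/= -ler_norml.
    exact: le_trans (coord_le_eucl_norm x i) xr.
rewrite lebesgue_box// ltey_eq (_ : _ \is a fin_num)//.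
apply: (big_ind (fun x => x \is a fin_num)%E) => //; first exact: fin_numM.
by move=> i _; rewrite lebesgue_measure_itv/=; case: ifP.
Qed.

Lemma bounded_set_eball n (A : set 'rV[R]_n) : bounded_set A ->
  exists2 r : R, 0 < r & A `<=` eball n r.
Proof.
move=> [M [_ /(_ (`|M| + 1))]].
rewrite (le_lt_trans (ler_norm _)) ?ltrDl// => /(_ isT) MA.
exists (n%:R * (`|M| + 1) + 1); first by rewrite ltr_wpDl// mulr_ge0// addr_ge0.
move=> x /MA /= xM; rewrite /eball/=.
rewrite (@le_lt_trans _ _ (n%:R * (`|M| + 1)))// ?ltrDl//.
apply: eucl_norm_le_coord => [|i]; first exact: addr_ge0.
apply: le_trans xM.
rewrite [leRHS]mx_normrE.
exact: (le_bigmax _ (fun ij : 'I_1 * 'I_n => `|x ij.1 ij.2|) (ord0, i)).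
Qed.

Lemma bounded_set_fin_measure n (A : set 'rV[R]_n) : measurable A ->
  bounded_set A -> (lebesgue_rV n A < +oo)%E.
Proof.
move=> mA /bounded_set_eball[r r0 Ar].
apply: le_lt_trans (lebesgue_eball n r).
by apply: le_measure; rewrite ?inE//=; exact: measurable_eball.
Qed.

End rV_sets.
Arguments eball {R} n r.

(** * Dyadic shells and the kernel |x|^(-p) *)

Lemma geometric_nneseries (R : realType) (a q : R) : 0 <= q < 1 ->
  (\sum_(0 <= k <oo) (a * q ^+ k)%:E = (a / (1 - q))%:E)%E.
Proof.
move=> /andP[q0 q1]; apply: cvg_lim => //.
rewrite (_ : (fun n => _) = EFin \o series (geometric a q)); last first.
  by apply/funext => n /=; rewrite sumEFin.
apply: cvg_EFin; first by apply: nearW.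
by apply: cvg_geometric_series; rewrite ger0_norm.
Qed.

Lemma exp2_unbounded (R : realType) (t : R) : exists k, t < 2 ^+ k.
Proof.
exists (Num.bound `|t|); apply: (@le_lt_trans _ _ `|t|); first exact: ler_norm.
apply: (@lt_le_trans _ _ (Num.bound `|t|)%:R); first exact: archi_boundP.
by rewrite -natrX ler_nat ltnW// ltn_expl.
Qed.

Lemma dyadic_ge1 (R : realType) (t : R) : 1 <= t ->
  exists k, 2 ^+ k <= t < 2 ^+ k.+1.
Proof.
move=> t1; have := exp2_unbounded t => ex.
case: (ex_minnP ex) => -[|m] tm min.
  by move: tm; rewrite expr0 ltNge t1.
exists m; rewrite tm andbT leNgt; apply/negP => /min.
by rewrite ltnn.
Qed.

Lemma dyadic_lt1 (R : realType) (t : R) : 0 < t < 1 ->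
  exists k, 2^-1 ^+ k.+1 <= t < 2^-1 ^+ k.
Proof.
move=> /andP[t0 t1]; have ex : exists k, 2^-1 ^+ k <= t.
  have [k tk] := exp2_unbounded t^-1; exists k.
  by rewrite exprVn -[leRHS]invrK lef_pV2 ?posrE ?exprn_gt0 ?invr_gt0// ltW.
case: (ex_minnP ex) => -[|m] tm min.
  by move: t1; rewrite ltNge tm.
exists m; rewrite tm/= ltNge; apply/negP => /min.
by rewrite ltnn.
Qed.

Section shells.
Context {R : realType} {n : nat}.
Local Notation E := 'rV[R]_n.
Local Notation leb := (@lebesgue_rV R n).
Local Open Scope ereal_scope.

Definition riesz (p : R) (x : E) : R := ((eucl_norm x `^ p)^-1)%R.

Lemma riesz_ge0 p x : (0 <= riesz p x)%R.
Proof. by rewrite invr_ge0 powR_ge0. Qed.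

Lemma measurable_riesz p : measurable_fun setT (riesz p).
Proof.
rewrite (_ : riesz p = (fun a => a `^ - p)%R \o @eucl_norm R n).
  by apply: measurableT_comp; [exact: measurable_powR|
    exact: measurable_eucl_norm].
by apply/funext => x /=; rewrite powRN.
Qed.

Lemma rieszZ p (c : R) x : (0 < c)%R ->
  riesz p (c *: x)%R = (c `^ (- p) * riesz p x)%R.
Proof.
move=> c0; rewrite /riesz eucl_normZ gtr0_norm// powRM ?eucl_norm_ge0 ?(ltW c0)//.
by rewrite invfM powRN.
Qed.

Definition shell (l h : R) : set E :=
  [set x | (l <= eucl_norm x)%R /\ (eucl_norm x < h)%R].

Lemma measurable_shell l h : measurable (shell l h).
Proof.
apply: measurableI.
  by apply: measurable_ler => //; exact: measurable_eucl_norm.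
exact: measurable_eball.
Qed.

Lemma trivIset_shell (l h : nat -> R) :
  (forall i j, (i < j)%N -> (h i <= l j \/ h j <= l i)%R) ->
  trivIset setT (fun k => shell (l k) (h k)).
Proof.
move=> lh; apply/trivIsetP => i j _ _; wlog ij : i j / (i < j)%N => [wlg|_].
  rewrite neq_ltn => /orP[] ij; first by rewrite wlg// neq_ltn ij.
  by rewrite setIC wlg// neq_ltn ij.
rewrite -subset0 => x [[li hi] [lj hj]] /=.
have [/(lt_le_trans hi)/lt_le_trans/(_ lj)|] := lh _ _ ij.
  by rewrite ltxx.
by move=> /(lt_le_trans hj)/lt_le_trans/(_ li); rewrite ltxx.
Qed.

(** The kernel is homogeneous, so its integral over a shell scales like the
    radius to the power n - p: this replaces polar coordinates. *)
Lemma integral_shellZ p (c : R) : (0 < c)%R ->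
  \int[leb]_(x in shell c (2 * c)) (riesz p x)%:E =
  (c `^ (n%:R - p))%:E * \int[leb]_(x in shell 1 2) (riesz p x)%:E.
Proof.
move=> c0; rewrite (ge0_integral_affine 0 c0); last 3 first.
- exact: measurable_shell.
- by apply/measurable_EFinP; apply: measurable_funTS; exact: measurable_riesz.
- by move=> x _; rewrite lee_fin riesz_ge0.
have -> : [set x : E | shell c (2 * c) (c *: x + 0)%R] = shell 1 2.
  apply/seteqP; split => x /=; rewrite /shell/= addr0 eucl_normZ gtr0_norm//;
  by rewrite mulrC ler_pMl// ltr_pM2r.
under eq_integral do rewrite addr0 rieszZ// EFinM.
rewrite ge0_integralZl_EFin//; last 4 first.
- exact: measurable_shell.
- by move=> x _; rewrite lee_fin riesz_ge0.
- by apply/measurable_EFinP; apply: measurable_funTS; exact: measurable_riesz.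
- exact: powR_ge0.
rewrite muleA -EFinM -powR_mulrn ?ltW// powRD//.
by rewrite (gt_eqF c0) implybT.
Qed.

Lemma shell_lty : leb (shell 1 2) < +oo.
Proof.
apply: le_lt_trans (lebesgue_eball n 2).
by apply: le_measure; rewrite ?inE//=; [exact: measurable_shell|
  exact: measurable_eball|by move=> x []].
Qed.

(** Otherwise the balls of radii 1 and 2 would have the same measure, while
    scaling gives them the ratio 2^n. *)
Lemma shell_gt0 : (0 < n)%N -> 0 < leb (shell 1 2).
Proof.
move=> n0; have ball0 : 0 < leb (eball n 1).
  pose c : R := ((2 * n.+1%:R)^-1)%R.
  have c0 : (0 < c)%R by rewrite invr_gt0 mulr_gt0.
  apply: (@lt_le_trans _ _ (leb (box (fun=> `[- c, c]%classic%R)))).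
    rewrite lebesgue_box//.
    apply: (big_ind (fun x => 0 < x)) => //; first exact: mule_gt0.
    move=> i _; rewrite lebesgue_measure_itv/= lte_fin gtrN// -EFinB lte_fin.
    by rewrite opprK addr_gt0.
  apply: le_measure; rewrite ?inE//=.
  - exact: measurable_box.
  - exact: measurable_eball.
  - move=> x xc; rewrite /eball/=.
    apply: (@le_lt_trans _ _ (n%:R * c)%R).
      apply: eucl_norm_le_coord => [|i]; first exact: ltW.
      by have := xc i; rewrite /= in_itv/= ler_norml.
    by rewrite ltr_pdivrMr ?mulr_gt0// mul1r -natrM ltr_nat mul2n -addnn ltn_addr.
have ball2 : leb (eball n 2) = (2 ^+ n)%:E * leb (eball n 1).
  rewrite -(lebesgue_rV_affine 0 (ltr0Sn R 1) (measurable_eball 2)).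
  congr (_ * leb _); apply/seteqP; split => x; rewrite /eball/= addr0 eucl_normZ;
  by rewrite gtr0_norm// gtr_pMr.
have ballU : leb (eball n 2) = leb (eball n 1) + leb (shell 1 2).
  rewrite -measureU/=; last 3 first.
  - exact: measurable_eball.
  - exact: measurable_shell.
  - by rewrite -subset0 => x [x1 [x2 _]]; move: x1; rewrite /eball/= ltNge x2.
  congr (leb _); apply/seteqP; split => x /=; rewrite /eball/shell/=.
    by move=> x2; case: (ltP (eucl_norm x) 1%R) => x1; [left|right].
  by case=> [x1|[]//]; rewrite (lt_trans x1)// ltr1n.
have := lebesgue_eball n (1%R : R).
move: ball0 ballU; rewrite ball2; case: (leb (eball _ _)) => // b.
rewrite lte_fin => b0; case: (leb (shell 1 2)) => //=.
move=> v; rewrite -EFinM -EFinD lte_fin => -[bv] _.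
have : (b * 2 <= 2 ^+ n * b)%R.
  by rewrite mulrC ler_pM2r// -(prednK n0) exprS ler_peMr// exprn_ege1// ler1n.
rewrite bv; lra.
Qed.

End shells.

Lemma powR_exprn (R : realType) (c a : R) k : 0 <= c ->
  (c ^+ k) `^ a = (c `^ a) ^+ k.
Proof.
by move=> c0; rewrite -powR_mulrn// -powRrM mulrC powRrM powR_mulrn// powR_ge0.
Qed.

Lemma powR_lt1 (R : realType) (a x : R) : 0 < a -> x * ln a < 0 -> a `^ x < 1.
Proof. by move=> a0 xa; rewrite /powR gt_eqF// -[ltRHS]expR0 ltr_expR. Qed.

Section riesz_integrals.
Context {R : realType} {n : nat}.
Local Notation E := 'rV[R]_n.
Local Notation leb := (@lebesgue_rV R n).
Local Notation d := (n%:R : R).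
Local Open Scope ereal_scope.

Definition shell_integral (p : R) : \bar R :=
  \int[leb]_(x in shell 1 2) (@riesz R n p x)%:E.

Lemma measurable_rieszE p (D : set E) :
  measurable_fun D (fun x => (riesz p x)%:E).
Proof.
by apply/measurable_EFinP; apply: measurable_funTS; exact: measurable_riesz.
Qed.

Lemma rieszD p t (x : E) : (0 < eucl_norm x)%R ->
  riesz (p + t) x = (riesz p x * riesz t x)%R.
Proof.
move=> x0; rewrite /riesz powRD ?invfM//.
by rewrite (gt_eqF x0) implybT.
Qed.

Lemma shell_integral_bounds p t : (0 <= t)%R ->
  (2 `^ (- t))%:E * shell_integral p <= shell_integral (p + t) <=
    shell_integral p.
Proof.
move=> t0; have ms := @measurable_shell R n 1 2.
have kt (x : E) : shell 1 2 x -> (2 `^ (- t) <= riesz t x <= 1)%R.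
  move=> [x1 x2]; have x0 := lt_le_trans ltr01 x1.
  rewrite powRN /riesz lef_pV2 ?posrE ?powR_gt0//; apply/andP; split.
    by rewrite ge0_ler_powR ?nnegrE// ltW.
  by rewrite invf_le1 ?powR_gt0// -[leLHS](@powRr0 R (eucl_norm x)) ler_powR.
apply/andP; split.
  rewrite -ge0_integralZl_EFin ?powR_ge0//; last 2 first.
  - by move=> x _; rewrite lee_fin riesz_ge0.
  - exact: measurable_rieszE.
  apply: ge0_le_integral => //.
  - by move=> x _; rewrite -EFinM lee_fin mulr_ge0 ?powR_ge0 ?riesz_ge0.
  - apply/measurable_EFinP/measurable_funM => //.
    by apply: measurable_funTS; exact: measurable_riesz.
  - exact: measurable_rieszE.
  - move=> x sx; have [x1 x2] := sx; have /andP[k1 k2] := kt _ sx.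
    rewrite -EFinM lee_fin rieszD ?(lt_le_trans ltr01)// mulrC.
    by rewrite ler_wpM2l ?riesz_ge0.
apply: ge0_le_integral => //.
- by move=> x _; rewrite lee_fin riesz_ge0.
- exact: measurable_rieszE.
- exact: measurable_rieszE.
- move=> x sx; have [x1 x2] := sx; have /andP[k1 k2] := kt _ sx.
  rewrite lee_fin rieszD ?(lt_le_trans ltr01)//.
  by rewrite ler_piMr// riesz_ge0.
Qed.

Lemma shell_integral0 : shell_integral 0 = leb (shell 1 2).
Proof.
rewrite /shell_integral; under eq_integral do rewrite /riesz powRr0 invr1.
by rewrite integral_cst ?mul1e//; exact: measurable_shell.
Qed.

(** Comparison with the case p = 0, the volume of the shell; the upper bound
    does not depend on p. *)
Lemma shell_integral_fin p : (0 < n)%N -> (0 <= p)%R -> exists j : R,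
  [/\ shell_integral p = j%:E, (0 < j)%R & j%:E <= leb (shell 1 2)].
Proof.
move=> n0 p0; have := shell_integral_bounds 0 p0; rewrite add0r shell_integral0.
move=> /andP[].
have := @shell_gt0 R n n0; have := @shell_lty R n.
case: (leb _) => // v _ v0; case: (shell_integral p) => // j vj jv.
exists j; split => //.
by rewrite -lte_fin; apply: lt_le_trans vj; rewrite mule_gt0 ?lte_fin ?powR_gt0.
Qed.

(** The shells between 2^k and 2^(k+1) fill the outside of the unit ball, and
    by scaling the integrals over them form a geometric sequence of ratio
    2^(d - p) < 1. *)
Lemma integral_riesz_far (p j : R) : (d < p)%R -> shell_integral p = j%:E ->
  \int[leb]_(y in [set y : E | (1 <= eucl_norm y)%R]) (riesz p y)%:E =
  (j / (1 - 2 `^ (d - p)))%:E.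
Proof.
move=> dp pj.
have -> : [set y : E | (1 <= eucl_norm y)%R] =
    \bigcup_k shell (2 ^+ k) (2 * 2 ^+ k).
  apply/seteqP; split => [y /= /dyadic_ge1[k /andP[k1 k2]]|y [k _ [k1 _]] /=].
    by exists k => //; split => //; rewrite -exprS.
  by apply: le_trans k1; rewrite exprn_ege1// ler1n.
rewrite ge0_integral_bigcup//=.
- rewrite -geometric_nneseries.
    apply: eq_eseriesr => k _.
    rewrite integral_shellZ ?exprn_gt0// -/(shell_integral p) pj -EFinM.
    by rewrite mulrC powR_exprn.
  by rewrite powR_ge0/= powR_lt1// pmulr_llt0 ?ln_gt0 ?ltr1n// subr_lt0.
- by move=> k; exact: measurable_shell.
- exact: measurable_rieszE.
- by move=> y _; rewrite lee_fin riesz_ge0.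
- apply: trivIset_shell => i k ik; left.
  by rewrite -exprS ler_eXn2l// ltr1n.
Qed.

(** The shells of radii r/2^(k+1) and r/2^k fill the punctured ball; the first
    inner radius is r/2, whence the ratio 2^(-(d - q)) as an extra factor in
    front of j. *)
Lemma integral_riesz_near (q j r : R) : (q < d)%R -> (0 < r)%R ->
  shell_integral q = j%:E ->
  \int[leb]_(y in [set y : E | (0 < eucl_norm y < r)%R]) (riesz q y)%:E =
  (r `^ (d - q) * 2^-1 `^ (d - q) * j / (1 - 2^-1 `^ (d - q)))%:E.
Proof.
move=> qd r0 qj.
have -> : [set y : E | (0 < eucl_norm y < r)%R] =
    \bigcup_k shell (r * 2^-1 ^+ k.+1) (2 * (r * 2^-1 ^+ k.+1)).
  have E2 k : (2 * (r * 2^-1 ^+ k.+1) = r * 2^-1 ^+ k)%R.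
    by rewrite exprS mulrCA mulVKf ?pnatr_eq0.
  apply/seteqP; split => y /=.
    move=> /andP[y0 yr].
    have [k] : exists k, (2^-1 ^+ k.+1 <= eucl_norm y / r < 2^-1 ^+ k)%R.
      by apply: dyadic_lt1; rewrite divr_gt0//= ltr_pdivrMr// mul1r.
    rewrite ler_pdivlMr// ltr_pdivrMr// => /andP[k1 k2].
    by exists k => //; split; rewrite ?E2 mulrC.
  move=> [k _ []]; rewrite E2 => k1 k2; apply/andP; split.
    by apply: lt_le_trans k1; rewrite mulr_gt0// exprn_gt0// invr_gt0.
  apply: lt_le_trans k2 _; rewrite ler_piMr ?(ltW r0)//.
  by rewrite exprn_ile1// ?invr_ge0// invf_le1// ler1n.
rewrite ge0_integral_bigcup//=.
- rewrite -geometric_nneseries.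
    apply: eq_eseriesr => k _.
    rewrite integral_shellZ ?mulr_gt0 ?exprn_gt0 ?invr_gt0//.
    rewrite -/(shell_integral q) qj -EFinM.
    rewrite powRM ?(ltW r0) ?exprn_ge0 ?invr_ge0// powR_exprn ?invr_ge0//.
    by rewrite exprS; congr EFin; ring.
  rewrite powR_ge0/= powR_lt1 ?invr_gt0// lnV ?posrE// mulrN oppr_lt0.
  by rewrite mulr_gt0 ?ln_gt0 ?ltr1n// subr_gt0.
- by move=> k; exact: measurable_shell.
- exact: measurable_rieszE.
- by move=> y _; rewrite lee_fin riesz_ge0.
- apply: trivIset_shell => i k ik; right.
  rewrite [in leLHS]exprS (mulrCA r) mulVKf//.
  by rewrite ler_pM2l// ler_wiXn2l ?invr_ge0// invf_le1// ler1n.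
Qed.

(** With j(p) the integral of the kernel over the unit shell, the mass is
    s j(d + 2s) / (1 - 2^(-2s)). As j is continuous at d and 1 - 2^(-2s) is
    equivalent to 2 s ln 2, the limit is j(d) / (2 ln 2) > 0; the bound
    e^x >= 1 + x makes both estimates quantitative. *)
Lemma mass_one : (0 < n)%N -> exists al C : R, [/\ (0 < al)%R, (0 <= C)%R &
  forall s : R, (0 < s)%R -> exists2 m : R,
    mass (fun _ : E => 1%R) s = m%:E & (`|m - al| <= C * s)%R].
Proof.
move=> n0; have [j0 [j0E j0_gt0 _]] := @shell_integral_fin d n0 (ler0n _ _).
pose c : R := (2 * ln 2)%R.
have c0 : (0 < c)%R by rewrite mulr_gt0// ln_gt0// ltr1n.
exists (j0 / c)%R, j0; split; [exact: divr_gt0|exact: ltW|move=> s s0].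
have dp : (d < d + 2 * s)%R by rewrite ltrDl mulr_gt0.
have [j [jE j_gt0 _]] : exists j : R, [/\ shell_integral (d + 2 * s) = j%:E,
    (0 < j)%R & j%:E <= leb (shell 1 2)].
  by apply: shell_integral_fin => //; rewrite addr_ge0// mulr_ge0// ltW.
pose e := expR (- (c * s)).
have eE : (2 `^ (- (2 * s)) = e)%R.
  by rewrite /powR gt_eqF// /e /c; congr expR; ring.
exists (s * (j / (1 - e)))%R.
  rewrite /mass; under eq_integral do rewrite mul1r -/(riesz _ _).
  rewrite (integral_riesz_far dp jE) EFinM.
  by rewrite opprD addrA subrr add0r eE.
have := shell_integral_bounds d (ltW (mulr_gt0 (ltr0Sn R 1) s0)).
rewrite j0E jE eE -EFinM !lee_fin => /andP[ej jj0].
have cs0 : (0 < c * s)%R by rewrite mulr_gt0.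
(* Convexity of the exponential on both sides: 1 - cs <= e^(-cs)
   <= 1/(1 + cs). *)
have e1 : (1 - c * s <= e)%R by exact: expR_ge1Dx.
have e2 : (e * (1 + c * s) <= 1)%R.
  by rewrite -ler_pdivlMl ?expR_gt0// mulr1 /e -expRN opprK expR_ge1Dx.
have e0 : (0 < e)%R by exact: expR_gt0.
have e3 : (0 < 1 - e)%R by nra.
set a := (j0 / c)%R.
have a0 : (0 < a)%R by exact: divr_gt0.
have j0a : j0 = (a * c)%R by rewrite divfK// gt_eqF.
rewrite mulrA ler_distl ler_pdivlMr// ler_pdivrMr// j0a; apply/andP; split.
- apply: (@le_trans _ _ (s * (e * (a * c)))%R); last first.
    by rewrite ler_pM2l// -j0a.
  rewrite -subr_ge0 (_ : _ - _ = a * (e - (1 - c * s)))%R; last by ring.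
  by rewrite mulr_ge0 ?(ltW a0)// subr_ge0.
- apply: (@le_trans _ _ (s * (a * c))%R); first by rewrite ler_pM2l// -j0a.
  rewrite -subr_ge0 (_ : _ - _ = a * (1 - e * (1 + c * s)))%R; last by ring.
  by rewrite mulr_ge0 ?(ltW a0)// subr_ge0.
Qed.

End riesz_integrals.

(** * The kernel seen from far away *)

Lemma bernoulli_ineq (R : realType) (t : R) N : 0 <= t <= 1 ->
  1 - N%:R * t <= (1 - t) ^+ N.
Proof.
move=> /andP[t0 t1]; elim: N => [|N IH]; first by rewrite mul0r subr0 expr0.
rewrite exprS; apply: (@le_trans _ _ ((1 - t) * (1 - N%:R * t))).
  by rewrite -natr1; have := ler0n R N; nra.
by rewrite ler_wpM2l// subr_ge0.
Qed.

Section far_field.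
Context {R : realType} {n : nat}.
Local Notation E := 'rV[R]_n.
Local Notation leb := (@lebesgue_rV R n).
Local Notation d := (n%:R : R).
Local Open Scope ereal_scope.

Definition outside (r : R) : set E := [set y | (r <= eucl_norm y)%R].

Lemma measurable_outside r : measurable (outside r).
Proof. by apply: measurable_ler => //; exact: measurable_eucl_norm. Qed.

(** If |y| is at least r/t then |x - y| lies between (1 - t)|y| and
    (1 + t)|y|, so the kernels compare up to the factor (1 - t)^p or its
    inverse. The bound p <= n + 2 makes the choice of rho independent of s in
    (0, 1]. *)
Lemma riesz_far_compare (r e : R) : (0 < r)%R -> (0 < e <= 1)%R ->
  exists rho : R, [/\ (1 <= rho)%R, (r <= rho)%R &
    forall (x y : E) p, (eucl_norm x < r)%R -> (rho <= eucl_norm y)%R ->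
      (0 <= p <= n.+2%:R)%R ->
      ((1 - e) * riesz p y <= riesz p (x - y) <= (1 + e) * riesz p y)%R].
Proof.
move=> r0 /andP[e0 e1].
(* With this t, Bernoulli gives (1 - t)^(n+2) >= 1 - e/2, whose inverse is at
   most 1 + e. *)
pose t := (e / (2 * n.+2%:R))%R.
have t0 : (0 < t)%R by rewrite divr_gt0// mulr_gt0.
have t1 : (t <= 2^-1)%R.
  rewrite /t invfM mulrA mulrAC ler_piMl// ler_pdivrMr// mul1r.
  by rewrite (le_trans e1)// ler1n.
have bern : (1 - e / 2 <= (1 - t) ^+ n.+2)%R.
  apply: le_trans (bernoulli_ineq n.+2 _); last by rewrite ltW//=; lra.
  have -> : (n.+2%:R * t = e / 2)%R; last by [].
  have N0 : (n.+2%:R != 0 :> R)%R by rewrite pnatr_eq0.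
  by rewrite /t; move: N0; set N : R := (n.+2%:R)%R => N0; field.
exists (1 + r / t)%R.
have rt : (r <= r / t)%R by rewrite ler_peMr ?(ltW r0)// invf_ge1//; lra.
split; [by rewrite lerDl; lra|lra|move=> x y p xr yr /andP[p0 pN]].
have y0 : (0 < eucl_norm y)%R by lra.
have rty : (r <= t * eucl_norm y)%R.
  rewrite -ler_pdivrMl// mulrC; lra.
have xyl : ((1 - t) * eucl_norm y <= eucl_norm (x - y))%R.
  by have := eucl_normB y x; rewrite (eucl_normBC y); lra.
have xyh : (eucl_norm (x - y) <= (1 + t) * eucl_norm y)%R.
  by have := eucl_normD x (- y); rewrite eucl_normN; lra.
have c1 : (0 < 1 - t)%R by lra.
have c2 : (0 < 1 + t)%R by lra.
have xy0 : (0 < eucl_norm (x - y))%R by apply: lt_le_trans xyl; rewrite mulr_gt0.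
have t1p : (1 - e / 2 <= (1 - t) `^ p)%R.
  apply: (le_trans bern); rewrite -powR_mulrn ?(ltW c1)//.
  apply: ger_powR => //; rewrite c1/=; lra.
rewrite /riesz; apply/andP; split.
- apply: (@le_trans _ _ (((1 + t) * eucl_norm y) `^ p)^-1)%R; last first.
    rewrite lef_pV2 ?posrE ?powR_gt0 ?mulr_gt0//.
    by rewrite ge0_ler_powR ?nnegrE ?eucl_norm_ge0// ltW// mulr_gt0.
  rewrite powRM ?(ltW c2) ?(ltW y0)// invfM ler_wpM2r ?invr_ge0 ?powR_ge0//.
  (* 1/(1 + t) >= 1 - t, raised to the power p. *)
  apply: (@le_trans _ _ ((1 - t) `^ p))%R; first lra.
  rewrite -[leRHS]mul1r ler_pdivlMr ?powR_gt0// -powRM ?(ltW c1) ?(ltW c2)//.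
  apply: (@le_trans _ _ (1 `^ p))%R; last by rewrite powR1.
  rewrite ge0_ler_powR ?nnegrE//; first by rewrite mulr_ge0// ltW.
  nra.
- apply: (@le_trans _ _ (((1 - t) * eucl_norm y) `^ p)^-1)%R.
    rewrite lef_pV2 ?posrE ?powR_gt0 ?mulr_gt0//.
    by rewrite ge0_ler_powR ?nnegrE ?eucl_norm_ge0// ltW// mulr_gt0.
  rewrite powRM ?(ltW c1) ?(ltW y0)// invfM ler_wpM2r ?invr_ge0 ?powR_ge0//.
  rewrite -[leLHS]mul1r ler_pdivrMr ?powR_gt0//.
  apply: (@le_trans _ _ ((1 + e) * (1 - e / 2)))%R; first nra.
  by rewrite ler_pM2l// addr_gt0.
Qed.

Lemma measurable_riesz_shift p (x : E) :
  measurable_fun setT (fun y : E => riesz p (x - y)).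
Proof.
rewrite (_ : (fun y => _) = riesz p \o (fun y : E => -1 *: y + x)%R); last first.
  by apply/funext => y /=; rewrite scaleN1r addrC.
apply: measurableT_comp; [exact: measurable_riesz|exact: measurable_rV_affine].
Qed.

(** Replaces the kernel centred at x by the one centred at the origin, and the
    region |y| >= rho by |y| >= 1. The difference of the regions costs at most
    Gam times the volume of a ball, since the kernel is at most 1 there;
    multiplied by s it disappears in the limit. *)
Lemma integral_far_compare (e rho : R) (G : E -> R) Gam p i (x : E) :
  (1 <= rho)%R -> (0 <= e <= 1)%R -> (0 <= p)%R ->
  (forall y, (rho <= eucl_norm y)%R ->
    ((1 - e) * riesz p y <= riesz p (x - y) <= (1 + e) * riesz p y)%R) ->
  measurable_fun setT G -> (forall y, 0 <= G y <= Gam)%R ->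
  \int[leb]_(y in outside 1) (G y * riesz p y)%:E = i%:E ->
  ((1 - e) * (i - Gam * fine (leb (eball n rho))))%:E <=
    \int[leb]_(y in outside rho) (G y * riesz p (x - y))%:E <=
  ((1 + e) * i)%:E.
Proof.
move=> rho1 /andP[e_ge0 e1] p0 cmp mG GG iE.
have mo := measurable_outside.
have mGK D : measurable_fun D (fun y => (G y * riesz p y)%:E).
  apply/measurable_EFinP; apply: measurable_funTS; apply: measurable_funM => //.
  exact: measurable_riesz.
have mGKx D : measurable_fun D (fun y => (G y * riesz p (x - y))%:E).
  apply/measurable_EFinP; apply: measurable_funTS; apply: measurable_funM => //.
  exact: measurable_riesz_shift.
have G0 y : (0 <= G y)%R by have /andP[] := GG y.
have GK0 y : 0 <= (G y * riesz p y)%:E.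
  by rewrite lee_fin mulr_ge0// riesz_ge0.
have GKx0 y : 0 <= (G y * riesz p (x - y))%:E.
  by rewrite lee_fin mulr_ge0// riesz_ge0.
have oU : outside 1 = outside rho `|` shell 1 rho.
  apply/seteqP; split => y /=.
    by case: (ltP (eucl_norm y) rho) => y1 y2; [right|left].
  by case=> [/(le_trans rho1)|[]].
move: iE; rewrite oU ge0_integral_setU//=; last 2 first.
- exact: measurable_shell.
- by apply/disj_setPS => y [/= y1 [_]]; rewrite ltNge y1.
have Vfin : leb (eball n rho) \is a fin_num.
  by rewrite ge0_fin_numE// lebesgue_eball.
have near_le : \int[leb]_(y in shell 1 rho) (G y * riesz p y)%:E <=
    (Gam * fine (leb (eball n rho)))%:E.
  rewrite EFinM fineK//.
  apply: (@le_trans _ _ (Gam%:E * leb (shell 1 rho))).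
    rewrite -integral_cst; last exact: measurable_shell.
    apply: ge0_le_integral => //; first exact: measurable_shell.
    move=> y [y1 _]; rewrite lee_fin -[leRHS]mulr1.
    have /andP[_ Gy] := GG y.
    rewrite ler_pM// ?riesz_ge0//.
    rewrite invf_le1 ?powR_gt0 ?(lt_le_trans ltr01)//.
    by rewrite -[leLHS](@powRr0 R (eucl_norm y)) ler_powR.
  apply: lee_wpmul2l.
    by rewrite lee_fin; have /andP[] := GG x; exact: le_trans.
  apply: le_measure; rewrite ?inE//=; [exact: measurable_shell|
    exact: measurable_eball|by move=> y []].
have B0 : 0 <= \int[leb]_(y in outside rho) (G y * riesz p y)%:E.
  exact: integral_ge0.
have S0 : 0 <= \int[leb]_(y in shell 1 rho) (G y * riesz p y)%:E.
  exact: integral_ge0.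
have low : (1 - e)%:E * \int[leb]_(y in outside rho) (G y * riesz p y)%:E <=
    \int[leb]_(y in outside rho) (G y * riesz p (x - y))%:E.
  have e10 : (0 <= 1 - e)%R by rewrite subr_ge0.
  rewrite -(ge0_integralZl_EFin leb (mo rho) (fun y _ => GK0 y) (mGK _) e10).
  apply: ge0_le_integral; first exact: mo.
  - by move=> y _; rewrite mule_ge0// lee_fin subr_ge0.
  - by apply: emeasurable_funM.
  - exact: mGKx.
  - move=> y /= yr; rewrite -EFinM lee_fin mulrCA ler_wpM2l//.
    by have /andP[] := cmp _ yr.
have e0 : (0 <= 1 + e)%R by rewrite addr_ge0.
have high : \int[leb]_(y in outside rho) (G y * riesz p (x - y))%:E <=
    (1 + e)%:E * \int[leb]_(y in outside rho) (G y * riesz p y)%:E.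
  rewrite -(ge0_integralZl_EFin leb (mo rho) (fun y _ => GK0 y) (mGK _) e0).
  apply: ge0_le_integral; first exact: mo.
  - by move=> y _; exact: GKx0.
  - exact: mGKx.
  - by apply: emeasurable_funM.
  - move=> y /= yr; rewrite -EFinM lee_fin mulrCA ler_wpM2l//.
    by have /andP[] := cmp _ yr.
have combine (B C J : \bar R) : C <= (Gam * fine (leb (eball n rho)))%:E ->
    0 <= B -> 0 <= C -> (1 - e)%:E * B <= J -> J <= (1 + e)%:E * B ->
    B + C = i%:E ->
    ((1 - e) * (i - Gam * fine (leb (eball n rho))))%:E <= J <=
    ((1 + e) * i)%:E.
  case: B => [b||]//; last by case: C.
  case: C => // c.
  rewrite !lee_fin => cG b0 c0 lowJ highJ [ibc]; apply/andP; split.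
    apply: le_trans lowJ; rewrite -EFinM lee_fin ler_wpM2l ?subr_ge0//; lra.
  apply: (le_trans highJ); rewrite -EFinM lee_fin ler_wpM2l//; lra.
exact: combine near_le B0 S0 low high.
Qed.

End far_field.

(** * Masses at infinity *)

Section mass_theory.
Context {R : realType} {n : nat}.
Hypothesis n0 : (0 < n)%N.
Local Notation E := 'rV[R]_n.
Local Notation leb := (@lebesgue_rV R n).
Local Notation d := (n%:R : R).
Local Open Scope ereal_scope.

(** Convergence to a real limit, spelled out because masses are extended
    reals: it records that the mass is finite for small s, so that limits can
    be combined linearly. *)
Definition mass_tends (w : E -> R) (a : R) := forall e : R, (0 < e)%R ->
  \forall s \near (0%R : R)^'+,
    exists2 m : R, mass w s = m%:E & (`|m - a| <= e)%R.

Lemma massE (w : E -> R) s : mass w s =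
  s%:E * \int[leb]_(y in outside 1) (w y * riesz (d + 2 * s) y)%:E.
Proof. by []. Qed.

Lemma mass_tends1 : exists2 a : R, (0 < a)%R & mass_tends (fun _ => 1%R) a.
Proof.
have [a [C [a0 C0 aC]]] := @mass_one R n n0; exists a => // e e0.
near=> s.
have s0 : (0 < s)%R by near: s; exact: nbhs_right_gt.
have [m mE mC] := aC s s0; exists m => //; apply: (le_trans mC).
have : (s <= e / (C + 1))%R.
  near: s; apply: nbhs_right_le; apply: divr_gt0 => //; lra.
rewrite ler_pdivlMr; last by lra.
apply: le_trans; rewrite mulrC; nra.
Unshelve. all: by end_near. Qed.

Lemma integrable_riesz_outside s : (0 < s)%R ->
  leb.-integrable (outside 1) (fun y : E => (riesz (d + 2 * s) y)%:E).
Proof.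
move=> s0; apply/integrableP; split; first exact: measurable_rieszE.
have dp : (d < d + 2 * s)%R by rewrite ltrDl mulr_gt0.
have p0 : (0 <= d + 2 * s)%R by rewrite addr_ge0// mulr_ge0// ltW.
have [j [jE _ _]] := shell_integral_fin n0 p0.
under eq_integral do rewrite abse_EFin ger0_norm ?riesz_ge0//.
by rewrite (integral_riesz_far dp jE) ltry.
Qed.

Lemma integrable_mass (w : E -> R) M s : (0 < s)%R -> measurable_fun setT w ->
  (forall y, `|w y| <= M)%R ->
  leb.-integrable (outside 1) (fun y => (w y * riesz (d + 2 * s) y)%:E).
Proof.
move=> s0 mw wM; have mo := @measurable_outside R n 1.
have M0 : (0 <= M)%R by exact: le_trans (normr_ge0 _) (wM 0%R).
have ig := integrableZl mo M (integrable_riesz_outside s0).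
apply: (le_integrable mo _ _ ig).
  apply/measurable_EFinP; apply: measurable_funTS; apply: measurable_funM => //.
  exact: measurable_riesz.
move=> y _; rewrite -EFinM !abse_EFin lee_fin !normrM ler_wpM2r//.
by rewrite (ger0_norm M0).
Qed.

Lemma mass_fin (w : E -> R) M s : (0 < s)%R -> measurable_fun setT w ->
  (forall y, `|w y| <= M)%R -> mass w s \is a fin_num.
Proof.
move=> s0 mw wM; rewrite massE fin_numM//.
by apply: integrable_fin_num; [exact: measurable_outside|
  exact: integrable_mass wM].
Qed.

Lemma mass_lincomb (w1 w2 : E -> R) M1 M2 (a b m1 m2 : R) s : (0 < s)%R ->
  measurable_fun setT w1 -> (forall y, `|w1 y| <= M1)%R ->
  measurable_fun setT w2 -> (forall y, `|w2 y| <= M2)%R ->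
  mass w1 s = m1%:E -> mass w2 s = m2%:E ->
  mass (fun y => a * w1 y + b * w2 y)%R s = (a * m1 + b * m2)%:E.
Proof.
move=> s0 mw1 wM1 mw2 wM2; have mo := @measurable_outside R n 1.
have i1 := integrable_mass s0 mw1 wM1; have i2 := integrable_mass s0 mw2 wM2.
rewrite !massE => e1 e2.
have -> : \int[leb]_(y in outside 1)
    ((a * w1 y + b * w2 y) * riesz (d + 2 * s) y)%:E =
    a%:E * (\int[leb]_(y in outside 1) (w1 y * riesz (d + 2 * s) y)%:E) +
    b%:E * (\int[leb]_(y in outside 1) (w2 y * riesz (d + 2 * s) y)%:E).
  rewrite -(integralZl mo i1) -(integralZl mo i2).
  rewrite -(integralD mo (integrableZl mo a i1) (integrableZl mo b i2)).
  by apply: eq_integral => y _; rewrite -!EFinM -EFinD mulrDl !mulrA.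
have f1 := integrable_fin_num mo i1; have f2 := integrable_fin_num mo i2.
move: e1 e2 f1 f2.
case: (\int[leb]_(y in outside 1) (w1 y * riesz (d + 2 * s) y)%:E) => // i.
case: (\int[leb]_(y in outside 1) (w2 y * riesz (d + 2 * s) y)%:E) => // k.
rewrite -!EFinM => -[<-] [<-] _ _. congr EFin; ring.
Qed.

Lemma mass_tends_lincomb (w1 w2 : E -> R) M1 M2 (a b l1 l2 : R) :
  measurable_fun setT w1 -> (forall y, `|w1 y| <= M1)%R ->
  measurable_fun setT w2 -> (forall y, `|w2 y| <= M2)%R ->
  mass_tends w1 l1 -> mass_tends w2 l2 ->
  mass_tends (fun y => a * w1 y + b * w2 y)%R (a * l1 + b * l2)%R.
Proof.
move=> mw1 wM1 mw2 wM2 t1 t2 e e0.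
pose D := (`|a| + `|b| + 1)%R.
have D0 : (0 < D)%R by rewrite /D ltr_wpDl// addr_ge0.
have eD : (0 < e / D)%R by exact: divr_gt0.
near=> s.
have s0 : (0 < s)%R by near: s; exact: nbhs_right_gt.
have [m1 m1E m1l] : exists2 m : R, mass w1 s = m%:E & (`|m - l1| <= e / D)%R.
  by near: s; exact: t1.
have [m2 m2E m2l] : exists2 m : R, mass w2 s = m%:E & (`|m - l2| <= e / D)%R.
  by near: s; exact: t2.
exists (a * m1 + b * m2)%R; first exact: (mass_lincomb a b s0 mw1 wM1 mw2 wM2).
rewrite (_ : _ - _ = a * (m1 - l1) + b * (m2 - l2))%R; last by ring.
apply: (le_trans (ler_normD _ _)); rewrite !normrM.
apply: (@le_trans _ _ (`|a| * (e / D) + `|b| * (e / D)))%R.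
  by rewrite lerD// ler_wpM2l.
rewrite -mulrDl mulrCA ler_piMr ?(ltW e0)// ler_pdivrMr// mul1r /D.
by rewrite lerDl.
Unshelve. all: by end_near. Qed.

Lemma mass_tends_alpha (w : E -> R) a : mass_tends w a -> alpha w = a%:E.
Proof.
move=> wa; apply: cvg_lim => //; apply/fine_cvgP; split.
  by near=> s; have [m -> _] : exists2 m : R, mass w s = m%:E & (`|m - a| <= 1)%R
    by near: s; exact: wa.
apply/cvgrPdist_le => e e0; near=> s.
have [m mE ma] : exists2 m : R, mass w s = m%:E & (`|m - a| <= e)%R.
  by near: s; exact: wa.
by rewrite /= mE /= distrC.
Unshelve. all: by end_near. Qed.

(** The mass of a function bounded by M is at most M times the mass of 1, so
    an existing limit is finite. *)
Lemma has_alpha_mass_tends (w : E -> R) M : measurable_fun setT w ->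
  (forall y, `|w y| <= M)%R -> has_alpha w -> exists a : R, mass_tends w a.
Proof.
move=> mw wM cw.
have [a1 _ t1] := mass_tends1.
have M0 : (0 <= M)%R by exact: le_trans (normr_ge0 _) (wM 0%R).
pose B : R := (M * (a1 + 1))%R.
have massB : \forall s \near (0%R : R)^'+, - B%:E <= mass w s <= B%:E.
  near=> s.
  have s0 : (0 < s)%R by near: s; exact: nbhs_right_gt.
  have [m1 m1E m1l] : exists2 m : R, mass (fun _ : E => 1%R) s = m%:E &
      (`|m - a1| <= 1)%R by near: s; exact: t1.
  have mo := @measurable_outside R n 1.
  have iK := integrable_riesz_outside s0.
  rewrite -(fineK (mass_fin s0 mw wM)) -EFinN !lee_fin -ler_norml -lee_fin.
  rewrite -abse_EFin (fineK (mass_fin s0 mw wM)) massE abseM abse_EFin gtr0_norm//.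
  apply: (@le_trans _ _ (s%:E * (M%:E *
      \int[leb]_(y in outside 1) (riesz (d + 2 * s) y)%:E))).
    rewrite lee_pmul2l ?lte_fin// -(integralZl mo iK).
    have mf := measurable_int _ (integrable_mass s0 mw wM).
    apply: (le_trans (le_abse_integral leb mo mf)).
    apply: ge0_le_integral => //.
    - exact: measurableT_comp.
    - exact: measurable_int _ (integrableZl mo M iK).
    - move=> y _; rewrite -EFinM abse_EFin lee_fin normrM.
      by rewrite (ger0_norm (riesz_ge0 _ _)) ler_wpM2r// riesz_ge0.
  rewrite muleCA.
  have -> : s%:E * \int[leb]_(y in outside 1) (riesz (d + 2 * s) y)%:E = m1%:E.
    rewrite -m1E massE; congr (_ * _); apply: eq_integral => y _.
    by rewrite mul1r.
  rewrite -EFinM lee_fin ler_wpM2l//.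
  by move: m1l; rewrite ler_distl => /andP[_]; rewrite addrC.
have lB : alpha w <= B%:E.
  by apply: lime_le => //; near=> s; have /andP[] : - B%:E <= mass w s <= B%:E
    by near: s.
have lA : - B%:E <= alpha w.
  by apply: lime_ge => //; near=> s; have /andP[] : - B%:E <= mass w s <= B%:E
    by near: s.
have [a aE] : exists a, alpha w = a%:E.
  by move: lA lB; case: (alpha w) => // a _ _; exists a.
exists a => e e0.
have : mass w s @[s --> (0%R : R)^'+] --> a%:E by rewrite -aE.
move/fine_cvgP => [finw /cvgrPdist_le/(_ _ e0) cvgw].
near=> s; exists (fine (mass w s)).
  by rewrite fineK//; near: s.
by rewrite distrC; near: s.
Unshelve. all: by end_near. Qed.

Lemma mass_ae_eq (w w' : E -> R) s : measurable_fun setT w ->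
  measurable_fun setT w' -> {ae leb, forall x, w x = w' x} ->
  mass w s = mass w' s.
Proof.
move=> mw mw' ww'; rewrite !massE; congr (_ * _); apply: ae_eq_integral.
- exact: measurable_outside.
- apply/measurable_EFinP; apply: measurable_funTS; apply: measurable_funM => //.
  exact: measurable_riesz.
- apply/measurable_EFinP; apply: measurable_funTS; apply: measurable_funM => //.
  exact: measurable_riesz.
- by apply: filterS ww' => x -> _.
Qed.

End mass_theory.

(** * Interaction of a bounded set with infinity *)

Section far_limit.
Context {R : realType} {n : nat}.
Hypothesis n0 : (0 < n)%N.
Local Notation E := 'rV[R]_n.
Local Notation leb := (@lebesgue_rV R n).
Local Notation d := (n%:R : R).
Local Open Scope ereal_scope.

(** The limit, for unit volume in x, of the interaction of the value a with
    boundary data whose powers 0, 1, 2 have masses a0, a1, a2. *)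
Definition quad (a0 a1 a2 a : R) : R := (a0 * a ^+ 2 - 2 * a1 * a + a2)%R.

Lemma norm_double_le (a : R) : (`|2 * a| <= 1 + a ^+ 2)%R.
Proof.
have := sqr_ge0 (a + 1); have := sqr_ge0 (a - 1).
by move=> ? ?; rewrite ler_norml; apply/andP; split; lra.
Qed.

Lemma quad_bound (a0 a1 a2 a : R) :
  (`|quad a0 a1 a2 a| <= (`|a0| + `|a1| + `|a2|) * (1 + a ^+ 2))%R.
Proof.
have a20 : (0 <= a ^+ 2)%R := sqr_ge0 a.
have -> : quad a0 a1 a2 a = (a0 * a ^+ 2 + a1 * (- (2 * a)) + a2)%R.
  by rewrite /quad; ring.
rewrite 2![in leRHS]mulrDl.
apply: (le_trans (ler_normD _ _)); rewrite lerD//; last first.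
  by rewrite ler_peMr// lerDl.
apply: (le_trans (ler_normD _ _)); rewrite lerD//.
  by rewrite normrM (ger0_norm a20) ler_wpM2l// lerDr.
by rewrite normrM normrN ler_wpM2l// norm_double_le.
Qed.

Lemma quad_close (a0 a1 a2 m0 m1 m2 a h : R) :
  (`|m0 - a0| <= h)%R -> (`|m1 - a1| <= h)%R -> (`|m2 - a2| <= h)%R ->
  (`|quad m0 m1 m2 a - quad a0 a1 a2 a| <= 3 * h * (1 + a ^+ 2))%R.
Proof.
move=> h0 h1 h2.
have -> : (quad m0 m1 m2 a - quad a0 a1 a2 a =
  quad (m0 - a0) (m1 - a1) (m2 - a2) a)%R by rewrite /quad; ring.
apply: (le_trans (quad_bound _ _ _ _)); rewrite ler_wpM2r//.
  by rewrite addr_ge0// sqr_ge0.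
lra.
Qed.

Lemma upper_error (t m q w : R) : (0 <= t <= 1)%R -> (0 <= w)%R ->
  (m - q <= 3 / 16 * w)%R -> (t * q <= w / 4)%R -> ((1 + t) * m <= q + w)%R.
Proof.
move=> /andP[t0 t1] w0 mq tq.
have t1' : (0 <= 1 + t)%R by lra.
have h : (m <= q + 3 / 16 * w)%R by lra.
have := ler_wpM2l t1' h.
have := ler_wpM2r w0 t1; lra.
Qed.

Lemma lower_error (t m q w z : R) : (0 <= t <= 1)%R -> (0 <= w)%R ->
  (- (3 / 16 * w) <= m - q)%R -> (t * q <= w / 4)%R -> (z <= w / 4)%R ->
  (q - w <= (1 - t) * (m - z))%R.
Proof.
move=> /andP[t0 t1] w0 mq tq zw.
have t1' : (0 <= 1 - t)%R by lra.
have h : (q - 7 / 16 * w <= m - z)%R by lra.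
have := ler_wpM2l t1' h.
have := mulr_ge0 t0 w0; lra.
Qed.

(** For fixed s the integral of (a - v)^2 is a combination of the masses of 1,
    v and v^2 with coefficients a^2, -2a and 1. All coefficients are at most
    1 + a^2 in absolute value, so every error is at most a multiple of 1 +
    a^2, uniformly in a. *)
Lemma far_limit (v : E -> R) M r a0 a1 a2 (e : R) : (0 < r)%R ->
  measurable_fun setT v -> (forall y, `|v y| <= M)%R ->
  mass_tends (fun _ : E => 1%R) a0 -> mass_tends v a1 ->
  mass_tends (fun y => v y ^+ 2)%R a2 -> (0 < e)%R ->
  exists rho : R, [/\ (1 <= rho)%R, (r <= rho)%R &
    \forall s \near (0%R : R)^'+, forall (x : E) a, (eucl_norm x < r)%R ->
    (quad a0 a1 a2 a - e * (1 + a ^+ 2))%:E <=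
    s%:E * \int[leb]_(y in outside rho)
      ((a - v y) ^+ 2 * riesz (d + 2 * s) (x - y))%:E <=
    (quad a0 a1 a2 a + e * (1 + a ^+ 2))%:E].
Proof.
move=> r0 mv vM t0 t1 t2 e0.
pose Cq := (`|a0| + `|a1| + `|a2|)%R.
have Cq0 : (0 <= Cq)%R by rewrite !addr_ge0.
(* The relative error on the kernel: e' Cq <= e/4 makes it harmless when
   multiplied by the limit, itself at most Cq (1 + a^2). *)
pose e' := (e / (e + 4 * (Cq + 1)))%R.
have den0 : (0 < e + 4 * (Cq + 1))%R by lra.
have e'0 : (0 < e')%R by exact: divr_gt0.
have e'1 : (e' <= 1)%R by rewrite ler_pdivrMr// mul1r; lra.
have e'C : (e' * Cq <= e / 4)%R.
  by rewrite /e' mulrAC ler_pdivrMr//; nra.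
have e'01 : (0 < e' <= 1)%R by rewrite e'0.
have [rho [rho1 rrho cmp]] := @riesz_far_compare R n r e' r0 e'01.
exists rho; split => //.
pose V := fine (leb (eball n rho)).
have V0 : (0 <= V)%R by rewrite fine_ge0.
(* (a - v)^2 <= 2 (1 + M^2) (1 + a^2), so W (1 + a^2) bounds the integral over
   the ball of radius rho. *)
pose W := (2 * (1 + M ^+ 2) * V)%R.
have M2 : (0 <= M ^+ 2)%R by exact: sqr_ge0.
have W0 : (0 <= W)%R by rewrite !mulr_ge0// addr_ge0.
have e16 : (0 < e / 16)%R by exact: divr_gt0.
near=> s.
have s0 : (0 < s)%R by near: s; exact: nbhs_right_gt.
have s1 : (s <= 1)%R by near: s; exact: nbhs_right_le.
have sW : (s * W <= e / 4)%R.
  have : (s <= e / 4 / (W + 1))%R.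
    by near: s; apply: nbhs_right_le; rewrite !divr_gt0//; lra.
  rewrite ler_pdivlMr; last by lra.
  by rewrite mulrDr mulr1; apply: le_trans; rewrite lerDl ltW.
have [m0 m0E m0l] : exists2 m : R, mass (fun _ : E => 1%R) s = m%:E &
  (`|m - a0| <= e / 16)%R by near: s; exact: t0.
have [m1 m1E m1l] : exists2 m : R, mass v s = m%:E &
  (`|m - a1| <= e / 16)%R by near: s; exact: t1.
have [m2 m2E m2l] : exists2 m : R, mass (fun y => v y ^+ 2)%R s = m%:E &
  (`|m - a2| <= e / 16)%R by near: s; exact: t2.
move=> x a xr.
set T := (1 + a ^+ 2)%R.
have a20 : (0 <= a ^+ 2)%R by exact: sqr_ge0.
have mv2 : measurable_fun setT (fun y => v y ^+ 2)%R by exact: measurable_funX.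
have v2M y : (`|v y ^+ 2| <= M ^+ 2)%R.
  rewrite normrX ler_pXn2r ?nnegrE ?normr_ge0//.
  exact: le_trans (normr_ge0 _) (vM y).
have massG : mass (fun y => (a - v y) ^+ 2)%R s = (quad m0 m1 m2 a)%:E.
  have one1 (y : E) : (`|1 : R| <= 1)%R by rewrite normr1.
  have L1 := mass_lincomb n0 (- (2 * a)) 1 s0 mv vM mv2 v2M m1E m2E.
  have b1 (y : E) : (`|- (2 * a) * v y + 1 * v y ^+ 2| <=
      `|2 * a| * M + M ^+ 2)%R.
    apply: (le_trans (ler_normD _ _)); rewrite mul1r lerD//.
    by rewrite normrM normrN ler_wpM2l.
  have mL1 : measurable_fun setT (fun y : E => - (2 * a) * v y + 1 * v y ^+ 2)%R.
    by apply: measurable_funD; apply: measurable_funM.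
  have L2 := mass_lincomb n0 (a ^+ 2) 1 s0 (measurable_cst _) one1 mL1 b1 m0E L1.
  transitivity (mass (fun y : E => a ^+ 2 * 1 +
      1 * (- (2 * a) * v y + 1 * v y ^+ 2))%R s).
    by congr (mass _ s); apply/funext => y; ring.
  by rewrite L2 /quad; congr EFin; ring.
have iE : \int[leb]_(y in outside 1)
    ((a - v y) ^+ 2 * riesz (d + 2 * s) y)%:E = (quad m0 m1 m2 a / s)%:E.
  move: massG; rewrite massE.
  have sV : s^-1%:E * s%:E = 1 by rewrite -EFinM mulVf// gt_eqF.
  by move/(congr1 (fun t => s^-1%:E * t)); rewrite muleA sV mul1e => ->;
    rewrite -EFinM mulrC.
have p0 : (0 <= d + 2 * s)%R by rewrite addr_ge0// mulr_ge0// ltW.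
have p2 : (0 <= d + 2 * s <= n.+2%:R)%R.
  rewrite p0/= -[n.+2]addn2 natrD lerD2l.
  by rewrite -[leRHS]mulr1 ler_pM2l.
have GG y : (0 <= (a - v y) ^+ 2 <= 2 * (1 + M ^+ 2) * T)%R.
  rewrite sqr_ge0/= /T.
  have vv : (v y ^+ 2 <= M ^+ 2)%R := le_trans (ler_norm _) (v2M y).
  have M2a := mulr_ge0 M2 a20; have avy := sqr_ge0 (a + v y).
  apply: (@le_trans _ _ (2 * (a ^+ 2 + M ^+ 2)))%R; last by lra.
  by move: vv avy; rewrite sqrrB sqrrD; lra.
have mG : measurable_fun setT (fun y => (a - v y) ^+ 2)%R.
  by apply: measurable_funX; exact: measurable_funB.
have e'01' : (0 <= e' <= 1)%R by rewrite ltW.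
have /andP[] := integral_far_compare rho1 e'01' p0
  (fun y yr => cmp x y _ xr yr p2) mG GG iE.
have sE : 0 <= s%:E by rewrite lee_fin ltW.
move=> /(lee_wpmul2l sE) lo /(lee_wpmul2l sE) hi.
move: lo hi; rewrite -/V -!EFinM => lo hi.
have := quad_close a m0l m1l m2l; have := quad_bound a0 a1 a2 a.
rewrite -/Cq -/T; move: lo hi.
set m := quad m0 m1 m2 a; set q := quad a0 a1 a2 a.
set I := s%:E * _ => lo hi qb mq.
have T0 : (0 <= T)%R by rewrite addr_ge0.
have sm : (s * (m / s) = m)%R by rewrite mulrC divfK// gt_eqF.
have e'q : (`|e' * q| <= e * T / 4)%R.
  rewrite [leRHS]mulrAC normrM (gtr0_norm e'0).
  apply: (@le_trans _ _ (e' * Cq * T))%R; last by rewrite ler_wpM2r.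
  by rewrite -mulrA ler_wpM2l// ltW.
have mqE : (3 * (e / 16) * T = 3 / 16 * (e * T))%R by ring.
move: mq e'q; rewrite mqE ler_norml => /andP[mq1 mq2].
rewrite ler_norml => /andP[eq1 eq2].
have eT : (0 <= e * T)%R by rewrite mulr_ge0// ltW.
apply/andP; split.
- apply: le_trans lo; rewrite lee_fin.
  have -> : (s * ((1 - e') * (m / s - 2 * (1 + M ^+ 2) * T * V)) =
      (1 - e') * (m - s * W * T))%R by rewrite -[in RHS]sm /W; ring.
  apply: lower_error => //; rewrite [leRHS]mulrAC ler_wpM2r//.
- apply: (le_trans hi); rewrite lee_fin.
  have -> : (s * ((1 + e') * (m / s)) = (1 + e') * m)%R.
    by rewrite -[in RHS]sm; ring.
  exact: upper_error.
Unshelve. all: by end_near. Qed.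

End far_limit.

(** * Interactions at bounded distance *)

Section tonelli_on_products.
Context d1 d2 (T1 : measurableType d1) (T2 : measurableType d2) (R : realType).
Variables (m1 : {sigma_finite_measure set T1 -> \bar R}).
Variables (m2 : {sigma_finite_measure set T2 -> \bar R}).
Variables (A : set T1) (B : set T2) (f : T1 * T2 -> \bar R).
Hypotheses (mA : measurable A) (mB : measurable B).
Hypotheses (mf : measurable_fun setT f) (f0 : forall x, (0 <= f x)%E).
Local Open Scope ereal_scope.

Let mfAB : measurable_fun setT (f \_ (A `*` B)).
Proof.
apply: (iffLR (measurable_restrictT f (measurableX mA mB))).
exact: measurable_funTS.
Qed.

Let fAB0 x : 0 <= (f \_ (A `*` B)) x.
Proof. exact: (erestrict_ge0 (fun y _ => f0 y)). Qed.

Let fABE x y : (f \_ (A `*` B)) (x, y) =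
  if (x \in A) && (y \in B) then f (x, y) else 0.
Proof.
by rewrite patchE in_setX.
Qed.

Lemma measurable_tonelli_inner :
  measurable_fun setT (fun x => \int[m2]_(y in B) f (x, y)).
Proof.
have mfB : measurable_fun setT (f \_ (setT `*` B)).
  apply: (iffLR (measurable_restrictT f (measurableX measurableT mB))).
  exact: measurable_funTS.
have fB0 x : 0 <= (f \_ (setT `*` B)) x.
  exact: (erestrict_ge0 (fun y _ => f0 y)).
have := @measurable_fun_fubini_tonelli_F _ _ T1 T2 R m2 _ mfB fB0.
rewrite /fubini_F; congr (measurable_fun _ _); apply/funext => x.
rewrite [RHS]integral_mkcond; apply: eq_integral => y _.
by rewrite !patchE in_setX in_setT.
Qed.

Lemma tonelli_setX1 : \int[m1 \x m2]_(p in A `*` B) f p =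
  \int[m1]_(x in A) \int[m2]_(y in B) f (x, y).
Proof.
rewrite integral_mkcond (fubini_tonelli1 _ mfAB fAB0) [RHS]integral_mkcond.
apply: eq_integral => x _; rewrite /fubini_F patchE.
under eq_integral do rewrite fABE.
case: ifPn => /= _; last by rewrite integral0.
by rewrite [RHS]integral_mkcond; apply: eq_integral => y _; rewrite patchE.
Qed.

Lemma tonelli_setX2 : \int[m1 \x m2]_(p in A `*` B) f p =
  \int[m2]_(y in B) \int[m1]_(x in A) f (x, y).
Proof.
rewrite integral_mkcond (fubini_tonelli2 _ mfAB fAB0) [RHS]integral_mkcond.
apply: eq_integral => y _; rewrite /fubini_G patchE.
under eq_integral do rewrite fABE.
case: ifPn => /= _; last first.
  by under eq_integral do rewrite andbF; rewrite integral0.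
rewrite [RHS]integral_mkcond; apply: eq_integral => x _.
by rewrite patchE andbT.
Qed.

End tonelli_on_products.

Section near_field.
Context {R : realType} {n : nat}.
Hypothesis n0 : (0 < n)%N.
Local Notation E := 'rV[R]_n.
Local Notation leb := (@lebesgue_rV R n).
Local Notation d := (n%:R : R).
Local Open Scope ereal_scope.

Lemma measurable_rV_add : measurable_fun setT (fun p : E * E => p.1 + p.2)%R.
Proof.
apply/measurable_fun_rVP => i.
under eq_fun do rewrite !mxE.
apply: measurable_funD.
  apply: (measurableT_comp (measurable_coor i)); exact: measurable_fst.
apply: (measurableT_comp (measurable_coor i)); exact: measurable_snd.
Qed.

Lemma measurable_rV_sub : measurable_fun setT (fun p : E * E => p.1 - p.2)%R.
Proof.
apply/measurable_fun_rVP => i.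
under eq_fun do rewrite !mxE.
apply: measurable_funB.
  apply: (measurableT_comp (measurable_coor i)); exact: measurable_fst.
apply: (measurableT_comp (measurable_coor i)); exact: measurable_snd.
Qed.

Lemma measurable_translation (z : E) : measurable_fun setT (fun x : E => x + z)%R.
Proof.
rewrite (_ : (fun x : E => x + z)%R = (fun x => 1 *: x + z)%R).
  exact: measurable_rV_affine.
by apply/funext => x; rewrite scale1r.
Qed.

(** Stronger, for a bounded u, than a bound O(|z|) on the L^1 norm over Omega
    of the increments of u, but preserved by composition with arbitrary
    functions, which makes it easy to produce. *)
Definition translation_stable (Omega : set E) (u : E -> R) :=
  exists2 C : R, (0 <= C)%R & forall z : E,
    leb [set x | Omega x /\ u x <> u (x + z)%R] <= (C * eucl_norm z)%:E.

Lemma measurable_neq (f g : E -> R) : measurable_fun setT f ->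
  measurable_fun setT g -> measurable [set x | f x <> g x].
Proof.
move=> mf mg; rewrite (_ : [set _ | _] = ~` [set x | f x == g x]).
  apply: measurableC.
  exact: (measurable_preimageT (measurable_fun_eqr mf mg) (B := [set true])).
by apply/seteqP; split => x /= => [/eqP/negP|/negP/eqP].
Qed.

(** The factor |z| lowers the exponent of the kernel to d + 2s - 1 < d, which
    is integrable at the origin. For s <= 1/4 the gap 1 - 2s is at least 1/2,
    so the geometric series has ratio at most 2^(-1/2), uniformly in s. *)
Lemma near_singular_bound (r : R) : (1 <= r)%R -> exists2 C : R, (0 <= C)%R &
  forall s : R, (0 < s <= 4^-1)%R ->
  \int[leb]_(z in eball n r) (eucl_norm z * riesz (d + 2 * s) z)%:E <= C%:E.
Proof.
move=> r1.
pose V := fine (leb (shell 1 2)).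
have VE : leb (shell 1 2) = V%:E.
  by rewrite fineK// ge0_fin_numE// shell_lty.
have V0 : (0 <= V)%R by rewrite fine_ge0.
pose h : R := (2^-1 `^ 2^-1)%R.
have half0 : (0 < 2^-1 :> R)%R by rewrite invr_gt0.
have h0 : (0 <= h)%R by exact: powR_ge0.
have h1 : (h < 1)%R.
  by rewrite powR_lt1// lnV ?posrE// mulrN oppr_lt0 mulr_gt0// ln_gt0// ltr1n.
exists (r * V / (1 - h))%R.
  by rewrite divr_ge0// ?mulr_ge0 ?subr_ge0 ?(ltW h1)// (le_trans ler01).
move=> s /andP[s0 s4].
pose q := (d + 2 * s - 1)%R.
have d1 : (1 <= d)%R by rewrite ler1n.
have q0 : (0 <= q)%R by rewrite /q; lra.
have qd : (q < d)%R by rewrite /q; lra.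
have [j [jE j0 jV]] := shell_integral_fin n0 q0.
have rpos : (0 < r)%R by lra.
have mq D : measurable_fun D (fun z : E => (eucl_norm z * riesz (d + 2 * s) z)%:E).
  apply/measurable_EFinP; apply: measurable_funTS; apply: measurable_funM => //.
    exact: measurable_eucl_norm.
  exact: measurable_riesz.
have mP : measurable [set z : E | (0 < eucl_norm z < r)%R].
  rewrite (_ : [set _ | _] = [set z | (0 < eucl_norm z)%R] `&` eball n r).
    apply: measurableI; last exact: measurable_eball.
    by apply: measurable_ltr => //; exact: measurable_eucl_norm.
  by apply/seteqP; split => z /= /andP.
have -> : \int[leb]_(z in eball n r) (eucl_norm z * riesz (d + 2 * s) z)%:E =
    \int[leb]_(z in [set z : E | (0 < eucl_norm z < r)%R]) (riesz q z)%:E.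
  rewrite integral_mkcond [RHS]integral_mkcond; apply: eq_integral => z _.
  rewrite !patchE.
  have [z0|z0] := eqVneq (eucl_norm z) 0%R.
    rewrite [in RHS]ifF; last by apply/negP => /set_mem/=; rewrite z0 ltxx.
    by case: ifP => // _; rewrite z0 mul0r.
  have zpos : (0 < eucl_norm z)%R by rewrite lt_neqAle eq_sym z0 eucl_norm_ge0.
  have -> : (z \in eball n r) = (z \in [set z : E | (0 < eucl_norm z < r)%R]).
    by apply/idP/idP => /set_mem/= zr; apply/mem_set => /=;
      rewrite /eball/= ?zpos//; case/andP: zr.
  case: ifP => // _; congr EFin.
  have rinv : riesz (- 1) z = eucl_norm z.
    by rewrite /riesz powRN invrK powRr1// ltW.
  by rewrite /q [in RHS]rieszD// rinv mulrC.
rewrite (integral_riesz_near qd rpos jE) lee_fin.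
have th : (d - q = 1 - 2 * s)%R by rewrite /q; ring.
rewrite th.
have rh : (r `^ (1 - 2 * s) <= r)%R by rewrite ler1_powR//; lra.
have hh : (2^-1 `^ (1 - 2 * s) <= h)%R.
  by apply: ger_powR; [rewrite half0 invf_le1// ler1n|lra].
have jV' : (j <= V)%R by rewrite -lee_fin -VE.
have rr0 : (0 <= r `^ (1 - 2 * s))%R by exact: powR_ge0.
have hh0 : (0 <= 2^-1 `^ (1 - 2 * s) :> R)%R by exact: powR_ge0.
rewrite ler_pM ?mulr_ge0 ?(ltW j0)//.
- by rewrite invr_ge0 subr_ge0 (le_trans hh)// ltW.
- rewrite ler_pM ?mulr_ge0 ?(ltW j0)//.
  apply: (@le_trans _ _ (r * 1)%R); last by rewrite mulr1.
  by rewrite ler_pM// (le_trans hh)// ltW.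
- rewrite lef_pV2 ?posrE ?subr_gt0 ?(le_lt_trans hh)//.
  by rewrite lerD2l lerN2.
Qed.

(** Put y = x + z and exchange the integrals: for given z the integrand is at
    most 4 M^2 |z|^(-d-2s) and lives on the set where u x differs from
    u (x + z), of measure at most C |z|. What is left is the integral bounded
    in near_singular_bound. *)
Lemma near_bound (Omega : set E) (u : E -> R) M (r rho : R) :
  measurable Omega -> Omega `<=` eball n r -> (r <= rho)%R -> (1 <= rho)%R ->
  measurable_fun setT u -> (forall x, `|u x| <= M)%R ->
  translation_stable Omega u ->
  exists2 C : R, (0 <= C)%R & forall s : R, (0 < s <= 4^-1)%R ->
    \int[leb]_(x in Omega) \int[leb]_(y in eball n rho)
      ((u x - u y) ^+ 2 * riesz (d + 2 * s) (x - y))%:E <= C%:E.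
Proof.
move=> mO Or rrho rho1 mu uM [C C0 uC].
have rho2 : (1 <= 2 * rho)%R by lra.
have [C1 C10 C1P] := near_singular_bound rho2.
have M0 : (0 <= M)%R by exact: le_trans (normr_ge0 _) (uM 0%R).
exists (4 * M ^+ 2 * C * C1)%R.
  by rewrite !mulr_ge0// sqr_ge0.
move=> s s4; have /andP[s0 _] := s4.
set p := (d + 2 * s)%R.
(* Pairs (x, z) that contribute; h dominates the interaction of x and x +
   z. *)
pose W : set (E * E) := [set q | u q.1 <> u (q.1 + q.2)%R].
have mW : measurable W.
  rewrite (_ : W = ~` [set q : E * E | u q.1 == u (q.1 + q.2)%R]).
    apply: measurableC.
    have m1 : measurable_fun setT (fun q : E * E => u q.1).
      by apply: measurableT_comp => //; exact: measurable_fst.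
    have m2 : measurable_fun setT (fun q : E * E => u (q.1 + q.2)%R).
      by apply: (measurableT_comp mu); exact: measurable_rV_add.
    exact: (measurable_preimageT (measurable_fun_eqr m1 m2) (B := [set true])).
  by apply/seteqP; split => x /= => [/eqP/negP|/negP/eqP].
pose h (q : E * E) : \bar R :=
  (4 * M ^+ 2 * (riesz p q.2 * \1_W q))%:E.
have h0 q : 0 <= h q.
  by rewrite lee_fin !mulr_ge0 ?riesz_ge0 ?sqr_ge0// indicE.
have mh : measurable_fun setT h.
  apply/measurable_EFinP; apply: measurable_funM => //; apply: measurable_funM.
    by apply: (measurableT_comp (measurable_riesz p)); exact: measurable_snd.
  exact: measurable_indic.
have mu2 (x : E) : measurable_fun setT
    (fun y => ((u x - u y) ^+ 2 * riesz p (x - y))%:E).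
  apply/measurable_EFinP; apply: measurable_funM; last first.
    exact: measurable_riesz_shift.
  by apply: measurable_funX; exact: measurable_funB.
have inner (x : E) : Omega x ->
    \int[leb]_(y in eball n rho) ((u x - u y) ^+ 2 * riesz p (x - y))%:E <=
    \int[leb]_(z in eball n (2 * rho)) h (x, z).
  move=> Ox; rewrite (ge0_integral_translation x); last 3 first.
  - exact: measurable_eball.
  - exact: measurable_funTS.
  - by move=> y _; rewrite lee_fin mulr_ge0 ?riesz_ge0 ?sqr_ge0.
  have mB : measurable [set z : E | eball n rho (z + x)%R].
    apply: (measurable_preimageT (measurable_translation x)).
    exact: measurable_eball.
  have mg : measurable_fun setT
      (fun z : E => ((u x - u (z + x)) ^+ 2 * riesz p (x - (z + x)))%:E).
    exact: (measurableT_comp (mu2 x) (measurable_translation x)).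
  have mhx D : measurable_fun D (fun z => h (x, z)).
    apply: measurable_funTS; apply: (measurableT_comp mh).
    exact: measurable_pair1.
  apply: (@le_trans _ _ (\int[leb]_(z in [set z : E | eball n rho (z + x)%R])
     h (x, z))).
    apply: ge0_le_integral => //.
    - by move=> y _; rewrite lee_fin mulr_ge0 ?riesz_ge0 ?sqr_ge0.
    - exact: measurable_funTS.
    - move=> z _; rewrite lee_fin.
      have -> : (x - (z + x) = - z)%R by rewrite opprD addrCA subrr addr0.
      rewrite /riesz eucl_normN -/(riesz p z) indicE.
      have [uxz|uxz] := eqVneq (u x) (u (z + x)%R).
        by rewrite uxz subrr expr0n mul0r !mulr_ge0 ?riesz_ge0 ?sqr_ge0.
      rewrite mem_set/=; last by apply/eqP; rewrite addrC.
      rewrite mulr1 ler_wpM2r ?riesz_ge0//.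
      have := uM x; have := uM (z + x)%R.
      rewrite !ler_norml => /andP[? ?] /andP[? ?]; nra.
  apply: ge0_subset_integral => //.
  - exact: measurable_eball.
  - move=> z /=; rewrite /eball/= => zx.
    have := eucl_normB z (- x); rewrite opprK eucl_normN.
    by have := Or _ Ox; rewrite /eball/=; lra.
apply: (@le_trans _ _ (\int[leb]_(x in Omega)
    \int[leb]_(z in eball n (2 * rho)) h (x, z))).
  have mF : measurable_fun setT (fun q : E * E =>
      ((u q.1 - u q.2) ^+ 2 * riesz p (q.1 - q.2))%:E).
    apply/measurable_EFinP; apply: measurable_funM; last first.
      apply: (measurableT_comp (measurable_riesz p)); exact: measurable_rV_sub.
    apply: measurable_funX; apply: measurable_funB.
      by apply: (measurableT_comp mu); exact: measurable_fst.
    by apply: (measurableT_comp mu); exact: measurable_snd.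
  apply: ge0_le_integral => //.
  - move=> x _; apply: integral_ge0 => y _.
    by rewrite lee_fin mulr_ge0 ?riesz_ge0 ?sqr_ge0.
  - apply: measurable_funTS.
    apply: (measurable_tonelli_inner leb (measurable_eball rho) mF).
    by move=> q; rewrite lee_fin mulr_ge0 ?riesz_ge0 ?sqr_ge0.
  - apply: measurable_funTS.
    exact: (measurable_tonelli_inner leb (measurable_eball _) mh).
rewrite -tonelli_setX1//; last exact: measurable_eball.
rewrite tonelli_setX2//; last exact: measurable_eball.
have K0 : (0 <= 4 * M ^+ 2 * C)%R by rewrite !mulr_ge0// sqr_ge0.
have mzK D : measurable_fun D (fun z : E => (eucl_norm z * riesz p z)%:E).
  apply/measurable_EFinP; apply: measurable_funTS; apply: measurable_funM => //.
    exact: measurable_eucl_norm.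
  exact: measurable_riesz.
have zK0 (z : E) : 0 <= (eucl_norm z * riesz p z)%:E.
  by rewrite lee_fin mulr_ge0 ?riesz_ge0 ?eucl_norm_ge0.
apply: (@le_trans _ _ (\int[leb]_(z in eball n (2 * rho))
    ((4 * M ^+ 2 * C)%:E * (eucl_norm z * riesz p z)%:E))); last first.
  rewrite ge0_integralZl_EFin//; last exact: measurable_eball.
  by rewrite [leRHS]EFinM lee_pmul// ?integral_ge0// C1P.
apply: ge0_le_integral.
- exact: measurable_eball.
- by move=> z _; apply: integral_ge0.
- apply: measurable_funTS.
  have mhs : measurable_fun setT (fun q : E * E => h (unstable.swap q)).
    apply: (measurableT_comp mh); exact: measurable_swap.
  by apply: (measurable_tonelli_inner leb mO mhs) => q.
- apply: emeasurable_funM => //.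
- move=> z _.
  have mWz : measurable [set x : E | u x <> u (x + z)%R].
    apply: measurable_neq => //; apply: (measurableT_comp mu).
    exact: measurable_translation.
  have -> : \int[leb]_(x in Omega) h (x, z) =
      (4 * M ^+ 2 * riesz p z)%:E * leb [set x | Omega x /\ u x <> u (x + z)%R].
    have -> : [set x | Omega x /\ u x <> u (x + z)%R] =
        [set x : E | u x <> u (x + z)%R] `&` Omega by rewrite setIC.
    rewrite -integral_indic// -ge0_integralZl_EFin//.
    + apply: eq_integral => x _; by rewrite -EFinM /h/= mulrA; congr (_ * _)%:E.
    + by apply/measurable_EFinP; apply: measurable_funTS; exact: measurable_indic.
    + by rewrite !mulr_ge0 ?riesz_ge0 ?sqr_ge0.
  have K1 : 0 <= (4 * M ^+ 2 * riesz p z)%:E.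
    by rewrite lee_fin !mulr_ge0 ?riesz_ge0 ?sqr_ge0.
  apply: (le_trans (lee_wpmul2l K1 (uC z))).
  rewrite -!EFinM lee_fin le_eqVlt; apply/orP; left; apply/eqP; ring.
Qed.

End near_field.

(** * Lipschitz domains and translations *)

Section stacked_translates.
Context {R : realType} {n : nat}.
Local Notation E := 'rV[R]_n.
Local Notation leb := (@lebesgue_rV R n).
Local Open Scope ereal_scope.

(** Translating by k t in the direction u moves the layer 0 < h <= t to the
    disjoint layer k t < h <= (k + 1) t without changing its measure. The
    layers with k t <= 1 stay in the ball of radius r + 1, and for t <= 1/2
    there are at least 1/(2t) of them. *)
Lemma stacked_translates (T : set E) (h : E -> R) (u : E) (t r : R) :
  measurable T -> (0 < t)%R -> (eucl_norm u <= 1)%R ->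
  (forall x a, h (x + a *: u) = h x + a)%R ->
  (forall x, T x -> (0 < h x <= t)%R) -> T `<=` eball n r ->
  leb T <= (2 * fine (leb (eball n (r + 1))) * t)%:E.
Proof.
move=> mT t0 u1 hu hT Tr.
have mball := @measurable_eball R n (r + 1).
have Vfin : leb (eball n (r + 1)) \is a fin_num.
  by rewrite ge0_fin_numE// lebesgue_eball.
set V := fine _.
have VE : leb (eball n (r + 1)) = V%:E by rewrite fineK.
have TB : T `<=` eball n (r + 1).
  by move=> x /Tr; rewrite /eball/=; lra.
have TV : leb T <= V%:E by rewrite -VE; apply: le_measure; rewrite ?inE.
have [tau tauE] : exists tau : R, leb T = tau%:E.
  exists (fine (leb T)); rewrite fineK// ge0_fin_numE//.
  exact: le_lt_trans TV (ltry _).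
have tau0 : (0 <= tau)%R by rewrite -lee_fin -tauE measure_ge0.
rewrite tauE lee_fin; move: TV; rewrite tauE lee_fin => tauV.
(* For t > 1/2 a single layer is enough; otherwise N t lies in (1 - t, 1] and
   hence exceeds 1/2. *)
have [t2|t2] := ltP 2^-1%R t.
  apply: (le_trans tauV); rewrite mulrAC ler_peMl//; lra.
pose N := Num.truncn t^-1.
have tinv0 : (0 <= t^-1)%R by rewrite invr_ge0 ltW.
have /andP[N1 N2] := truncn_itv tinv0.
pose F (k : nat) : set E := [set y | T (y + (- (k%:R * t)) *: u)%R].
have FE k : leb (F k) = tau%:E by rewrite lebesgue_rV_translation.
have mF k : measurable (F k).
  exact: (measurable_preimageT (measurable_translation _) mT).
have hF k y : F k y -> (k%:R * t < h y <= k.+1%:R * t)%R.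
  by move=> /hT; rewrite hu -natr1 => /andP[h1 h2]; apply/andP; split; lra.
have tF : trivIset setT F.
  apply/trivIsetP => i j _ _; wlog ij : i j / (i < j)%N => [wlg|_].
    rewrite neq_ltn => /orP[] ij; first by rewrite wlg// neq_ltn ij.
    by rewrite setIC wlg// neq_ltn ij.
  rewrite -subset0 => y [/hF/andP[_ hi] /hF/andP[hj _]] /=.
  have : (i.+1%:R * t <= j%:R * t)%R by rewrite ler_pM2r// ler_nat.
  by move=> /(le_trans hi)/(lt_le_trans hj); rewrite ltxx.
have Nt : (N%:R * t <= 1)%R by rewrite -ler_pdivlMr// mul1r.
have NV : (N%:R * tau <= V)%R.
  rewrite -lee_fin -VE.
  have -> : (N%:R * tau)%:E = leb (\big[setU/set0]_(k < N) F k).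
    rewrite measure_bigsetU//=; under eq_bigr do rewrite FE.
    by rewrite sumEFin sumr_const card_ord mulr_natl.
  apply: le_measure; rewrite ?inE//; first exact: bigsetU_measurable.
  rewrite -bigcup_mkord => y [k /= kN /Tr]; rewrite /eball/= => yr.
  have -> : y = (y + - (k%:R * t) *: u + (k%:R * t) *: u)%R.
    by rewrite scaleNr subrK.
  apply: (le_lt_trans (eucl_normD _ _)).
  have kt0 : (0 <= k%:R * t)%R by rewrite mulr_ge0// ltW.
  rewrite eucl_normZ ger0_norm//.
  have kt1 : (k%:R * t <= 1)%R.
    by apply: le_trans Nt; rewrite ler_pM2r// ler_nat ltnW.
  have : (k%:R * t * eucl_norm u <= 1)%R.
    by rewrite -[leRHS]mulr1 ler_pM// eucl_norm_ge0.
  lra.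
have N12 : (1 <= 2 * t * N%:R)%R.
  have : (1 < N.+1%:R * t)%R by rewrite -ltr_pdivrMr// mul1r.
  rewrite -natr1; lra.
apply: (@le_trans _ _ (2 * t * (N%:R * tau)))%R.
  by rewrite mulrA ler_peMl.
by rewrite [leRHS]mulrAC ler_wpM2l// mulr_ge0// ltW.
Qed.

End stacked_translates.

Section lipschitz_domains.
Context {R : realType} {n : nat}.
Local Notation E := 'rV[R]_n.+1.
Local Notation leb := (@lebesgue_rV R n.+1).

Lemma eucl_norm_col' (y : E) (i : 'I_n.+1) :
  eucl_norm (col' i y) <= eucl_norm y.
Proof.
apply: eucl_norm_le; first exact: eucl_norm_ge0.
rewrite eucl_norm_sqr (bigD1_ord i)//= -[leLHS]add0r lerD ?sqr_ge0//.
by apply: ler_sum => j _; rewrite mxE.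
Qed.

Section graph_height.
Variables (O : 'M[R]_n.+1) (g : 'rV[R]_n -> R) (L : R).
Hypothesis OO : O *m O^T = 1%:M.
Hypothesis gL : forall a b, `|g a - g b| <= L * eucl_norm (a - b).

(** In the coordinates of the graph, how far x lies above it. *)
Definition height (x : E) := (x *m O) ord0 ord_max - g (col' ord_max (x *m O)).

(** The unit vector which in the coordinates of the graph is the last one. *)
Definition graph_axis : E := delta_mx ord0 ord_max *m O^T.

Lemma eucl_norm_graph_axis : eucl_norm graph_axis = 1.
Proof.
rewrite eucl_norm_mulmx; last by rewrite trmxK; exact: mulmx1C.
rewrite /eucl_norm (bigD1 ord_max)//= mxE !eqxx/= big1 ?addr0 ?expr1n ?sqrtr1//.
by move=> i /negPf im; rewrite mxE im andbF expr0n.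
Qed.

Lemma height_axis x a : height (x + a *: graph_axis) = height x + a.
Proof.
have upO : graph_axis *m O = delta_mx ord0 ord_max.
  by rewrite -mulmxA (mulmx1C OO) mulmx1.
rewrite /height mulmxDl -scalemxAl upO.
have -> : col' ord_max (x *m O + a *: delta_mx ord0 ord_max) =
    col' ord_max (x *m O).
  apply/rowP => i; rewrite !mxE eqxx/=.
  by rewrite eq_sym (negPf (neq_lift _ _)) mulr0 addr0.
by rewrite !mxE !eqxx/= mulr1; ring.
Qed.

Lemma height_lipschitz x y :
  height x - height y <= (1 + `|L|) * eucl_norm (x - y).
Proof.
have E1 : (x - y) *m O = x *m O - y *m O by rewrite mulmxBl.
have H1 : (x *m O) ord0 ord_max - (y *m O) ord0 ord_max <= eucl_norm (x - y).
  rewrite -(eucl_norm_mulmx (x - y) OO) E1.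
  apply: le_trans (coord_le_eucl_norm _ ord_max); rewrite !mxE; exact: ler_norm.
have H2 : g (col' ord_max (y *m O)) - g (col' ord_max (x *m O)) <=
    `|L| * eucl_norm (x - y).
  apply: (le_trans (ler_norm _)); apply: (le_trans (gL _ _)).
  have -> : col' ord_max (y *m O) - col' ord_max (x *m O) =
      col' ord_max (y *m O - x *m O) by apply/rowP => i; rewrite !mxE.
  apply: (le_trans (ler_wpM2r (eucl_norm_ge0 _) (ler_norm L))).
  rewrite ler_wpM2l//; apply: (le_trans (eucl_norm_col' _ _)).
  by rewrite -mulmxBl eucl_norm_mulmx// eucl_normBC.
rewrite /height; lra.
Qed.

End graph_height.
End lipschitz_domains.

Section exit_bound.
Context {R : realType} {n : nat}.
Local Notation E := 'rV[R]_n.+1.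
Local Notation leb := (@lebesgue_rV R n.+1).
Local Open Scope ereal_scope.

Definition exits (Omega : set E) (z : E) : set E :=
  [set x | Omega x /\ ~ Omega (x + z)%R].

Lemma measurable_exits (Omega : set E) z : measurable Omega ->
  measurable (exits Omega z).
Proof.
move=> mO; apply: measurableI => //.
apply: measurableC; exact: (measurable_preimageT (measurable_translation z) mO).
Qed.

Definition near_point (p : E) (r : R) : set E :=
  [set x | (eucl_norm (x - p) < r)%R].

Lemma measurable_near_point p r : measurable (near_point p r).
Proof.
apply: measurable_ltr => //.
apply: (measurableT_comp (@measurable_eucl_norm R n.+1)).
exact: measurable_translation.
Qed.

Lemma near_point_eball p r :
  near_point p r `<=` eball n.+1 (r + eucl_norm p).
Proof.
move=> x; rewrite /near_point /eball/= => xp.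
rewrite -(subrK p x); apply: (le_lt_trans (eucl_normD _ _)).
by rewrite ltrD2r.
Qed.

(** At an interior point nothing exits for small z. At a boundary point an
    exiting x has positive height while x + z has height at most 0; the height
    being Lipschitz, that of x is at most a multiple of |z|, and such a layer
    has measure O(|z|). *)
Lemma exits_local (Omega : set E) p : open Omega ->
  lipschitz_boundary Omega -> closure Omega p ->
  exists r C : R, [/\ (0 < r)%R, (0 <= C)%R &
    forall z, (eucl_norm z < r)%R ->
      leb (exits Omega z `&` near_point p r) <= (C * eucl_norm z)%:E].
Proof.
move=> oO lO cp; have mO := open_measurable_rV oO.
have [Op|nOp] := pselect (Omega p).
  have [r r0 rO] := open_eucl_norm oO Op.
  exists (r / 2)%R, 0%R; split => //; first exact: divr_gt0.
  move=> z zr; rewrite mul0r.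
  have -> : exits Omega z `&` near_point p (r / 2) = set0.
    rewrite -subset0 => x [[_ nOxz]]; rewrite /near_point/= => xp.
    apply: nOxz; apply: rO; rewrite addrAC.
    by apply: (le_lt_trans (eucl_normD _ _)); lra.
  by rewrite measure0.
have /lO[r [Q [g [r0 OO [L gL] rO]]]] : (closure Omega `\` interior Omega) p.
  by split => // /interior_subset.
(* The Lipschitz constant of the height. *)
pose c : R := (1 + `|L|)%R.
have c0 : (0 < c)%R by rewrite ltr_wpDr.
pose V := fine (leb (eball n.+1 (r / 2 + eucl_norm p + 1))).
have V0 : (0 <= V)%R by rewrite fine_ge0.
exists (r / 2)%R, (2 * V * c)%R; split; first exact: divr_gt0.
  by rewrite !mulr_ge0// ltW.
move=> z zr.
have [z0|z0] := eqVneq z 0%R.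
  rewrite (_ : _ `&` _ = set0).
    by rewrite measure0 lee_fin !mulr_ge0 ?eucl_norm_ge0// ltW.
  by rewrite -subset0 => x [[Ox nOx] _]; apply: nOx; rewrite z0 addr0.
have zpos : (0 < eucl_norm z)%R.
  rewrite lt_neqAle eucl_norm_ge0 andbT eq_sym; apply/eqP => /eucl_norm_eq0/eqP.
  by rewrite (negPf z0).
rewrite -[(_ * c * _)%R]mulrA.
apply: (@stacked_translates _ _ _ (height Q g) (graph_axis Q)) => //.
- apply: measurableI; [exact: measurable_exits|exact: measurable_near_point].
- exact: mulr_gt0.
- by rewrite eucl_norm_graph_axis.
- exact: height_axis.
- move=> x [[Ox nOxz]]; rewrite /near_point/= => xp.
  have hpos : (0 < height Q g x)%R.
    by rewrite subr_gt0; apply/(rO x) => //; lra.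
  have hneg : (height Q g (x + z) <= 0)%R.
    rewrite leNgt subr_gt0; apply/negP => /(rO (x + z)%R) H; apply/nOxz/H.
    by rewrite addrAC; apply: (le_lt_trans (eucl_normD _ _)); lra.
  have := height_lipschitz OO gL x (x + z)%R.
  have -> : (x - (x + z) = - z)%R by rewrite opprD addrA subrr add0r.
  rewrite eucl_normN -/c hpos/=; lra.
- by move=> x [_ /near_point_eball].
Qed.

(** Finitely many of the neighbourhoods of the local estimate cover Omega. For
    z too large for the local estimate, the volume of Omega is itself
    O(|z|). *)
Lemma exits_bound (Omega : set E) : open Omega -> bounded_set Omega ->
  lipschitz_boundary Omega -> exists2 C : R, (0 <= C)%R &
    forall z, leb (exits Omega z) <= (C * eucl_norm z)%:E.
Proof.
move=> oO bO lO; have mO := open_measurable_rV oO.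
have /choice[rC rCP] : forall p : E, exists rC : R * R, closure Omega p ->
    [/\ (0 < rC.1)%R, (0 <= rC.2)%R &
    forall z, (eucl_norm z < rC.1)%R ->
      leb (exits Omega z `&` near_point p rC.1) <= (rC.2 * eucl_norm z)%:E].
  move=> p; have [cp|ncp] := pselect (closure Omega p).
    by have [r [C H]] := exits_local oO lO cp; exists (r, C).
  by exists (0, 0)%R.
have cK : compact (closure Omega).
  apply: bounded_closed_compact; last exact: closed_closure.
  have [r r0 Or] := bounded_set_eball bO.
  exists (r + 1)%R; split; first exact: num_real.
  move=> M rM p cp /=; have [x [/Or xr xp]] := cp _ (nbhs_eucl_norm p ltr01).
  have pr : (eucl_norm p <= r + 1)%R.
    have := eucl_normD x (- (x - p)); rewrite opprB addrC subrK eucl_normBC.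
    by move: xr xp; rewrite /eball/=; lra.
  apply: le_trans (ltW rM); rewrite [leLHS]mx_normrE.
  apply: bigmax_le => [|[i j] _ /=]; first by rewrite addr_ge0// ltW.
  by rewrite ord1; apply: le_trans pr; exact: coord_le_eucl_norm.
move: cK; rewrite compact_cover => /(_ E (closure Omega)
  (fun p => interior (near_point p (rC p).1))).
case=> [p _|p cp|D Dc cD]; first exact: open_interior.
  exists p => //; have [rC0 _ _] := rCP _ cp.
  by apply: nbhs_eucl_norm.
(* The estimate is transferred to finite unions by induction on the list of
   centres. *)
pose U (s : seq E) : set E :=
  [set x | has (fun p => (eucl_norm (x - p) < (rC p).1)%R) s].
have [dlt [C [dlt0 C0 dC]]] : exists dlt C : R, [/\ (0 < dlt)%R, (0 <= C)%R &
    forall z, (eucl_norm z < dlt)%R ->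
      leb (exits Omega z `&` U (finmap.enum_fset D)) <= (C * eucl_norm z)%:E].
  have : forall p, p \in finmap.enum_fset D -> closure Omega p.
    by move=> p /Dc; rewrite inE.
  elim: (finmap.enum_fset D) => [_|p s IH sD].
    exists 1%R, 0%R; split => // z _; rewrite (_ : _ `&` _ = set0).
      by rewrite measure0 mul0r.
    by rewrite -subset0 => x [].
  have [|d1 [C1 [d10 C10 H1]]] := IH.
    by move=> q qs; apply: sD; rewrite inE qs orbT.
  have [|d20 C20 H2] := rCP p; first by apply: sD; rewrite inE eqxx.
  exists (Num.min d1 (rC p).1), (C1 + (rC p).2)%R; split.
  - by rewrite lt_min d10.
  - exact: addr_ge0.
  - move=> z; rewrite lt_min => /andP[z1 z2].
    have mU t : measurable (U t).
      elim: t => [|q t mt].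
        by rewrite (_ : U [::] = set0)// -subset0 => x.
      rewrite (_ : U (q :: t) = near_point q (rC q).1 `|` U t).
        by apply: measurableU => //; exact: measurable_near_point.
      by apply/seteqP; split => x /= => [/orP|H]; [|apply/orP].
    have -> : exits Omega z `&` U (p :: s) =
        (exits Omega z `&` U s) `|` (exits Omega z `&` near_point p (rC p).1).
      rewrite -setIUr; congr (_ `&` _).
      by apply/seteqP; split => x /= => [/orP[]|[]]; [right|left|
        move=> H; apply/orP; right|move=> H; apply/orP; left].
    apply: (le_trans (measureU2 _ _ _)) => /=.
    - by apply: measurableI => //; exact: measurable_exits.
    - apply: measurableI; [exact: measurable_exits|exact: measurable_near_point].
    rewrite mulrDl EFinD; apply: leeD; [exact: H1|exact: H2].
have UO : Omega `<=` U (finmap.enum_fset D).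
  move=> x /subset_closure/cD[p /= pD /interior_subset xp].
  by apply/hasP; exists p.
have Ofin := bounded_set_fin_measure mO bO.
pose W := fine (leb Omega).
have WE : leb Omega = W%:E by rewrite fineK// ge0_fin_numE.
have W0 : (0 <= W)%R by rewrite fine_ge0.
exists (C + W / dlt)%R; first by rewrite addr_ge0// divr_ge0// ltW.
move=> z; have [zd|zd] := ltP (eucl_norm z) dlt.
  have -> : exits Omega z = exits Omega z `&` U (finmap.enum_fset D).
    by rewrite setIidl// => x [/UO].
  apply: (le_trans (dC _ zd)); rewrite lee_fin ler_wpM2r ?eucl_norm_ge0//.
  by rewrite lerDl divr_ge0// ltW.
apply: (@le_trans _ _ W%:E).
  rewrite -WE; apply: le_measure; rewrite ?inE//; first exact: measurable_exits.
  by move=> x [].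
rewrite lee_fin mulrDl mulrAC -[leLHS]add0r lerD ?mulr_ge0 ?eucl_norm_ge0//.
by rewrite ler_pdivlMr// ler_wpM2l.
Qed.

End exit_bound.

(** * Splitting the energy *)

Section energy_splitting.
Context {R : realType} {n : nat}.
Local Notation E := 'rV[R]_n.
Local Notation leb := (@lebesgue_rV R n).
Local Notation d := (n%:R : R).
Local Open Scope ereal_scope.

Definition interaction (s : R) (u : E -> R) (p : E * E) : \bar R :=
  ((u p.1 - u p.2) ^+ 2 * riesz (d + 2 * s) (p.1 - p.2)%R)%:E.

Lemma interaction_ge0 s u p : 0 <= interaction s u p.
Proof. by rewrite lee_fin mulr_ge0 ?sqr_ge0 ?riesz_ge0. Qed.

Lemma interactionC s u x y : interaction s u (x, y) = interaction s u (y, x).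
Proof.
rewrite /interaction/= /riesz eucl_normBC; congr (_ * _)%:E.
by rewrite -[LHS]sqrrN opprB.
Qed.

Lemma measurable_interaction s u : measurable_fun setT u ->
  measurable_fun setT (interaction s u).
Proof.
move=> mu; apply/measurable_EFinP; apply: measurable_funM; last first.
  apply: (measurableT_comp (measurable_riesz _)); exact: measurable_rV_sub.
apply: measurable_funX; apply: measurable_funB.
  by apply: (measurableT_comp mu); exact: measurable_fst.
by apply: (measurableT_comp mu); exact: measurable_snd.
Qed.

Lemma seminorm2E (Omega : set E) s u :
  seminorm2 Omega s u = \int[leb \x leb]_(p in Qset Omega) interaction s u p.
Proof.
apply: eq_integral => p _; rewrite /interaction real_normK ?num_real//.
Qed.

Lemma tonelli_interaction A B s u : measurable A -> measurable B ->
  measurable_fun setT u ->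
  \int[leb \x leb]_(p in A `*` B) interaction s u p =
    \int[leb]_(x in A) \int[leb]_(y in B) interaction s u (x, y) /\
  \int[leb \x leb]_(p in A `*` B) interaction s u p =
    \int[leb]_(x in B) \int[leb]_(y in A) interaction s u (x, y).
Proof.
move=> mA mB mu; have mi := measurable_interaction s mu.
have i0 := interaction_ge0 s u.
split; first exact: (@tonelli_setX1 _ _ _ _ R leb leb A B _ mA mB mi i0).
rewrite (@tonelli_setX2 _ _ _ _ R leb leb A B _ mA mB mi i0).
by apply: eq_integral => y _; apply: eq_integral => x _; rewrite interactionC.
Qed.

Lemma measurable_Qset (Omega : set E) : measurable Omega ->
  measurable (Qset Omega).
Proof.
by move=> mO; apply: measurableC; apply: measurableX; exact: measurableC.
Qed.

(** Discards all pairs except Omega x far and far x Omega. *)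
Lemma seminorm2_ge (Omega : set E) rho s u : measurable Omega ->
  Omega `<=` eball n rho -> measurable_fun setT u ->
  2%:E * (\int[leb]_(x in Omega) \int[leb]_(y in outside rho)
    interaction s u (x, y)) <= seminorm2 Omega s u.
Proof.
move=> mO Or mu; rewrite seminorm2E.
have mo := @measurable_outside R n rho.
have disj x : Omega x -> ~ outside rho x.
  by move=> /Or; rewrite /eball /outside/= ltNge => /negP.
have [e1 _] := tonelli_interaction s mO mo mu.
have [_ e2] := tonelli_interaction s mo mO mu.
apply: (@le_trans _ _ (\int[leb \x leb]_(p in
    Omega `*` outside rho `|` outside rho `*` Omega) interaction s u p)).
  rewrite ge0_integral_setU//.
  - by rewrite e1 e2 (_ : 2%:E = 1 + 1) ?ge0_muleDl// ?mul1e// -EFinD.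
  - exact: measurableX.
  - exact: measurableX.
  - by apply: measurable_funTS; exact: measurable_interaction.
  - by move=> p _; exact: interaction_ge0.
  - apply/disj_setPS => -[x y] [/= [Ox _] [ox _]]; exact: disj ox.
apply: ge0_subset_integral.
- by apply: measurableU; exact: measurableX.
- exact: measurable_Qset.
- by apply: measurable_funTS; exact: measurable_interaction.
- by move=> p _; exact: interaction_ge0.
- by move=> [x y] [[/= Ox _]|[/= _ Oy]] [].
Qed.

(** Q_Omega is the union of Omega x everything and of its mirror image. *)
Lemma seminorm2_le (Omega : set E) s u : measurable Omega ->
  measurable_fun setT u ->
  seminorm2 Omega s u <=
  2%:E * (\int[leb]_(x in Omega) \int[leb]_y interaction s u (x, y)).
Proof.
move=> mO mu; rewrite seminorm2E.
have mC : measurable (~` Omega) by exact: measurableC.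
have [e1 _] := tonelli_interaction s mO (@measurableT _ E) mu.
have [_ e2] := tonelli_interaction s (@measurableT _ E) mO mu.
have -> : Qset Omega = Omega `*` setT `|` ~` Omega `*` Omega.
  apply/seteqP; split => -[x y] /=; rewrite /Qset/=.
    move=> H; have [Ox|nOx] := pselect (Omega x); [by left|right; split => //].
    by apply: contrapT => nOy; apply: H.
  by case=> [[Ox _] []|[_ Oy] []].
rewrite ge0_integral_setU//.
- have -> : 2%:E = 1 + 1 :> \bar R by rewrite -EFinD.
  rewrite ge0_muleDl// mul1e -e1; apply: leeD => //; rewrite e1 -e2.
  apply: ge0_subset_integral => //.
  - exact: measurableX.
  - exact: measurableX.
  - by apply: measurable_funTS; exact: measurable_interaction.
  - by move=> p _; exact: interaction_ge0.
  - by move=> [x y] [].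
- exact: measurableX.
- exact: measurableX.
- by apply: measurable_funTS; exact: measurable_interaction.
- by move=> p _; exact: interaction_ge0.
- by apply/disj_setPS => -[x y] [/= [Ox _] []].
Qed.

(* The data v is only measurable and essentially bounded outside Omega; v' is
   a bounded measurable function on the whole space that agrees with it almost
   everywhere there. *)
Variables (Omega : set E) (v v' : E -> R).
Hypothesis mO : measurable Omega.
Hypothesis mv' : measurable_fun setT v'.
Hypothesis vv' : {ae leb, forall x, ~ Omega x -> v x = v' x}.

Lemma interaction_ae (w : E -> R) s x D : Omega x -> measurable D ->
  measurable_fun setT (patch v Omega w) ->
  measurable_fun setT (patch v' Omega w) ->
  \int[leb]_(y in D) interaction s (patch v Omega w) (x, y) =
  \int[leb]_(y in D) interaction s (patch v' Omega w) (x, y).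
Proof.
move=> Ox mD mw mw'; apply: ae_eq_integral => //.
- apply: measurable_funTS.
  exact: (measurableT_comp (measurable_interaction s mw) (measurable_pair1 x)).
- apply: measurable_funTS.
  exact: (measurableT_comp (measurable_interaction s mw') (measurable_pair1 x)).
- apply: filterS vv' => y vy _; rewrite /interaction/=.
  congr ((_ - _) ^+ 2 * _)%:E.
    by rewrite /patch mem_set.
  rewrite /patch; case: ifPn => // /negP yO; apply: vy => Oy.
  by apply: yO; exact/mem_set.
Qed.

Lemma measurable_patch (w : E -> R) : measurable_fun Omega w ->
  measurable_fun setT (patch v' Omega w).
Proof.
move=> mw.
have -> : setT = Omega `|` ~` Omega by rewrite setUv.
apply/measurable_funU => //; first exact: measurableC.
split.
- apply: eq_measurable_fun mw => x; rewrite inE => Ox.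
  by rewrite /patch mem_set.
- apply: (eq_measurable_fun v'); last exact: measurable_funTS.
  by move=> x; rewrite inE => nOx; rewrite /patch memNset.
Qed.

Lemma interaction_far (w : E -> R) s x rho : Omega `<=` eball n rho ->
  Omega x ->
  \int[leb]_(y in outside rho) interaction s (patch v' Omega w) (x, y) =
  \int[leb]_(y in outside rho)
    ((w x - v' y) ^+ 2 * riesz (d + 2 * s) (x - y))%:E.
Proof.
move=> Or Ox; apply: eq_integral => y; rewrite inE => oy.
rewrite /interaction/= /patch mem_set// memNset// => /Or.
by move: oy; rewrite /outside /eball/= ltNge => ->.
Qed.

Lemma F_on_ge (w : E -> R) s rho : (0 < s)%R -> Omega `<=` eball n rho ->
  measurable_fun Omega w ->
  \int[leb]_(x in Omega) (s%:E * \int[leb]_(y in outside rho)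
    ((w x - v' y) ^+ 2 * riesz (d + 2 * s) (x - y))%:E) <= F_on Omega v s w.
Proof.
move=> s0 Or mw; rewrite /F_on /F_; case: asboolP => [[[mu _] _]|_]; last first.
  exact: leey.
have mw' := measurable_patch mw.
have mo := @measurable_outside R n rho.
have mi := measurable_interaction s mw'.
have s20 : 0 <= (s / 2)%:E by rewrite lee_fin divr_ge0// ltW.
apply: le_trans (lee_wpmul2l s20 (seminorm2_ge s mO Or mu)).
rewrite muleA -EFinM divfK//.
rewrite -ge0_integralZl_EFin; [|exact: mO| | |exact: ltW]; last 2 first.
- by move=> x _; apply: integral_ge0 => y _; exact: interaction_ge0.
- apply: measurable_funTS.
  exact: (measurable_tonelli_inner leb mo (measurable_interaction s mu)
    (interaction_ge0 s _)).
rewrite le_eqVlt; apply/orP; left; apply/eqP.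
apply: eq_integral => x; rewrite inE => Ox; congr (_ * _).
by rewrite -interaction_far// interaction_ae.
Qed.

Lemma F_on_le (w : E -> R) s rho : (0 < s)%R -> Omega `<=` eball n rho ->
  L2loc_Q Omega v (patch v Omega w) -> measurable_fun Omega w ->
  F_on Omega v s w <=
  \int[leb]_(x in Omega) (s%:E * \int[leb]_(y in outside rho)
    ((w x - v' y) ^+ 2 * riesz (d + 2 * s) (x - y))%:E) +
  s%:E * \int[leb]_(x in Omega) \int[leb]_(y in eball n rho)
    interaction s (patch v' Omega w) (x, y).
Proof.
move=> s0 Or Lw mw; rewrite /F_on /F_ asboolT//; have [[mu _] _] := Lw.
have mw' := measurable_patch mw.
have mo := @measurable_outside R n rho.
have mb := @measurable_eball R n rho.
have mi := measurable_interaction s mw'.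
have i0 := interaction_ge0 s (patch v' Omega w).
have s20 : 0 <= (s / 2)%:E by rewrite lee_fin divr_ge0// ltW.
apply: (le_trans (lee_wpmul2l s20 (seminorm2_le s mO mu))).
rewrite muleA -EFinM divfK//.
have m1 : measurable_fun Omega
    (fun x => \int[leb]_(y in outside rho) interaction s (patch v' Omega w) (x, y)).
  by apply: measurable_funTS; exact: (measurable_tonelli_inner leb mo mi i0).
have m2 : measurable_fun Omega
    (fun x => \int[leb]_(y in eball n rho) interaction s (patch v' Omega w) (x, y)).
  by apply: measurable_funTS; exact: (measurable_tonelli_inner leb mb mi i0).
have -> : \int[leb]_(x in Omega) \int[leb]_y
      interaction s (patch v Omega w) (x, y) =
    \int[leb]_(x in Omega) (\int[leb]_(y in outside rho)
       interaction s (patch v' Omega w) (x, y) +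
     \int[leb]_(y in eball n rho) interaction s (patch v' Omega w) (x, y)).
  apply: eq_integral => x; rewrite inE => Ox.
  rewrite (interaction_ae s Ox measurableT mu mw') -ge0_integral_setU.
  - congr (integral _ _ _); apply/seteqP; split => // y _.
    by rewrite /outside /eball/=; case: (leP rho (eucl_norm y)); [left|right].
  - exact: mo.
  - exact: mb.
  - apply: measurable_funTS; exact: (measurableT_comp mi (measurable_pair1 x)).
  - by move=> y _; exact: i0.
  - by apply/disj_setPS => y [] /=; rewrite /outside /eball/= leNgt => /negP.
rewrite (ge0_integralD leb mO _ m1 _ m2); last 2 first.
- by move=> x _; exact: integral_ge0.
- by move=> x _; exact: integral_ge0.
rewrite ge0_muleDr; last 2 first.
- by apply: integral_ge0 => x _; exact: integral_ge0.
- by apply: integral_ge0 => x _; exact: integral_ge0.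
apply: leeD; last exact: lexx.
rewrite -ge0_integralZl_EFin; [|exact: mO| |exact: m1|exact: ltW]; last first.
  by move=> x _; exact: integral_ge0.
rewrite le_eqVlt; apply/orP; left; apply/eqP.
by apply: eq_integral => x; rewrite inE => Ox; rewrite interaction_far.
Qed.

End energy_splitting.

(** * Density of functions that change little under translations *)

Section density.
Context {R : realType} {n : nat}.
Local Notation E := 'rV[R]_n.
Local Notation leb := (@lebesgue_rV R n).
Local Open Scope ereal_scope.
Variables (Omega : set E) (r : R).
Hypotheses (mO : measurable Omega) (Or : Omega `<=` eball n r).

(** Approximations of u by such functions make up the recovery sequences. *)
Definition tame (w : E -> R) := [/\ measurable_fun setT w,
  exists M : R, forall x, (`|w x| <= M)%R & translation_stable Omega w].

Lemma measurable_jump (w : E -> R) z : measurable_fun setT w ->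
  measurable [set x | Omega x /\ w x <> w (x + z)%R].
Proof.
move=> mw.
have mz : measurable [set x : E | w x <> w (x + z)%R].
  apply: measurable_neq => //; apply: (measurableT_comp mw).
  exact: measurable_translation.
exact: measurableI.
Qed.

(** Where f (w1, w2) changes, w1 or w2 changes. *)
Lemma tame_comb (f : R -> R -> R) (w1 w2 : E -> R) :
  measurable_fun setT (fun x => f (w1 x) (w2 x)) ->
  (exists M : R, forall x, (`|f (w1 x) (w2 x)| <= M)%R) ->
  tame w1 -> tame w2 -> tame (fun x => f (w1 x) (w2 x)).
Proof.
move=> mf bf [m1 _ [C1 C10 t1]] [m2 _ [C2 C20 t2]]; split => //.
exists (C1 + C2)%R; first exact: addr_ge0.
move=> z; rewrite mulrDl EFinD; apply: le_trans (leeD (t1 z) (t2 z)).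
apply: le_trans (measureU2 leb (measurable_jump z m1) (measurable_jump z m2)).
apply: le_measure; rewrite ?inE.
- exact: (measurable_jump z mf).
- by apply: measurableU; exact: measurable_jump.
- move=> x [Ox H]; have [e1|ne1] := pselect (w1 x = w1 (x + z)%R).
    by right; split => // e2; apply: H; rewrite e1 e2.
  by left.
Qed.

Lemma tame_cst (c : R) : tame (cst c).
Proof.
split => //; first by exists `|c|%R.
exists 0%R => // z; rewrite mul0r (_ : [set _ | _] = set0) ?measure0//.
by rewrite -subset0 => x [].
Qed.

(** The indicator can only change between x and x + z if the coordinate x_i is
    within |z_i| of a, which confines x to a thin slab of a cube. *)
Lemma tame_halfspace (i : 'I_n) (a : R) : tame (fun x => (a < x ord0 i)%R%:R).
Proof.
have mh : measurable_fun setT (fun x : E => (a < x ord0 i)%R%:R : R).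
  rewrite (_ : (fun x => _) = \1_[set x : E | (a < x ord0 i)%R]); last first.
    apply/funext => x; rewrite indicE; congr (nat_of_bool _)%:R.
    by apply/idP/idP => [?|/set_mem]; [exact/mem_set|].
  apply: measurable_indic; apply: measurable_ltr => //; exact: measurable_coor.
split => //.
  by exists 1%R => x; case: (a < _)%R; rewrite ?normr0 ?normr1.
pose m (j : 'I_n) : \bar R := lebesgue_measure (`[- r, r]%classic%R : set R).
pose c := fine (\prod_(j < n | j != i) m j).
have mfin : \prod_(j < n | j != i) m j \is a fin_num.
  apply: (big_ind (fun x => x \is a fin_num)) => //; first exact: fin_numM.
  by move=> j _; rewrite /m lebesgue_measure_itv/=; case: ifP.
have cE : \prod_(j < n | j != i) m j = c%:E by rewrite fineK.
have c0 : (0 <= c)%R.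
  by rewrite fine_ge0//; apply: prode_ge0 => j _; exact: measure_ge0.
exists (2 * c)%R; first exact: mulr_ge0.
move=> z; set b := `|z ord0 i|%R.
pose B (j : 'I_n) : set R :=
  if j == i then `[a - b, a + b]%classic%R else `[- r, r]%classic%R.
have mB j : measurable (B j) by rewrite /B; case: ifP.
apply: (@le_trans _ _ (leb (box B))).
  apply: le_measure; rewrite ?inE.
  - exact: (measurable_jump z mh).
  - exact: measurable_box.
  - move=> x [/Or xr xz] j; rewrite /B; case: eqP => [->|_] /=.
      rewrite in_itv/=; move: xz; rewrite mxE.
      have := ler_norm (z ord0 i); have := ler_norm (- z ord0 i).
      rewrite normrN -/b => h1 h2.
      by case: (ltP a (x ord0 i)) => h3; case: (ltP a) => h4 H //;
        apply/andP; split; lra.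
    rewrite in_itv/= -ler_norml; apply: le_trans (ltW xr).
    exact: coord_le_eucl_norm.
rewrite lebesgue_box// (bigD1 i)//= {1}/B eqxx.
have -> : \prod_(j < n | j != i) lebesgue_measure (B j) = c%:E.
  by rewrite -cE; apply: eq_bigr => j /negPf ji; rewrite /B ji.
have b0 : (0 <= b)%R by exact: normr_ge0.
apply: (@le_trans _ _ ((2 * b)%:E * c%:E)).
  apply: lee_wpmul2r; first by rewrite lee_fin.
  rewrite lebesgue_measure_itv/=; case: ifP => _.
    by rewrite -EFinB lee_fin; lra.
  by rewrite lee_fin mulr_ge0.
rewrite -EFinM lee_fin mulrAC ler_wpM2l ?mulr_ge0//.
exact: coord_le_eucl_norm.
Qed.

Definition approximable (u : E -> R) := measurable_fun Omega u /\
  forall e : R, (0 < e)%R -> exists2 w, tame w &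
    \int[leb]_(x in Omega) ((u x - w x) ^+ 2)%:E <= e%:E.

Lemma measurable_sqr_dist (u w : E -> R) : measurable_fun Omega u ->
  measurable_fun Omega w ->
  measurable_fun Omega (fun x => ((u x - w x) ^+ 2)%:E).
Proof.
move=> mu mw; apply/measurable_EFinP; apply: measurable_funX.
exact: measurable_funB.
Qed.

(** The L^2 triangle inequality in squared form, for pointwise domination. *)
Lemma sqr_dist_combine (f g h : E -> R) (a b : R) :
  measurable_fun Omega f -> measurable_fun Omega g -> measurable_fun Omega h ->
  (forall x, Omega x -> (h x ^+ 2 <= 2 * (f x ^+ 2 + g x ^+ 2))%R) ->
  \int[leb]_(x in Omega) (f x ^+ 2)%:E <= a%:E ->
  \int[leb]_(x in Omega) (g x ^+ 2)%:E <= b%:E ->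
  \int[leb]_(x in Omega) (h x ^+ 2)%:E <= (2 * (a + b))%:E.
Proof.
move=> mf mg mh fgh fa gb.
have m2 (k : E -> R) : measurable_fun Omega k ->
    measurable_fun Omega (fun x => (k x ^+ 2)%:E).
  by move=> mk; apply/measurable_EFinP; exact: measurable_funX.
have k0 (k : E -> R) x : 0 <= (k x ^+ 2)%:E by rewrite lee_fin sqr_ge0.
rewrite EFinM (EFinD a b).
apply: (@le_trans _ _ (2%:E * (\int[leb]_(x in Omega) (f x ^+ 2)%:E +
   \int[leb]_(x in Omega) (g x ^+ 2)%:E))); last first.
  by apply: lee_wpmul2l => //; exact: leeD.
rewrite -ge0_integralD//; [|exact: m2|exact: m2].
rewrite -ge0_integralZl_EFin//; last 2 first.
- by move=> x _; exact: adde_ge0.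
- by apply: emeasurable_funD; exact: m2.
apply: ge0_le_integral => //; first exact: m2.
- apply: emeasurable_funM => //; apply: emeasurable_funD; exact: m2.
Qed.

Lemma approximable_lim (u : E -> R) : measurable_fun Omega u ->
  (forall e : R, (0 < e)%R -> exists2 w, approximable w &
    \int[leb]_(x in Omega) ((u x - w x) ^+ 2)%:E <= e%:E) ->
  approximable u.
Proof.
move=> mu H; split => // e e0; have e4 : (0 < e / 4)%R by exact: divr_gt0.
have [f [mf Hf] uf] := H _ e4; have [w gw fw] := Hf _ e4.
exists w => //; have [mw _ _] := gw.
have mw' : measurable_fun Omega w := measurable_funTS mw.
have -> : e = (2 * (e / 4 + e / 4))%R by field.
apply: (sqr_dist_combine _ _ _ _ uf fw); try exact: measurable_funB.
by move=> x _; have := sqr_ge0 ((u x - f x) - (f x - w x)); lra.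
Qed.

(** Transfers pointwise operations with Lipschitz constant sqrt 2 from tame
    functions to their L^2 limits. *)
Lemma approximable_comb (f : R -> R -> R) (u1 u2 : E -> R) :
  (forall D (g1 g2 : E -> R), measurable_fun D g1 -> measurable_fun D g2 ->
    measurable_fun D (fun x => f (g1 x) (g2 x))) ->
  (forall w1 w2 : E -> R,
    (exists M : R, forall x, `|w1 x| <= M)%R ->
    (exists M : R, forall x, `|w2 x| <= M)%R ->
    exists M : R, forall x, `|f (w1 x) (w2 x)| <= M)%R ->
  (forall a b c e, (f a b - f c e) ^+ 2 <= 2 * ((a - c) ^+ 2 + (b - e) ^+ 2))%R ->
  approximable u1 -> approximable u2 ->
  approximable (fun x => f (u1 x) (u2 x)).
Proof.
move=> mff bf lf [m1 a1] [m2 a2].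
split; first exact: mff.
move=> e e0; have e4 : (0 < e / 4)%R by exact: divr_gt0.
have [w1 g1 uw1] := a1 _ e4; have [w2 g2 uw2] := a2 _ e4.
have [mw1 bw1 _] := g1; have [mw2 bw2 _] := g2.
exists (fun x => f (w1 x) (w2 x)).
  by apply: tame_comb => //; [exact: mff|exact: bf].
have -> : e = (2 * (e / 4 + e / 4))%R by field.
have mw1' : measurable_fun Omega w1 := measurable_funTS mw1.
have mw2' : measurable_fun Omega w2 := measurable_funTS mw2.
apply: (sqr_dist_combine _ _ _ _ uw1 uw2); try exact: measurable_funB.
  by apply: measurable_funB; exact: mff.
by move=> x _; exact: lf.
Qed.

Lemma approximable_max (u1 u2 : E -> R) : approximable u1 -> approximable u2 ->
  approximable (fun x => Num.max (u1 x) (u2 x)).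
Proof.
apply: approximable_comb.
- by move=> D g1 g2; exact: measurable_maxr.
- move=> w1 w2 [M1 b1] [M2 b2]; exists (Num.max M1 M2) => x.
  by rewrite /Num.max; case: ltP => _; rewrite le_max ?b1 ?b2 ?orbT.
- move=> a b c e.
  have := sqr_ge0 (a - c); have := sqr_ge0 (b - e).
  case: (leP a b) => ab; case: (leP c e) => ce; try nra.
    by case: (leP b c) => bc; nra.
  by case: (leP a e) => ae; nra.
Qed.

Lemma approximable_add (u1 u2 : E -> R) : approximable u1 -> approximable u2 ->
  approximable (fun x => u1 x + u2 x)%R.
Proof.
apply: (approximable_comb (f := fun a b => (a + b)%R)).
- by move=> D g1 g2; exact: measurable_funD.
- move=> w1 w2 [M1 b1] [M2 b2]; exists (M1 + M2)%R => x.
  by apply: (le_trans (ler_normD _ _)); rewrite lerD.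
- by move=> a b c e; have := sqr_ge0 ((a - c) - (b - e)); lra.
Qed.

Lemma approximable_tame u : tame u -> approximable u.
Proof.
move=> gu; have [mu _ _] := gu; split; first exact: measurable_funTS.
move=> e e0; exists u => //.
by under eq_integral do rewrite subrr expr0n/=; rewrite integral0 lee_fin ltW.
Qed.

Lemma approximable_scale (k : R) (u : E -> R) : approximable u ->
  approximable (fun x => k * u x)%R.
Proof.
move=> [mu au]; split; first exact: measurable_funM.
move=> e e0; have ek : (0 < e / (k ^+ 2 + 1))%R.
  by rewrite divr_gt0// ltr_wpDl// sqr_ge0.
have [w gw uw] := au _ ek; have [mw [M bw] _] := gw.
exists (fun x => k * w x)%R.
  apply: (tame_comb (f := fun a _ => (k * a)%R) _ _ gw gw).
    exact: measurable_funM.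
  by exists (`|k| * M)%R => x; rewrite normrM ler_wpM2l.
under eq_integral do rewrite -mulrBr exprMn EFinM.
rewrite ge0_integralZl_EFin ?sqr_ge0//; last 2 first.
- by move=> x _; rewrite lee_fin sqr_ge0.
- by apply: measurable_sqr_dist => //; exact: measurable_funTS.
apply: (le_trans (lee_wpmul2l _ uw)); first by rewrite lee_fin sqr_ge0.
rewrite -EFinM lee_fin mulrCA ler_piMr ?(ltW e0)// ler_pdivrMr ?mul1r ?lerDl//.
by rewrite ltr_wpDl// sqr_ge0.
Qed.

End density.

Section density_L2.
Context {R : realType} {n : nat}.
Local Notation E := 'rV[R]_n.
Local Notation leb := (@lebesgue_rV R n).
Local Open Scope ereal_scope.
Variables (Omega : set E) (r : R).
Hypotheses (mO : measurable Omega) (Or : Omega `<=` eball n r).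

Lemma approximable_dominated (u : E -> R) (u_ : nat -> E -> R) (g : E -> R) :
  measurable_fun Omega u -> (forall k, approximable Omega (u_ k)) ->
  (forall x, Omega x -> u_ ^~ x @ \oo --> u x) ->
  (forall k x, Omega x -> ((u x - u_ k x) ^+ 2 <= g x)%R) ->
  leb.-integrable Omega (EFin \o g) -> approximable Omega u.
Proof.
move=> mu au cu ug ig; apply: approximable_lim => // e e0.
have : \int[leb]_(x in Omega) ((u x - u_ k x) ^+ 2)%:E @[k --> \oo] -->
    \int[leb]_(x in Omega) (cst 0 x).
  apply: (dominated_cvg mO _ _ _ ig) => //.
  - by move=> k; apply: measurable_sqr_dist => //; have [] := au k.
  - move=> x Ox; rewrite /cst -[0]/(0%R%:E); apply: cvg_EFin.
      exact: nearW.
    rewrite -[X in _ --> X](expr0n _ 2) -(subrr (u x)).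
    apply: (@cvg_comp _ _ _ (fun k => u x - u_ k x)%R (fun t : R => t ^+ 2)%R
      _ (nbhs (u x - u x)%R)).
      by apply: cvgB; [exact: cvg_cst|exact: cu].
    exact: exprn_continuous.
  - by move=> k x Ox; rewrite abse_EFin lee_fin ger0_norm ?sqr_ge0// ug.
rewrite integral0 => /fine_cvgP[fink /cvgrPdist_le/(_ _ e0) cvgk].
have [k [finK cK]] : exists k, \int[leb]_(x in Omega)
   ((u x - u_ k x) ^+ 2)%:E \is a fin_num /\
   (`|0 - fine (\int[leb]_(x in Omega) ((u x - u_ k x) ^+ 2)%:E)| <= e)%R.
  near \oo => k; exists k; split; near: k => //.
exists (u_ k) => //; rewrite -(fineK finK) lee_fin.
by apply: le_trans cK; rewrite sub0r normrN ler_norm.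
Unshelve. all: by end_near. Qed.

Lemma integrable_cst_bounded (c : R) : leb.-integrable Omega (EFin \o cst c).
Proof.
apply/integrableP; split; first exact/measurable_EFinP.
rewrite [ltLHS](_ : _ = `|c|%:E * leb Omega); last by rewrite -integral_cst.
rewrite lte_mul_pinfty//.
have : leb Omega <= leb (eball n r).
  by apply: le_measure; rewrite ?inE//; exact: measurable_eball.
by move=> /le_lt_trans; apply; exact: lebesgue_eball.
Qed.

(** Such sets form a sigma-algebra: the complement is handled by 1 - w, finite
    unions by maxima, countable unions by dominated convergence. It contains
    the coordinate half-spaces, which generate. *)
Lemma approximable_indic (A : set E) : measurable A ->
  approximable Omega (\1_A : E -> R).
Proof.
pose P := [set A : set E | measurable A /\ approximable Omega (\1_A : E -> R)].
have sP : sigma_algebra setT P.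
  split.
    - split => //; rewrite indic0; apply: approximable_tame => //.
      exact: tame_cst.
    - move=> D [mD aD]; split; first exact: measurableD.
      rewrite (_ : \1_(_) = fun x => (1 + -1 * \1_D x)%R); last first.
        apply/funext => x; rewrite setTD indicC indicE.
        by case: (x \in D) => /=; lra.
      apply: (approximable_add mO (u1 := cst 1%R)
        (u2 := fun x => (-1 * \1_D x)%R)); last exact: approximable_scale.
      by apply: approximable_tame => //; exact: tame_cst.
    - move=> F PF; split; first by apply: bigcupT_measurable => k; have [] := PF k.
      pose B N := \big[setU/set0]_(k < N) F k.
      have aB N : approximable Omega (\1_(B N) : E -> R).
        rewrite /B; elim: N => [|N IH].
          rewrite big_ord0 indic0; apply: approximable_tame => //.
          exact: tame_cst.
        rewrite big_ord_recr/= (_ : \1_(_) = fun x =>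
          Num.max (\1_(\big[setU/set0]_(k < N) F k) x) (\1_(F N) x)).
          by apply: approximable_max => //; have [] := PF N.
        apply/funext => x; rewrite !indicE in_setU.
        by case: (x \in _) => /=; case: (x \in _);
          rewrite /Num.max ?ltxx ?ltr01 ?ltr10.
      have mU : measurable (\bigcup_k F k).
        by apply: bigcupT_measurable => k; have [] := PF k.
      apply: (@approximable_dominated _ (fun N => \1_(B N)) (cst 1%R)).
      + by apply: measurable_funTS; exact: measurable_indic.
      + exact: aB.
      + move=> x _; have [[k _ Fkx]|nUx] := pselect ((\bigcup_k F k) x).
          apply: cvg_near_cst; near=> N.
          have BNx : B N x.
            rewrite /B -bigcup_mkord; exists k => //=.
            by near: N; exact: nbhs_infty_gt.
          have Ux : (\bigcup_k F k) x by exists k.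
          by rewrite !indicE !mem_set.
        apply: cvg_near_cst; apply: nearW => N.
        rewrite !indicE !memNset// => H; apply: nUx.
        by move: H; rewrite /B -bigcup_mkord => -[k _ Fk]; exists k.
      + move=> k x _; rewrite !indicE.
        by case: (x \in _); case: (x \in _);
          rewrite /cst/= ?subrr ?subr0 ?sub0r ?sqrrN ?expr1n ?expr0n/= ?ler01.
      + exact: integrable_cst_bounded.
move=> mA; suff [] : P A by [].
move: A mA; apply: (measurable_rV_ind sP).
move=> i; pose Q := [set B : set R | P [set x | B (x ord0 i)]].
suff mQ : measurable `<=` Q by move=> B /mQ.
rewrite [X in X `<=` _]RGenOInfty.measurableE; apply: smallest_sub.
  have [P0 PD PU] := sP; split.
  - exact: P0.
  - by move=> B; exact: PD.
  - by move=> F QF; rewrite /Q/= -[X in P X]/(_ @^-1` _) preimage_bigcup; exact: PU.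
move=> _ [a ->]; split.
  by apply: (measurable_preimageT (measurable_coor i)).
rewrite (_ : \1_(_) = fun x : E => (a < x ord0 i)%R%:R).
  by apply: approximable_tame => //; exact: tame_halfspace Or _ _.
apply/funext => x; rewrite indicE; congr (nat_of_bool _)%:R.
by apply/idP/idP => [/set_mem|H]; [|apply/mem_set];
  rewrite /= in_itv/= andbT.
Unshelve. all: by end_near. Qed.

Import HBNNSimple.

Lemma approximable_simple (f : {nnsfun E >-> R}) : approximable Omega f.
Proof.
have -> : (f : E -> R) = fun x => (\sum_(y <- finmap.enum_fset (fset_set (range f)))
    y * \1_(f @^-1` [set y]) x)%R.
  by apply/funext => x; rewrite fimfunE fsbig_finite.
elim: (finmap.enum_fset _) => [|y s IH].
  under eq_fun do rewrite big_nil; apply: approximable_tame => //.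
  exact: tame_cst.
under eq_fun do rewrite big_cons.
apply: (approximable_add mO (u1 := fun x => (y * \1_(f @^-1` [set y]) x)%R)) => //.
apply: approximable_scale => //; apply: approximable_indic.
by apply: measurable_preimageT.
Qed.

Lemma approximable_ge0 (u : E -> R) : measurable_fun Omega u ->
  (forall x, Omega x -> 0 <= u x)%R ->
  \int[leb]_(x in Omega) (u x ^+ 2)%:E < +oo -> approximable Omega u.
Proof.
move=> mu u0 u2.
have mue : measurable_fun Omega (fun x => (u x)%:E) by exact/measurable_EFinP.
have ue0 x : Omega x -> 0 <= (u x)%:E by move=> Ox; rewrite lee_fin u0.
pose f := nnsfun_approx mO mue.
apply: (@approximable_dominated _ (fun k => f k) (fun x => u x ^+ 2)%R) => //.
- by move=> k; exact: approximable_simple.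
- move=> x Ox; have := cvg_nnsfun_approx mO mue ue0 Ox.
  by move=> /fine_cvgP[_].
- move=> k x Ox.
  have f0 : (0 <= f k x)%R by exact: fun_ge0.
  have fu : (f k x <= u x)%R.
    by rewrite -lee_fin /f nnsfun_approxE; exact: le_approx.
  by have := u0 _ Ox; nra.
- apply/integrableP; split; first by apply/measurable_EFinP; exact: measurable_funX.
  by under eq_integral do rewrite /= ger0_norm ?sqr_ge0//.
Qed.

Lemma approximable_L2 (u : E -> R) : square_integrable Omega u ->
  approximable Omega u.
Proof.
move=> [mu]; under eq_integral do rewrite real_normK ?num_real//.
move=> u2.
have split_le (f : E -> R) : measurable_fun Omega f ->
    (forall x, f x ^+ 2 <= u x ^+ 2)%R ->
    \int[leb]_(x in Omega) (f x ^+ 2)%:E < +oo.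
  move=> mf fu; apply: le_lt_trans u2; apply: ge0_le_integral => //.
  - by move=> x _; rewrite lee_fin sqr_ge0.
  - by apply/measurable_EFinP; exact: measurable_funX.
  - by apply/measurable_EFinP; exact: measurable_funX.
  - by move=> x _; rewrite lee_fin.
have mp : measurable_fun Omega (fun x => Num.max (u x) 0%R).
  exact: measurable_maxr.
have mn : measurable_fun Omega (fun x => Num.max (- u x)%R 0%R).
  by apply: measurable_maxr => //; exact: measurable_funN.
have -> : u = fun x => (Num.max (u x) 0 + -1 * Num.max (- u x) 0)%R.
  apply/funext => x; case: (leP (u x) 0%R) => ux;
    case: (leP (- u x)%R 0%R) => nux; lra.
apply: (approximable_add mO (u1 := fun x => Num.max (u x) 0%R)
    (u2 := fun x => (-1 * Num.max (- u x) 0)%R)).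
  apply: approximable_ge0 => //; first by move=> x _; rewrite le_max lexx orbT.
  apply: split_le => // x; case: (leP (u x) 0%R) => // _.
  by rewrite expr0n; exact: sqr_ge0.
apply: approximable_scale => //.
apply: approximable_ge0 => //; first by move=> x _; rewrite le_max lexx orbT.
apply: split_le => // x; case: (leP (- u x)%R 0%R) => _; rewrite ?sqrrN//.
by rewrite expr0n; exact: sqr_ge0.
Qed.

End density_L2.

(** * Sequences *)

Section sequence_lemmas.
Context {R : realType}.
Local Open Scope ereal_scope.

Lemma limn_einf_ge (f : nat -> \bar R) (l : R) :
  (forall e : R, (0 < e)%R -> \forall j \near \oo, (l - e)%:E <= f j) ->
  l%:E <= limn_einf f.
Proof.
move=> H; apply/lee_addgt0Pr => e e0.
have := H _ e0; rewrite -leeBlDr// -EFinB => He.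
rewrite limn_einf_lim; apply: lime_ge; first exact: is_cvg_einfs.
case: He => N _ NH; near=> k.
have kN : (N <= k)%N by near: k; exact: nbhs_infty_ge.
apply: le_ereal_inf_tmp => _ [i /= ki <-]; apply: NH => /=.
exact: leq_trans kN ki.
Unshelve. all: by end_near. Qed.

Lemma limn_esup_le (f : nat -> \bar R) (l : R) :
  (forall e : R, (0 < e)%R -> \forall j \near \oo, f j <= (l + e)%:E) ->
  limn_esup f <= l%:E.
Proof.
move=> H; rewrite -leeN2 -limn_einfN -EFinN; apply: limn_einf_ge => e e0.
have := H _ e0; apply: filterS => j fj /=.
by rewrite -opprD EFinN leeN2.
Qed.

(** If P k j holds for j >= N k, let kappa advance from k to k + 1 as soon as
    j has passed N (k + 1). *)
Lemma diagonal_selection (P : nat -> nat -> Prop) :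
  (forall k, \forall j \near \oo, P k j) ->
  exists2 kappa : nat -> nat, (forall k, \forall j \near \oo, (k <= kappa j)%N) &
    \forall j \near \oo, P (kappa j) j.
Proof.
move=> HP; have /choice[N NP] : forall k, exists N, forall j, (N <= j)%N -> P k j.
  by move=> k; have [N _ H] := HP k; exists N => j jN; exact: H.
(* kappa increases by at most one at each step, so it meets every k, and by
   construction j >= N (kappa j) once kappa has started. *)
pose fix kappa j := if j is i.+1 then
  (if (N (kappa i).+1 <= i.+1)%N then (kappa i).+1 else kappa i) else 0%N.
have kS i : kappa i.+1 =
  if (N (kappa i).+1 <= i.+1)%N then (kappa i).+1 else kappa i by [].
exists kappa.
- elim=> [|k [J _ IH]]; first exact: nearW.
  exists (maxn J (N k.+1)).+1 => // -[|j] //= jH.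
  move: jH; rewrite ltnS geq_max => /andP[jJ jN].
  have := IH j jJ; rewrite /= leq_eqVlt => /orP[/eqP kE|kj].
    by rewrite -kE leqW.
  by case: ifP => // _; exact: ltnW.
- have inv j : (N (kappa j) <= j)%N \/ kappa j = 0%N.
    elim: j => [|j IH]; first by right.
    rewrite kS; case: ifP => [|_]; first by left.
    by case: IH => [IH|->]; [left; exact: leqW|right].
  exists (N 0%N) => // j jN; have [/NP//|k0] := inv j.
  by rewrite k0; exact: NP.
Qed.

End sequence_lemmas.

Section L2_facts.
Context {R : realType} {n : nat}.
Local Notation E := 'rV[R]_n.
Local Notation leb := (@lebesgue_rV R n).
Variables (Omega : set E) (r : R).
Hypotheses (mO : measurable Omega) (Or : Omega `<=` eball n r).

Lemma square_integrableP (u : E -> R) : square_integrable Omega u <->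
  measurable_fun Omega u /\
  leb.-integrable Omega (fun x => (u x ^+ 2)%:E).
Proof.
have eqi : (\int[leb]_(x in Omega) (`|u x| ^+ 2)%R%:E =
    \int[leb]_(x in Omega) `|(u x ^+ 2)%:E|)%E.
  by apply: eq_integral => x _; rewrite abse_EFin normrX.
split=> [[mu u2]|[mu /integrableP[_ u2]]]; split => //.
- apply/integrableP; split; last by rewrite -eqi.
  by apply/measurable_EFinP; exact: measurable_funX.
- by rewrite eqi.
Qed.

Lemma square_integrable_mul (u w : E -> R) :
  square_integrable Omega u -> square_integrable Omega w ->
  leb.-integrable Omega (fun x => (u x * w x)%:E).
Proof.
move=> /square_integrableP[mu u2] /square_integrableP[mw w2].
apply: (le_integrable mO _ _ (integrableD mO u2 w2)).
  by apply/measurable_EFinP; exact: measurable_funM.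
move=> x _; rewrite /= lee_fin [leRHS]ger0_norm; last first.
  by rewrite addr_ge0// sqr_ge0.
have := sqr_ge0 (u x - w x); have := sqr_ge0 (u x + w x).
have := sqr_ge0 (u x); have := sqr_ge0 (w x).
by move=> *; rewrite ler_norml; apply/andP; split; nra.
Qed.

Lemma square_integrable_bounded (w : E -> R) (M : R) :
  measurable_fun Omega w -> (forall x, Omega x -> `|w x| <= M) ->
  square_integrable Omega w.
Proof.
move=> mw wM; apply/square_integrableP; split => //.
apply: (le_integrable mO _ _ (integrable_cst_bounded mO Or (M ^+ 2))).
  by apply/measurable_EFinP; exact: measurable_funX.
move=> x Ox; rewrite /= lee_fin normrX [leRHS]ger0_norm ?sqr_ge0//.
by rewrite ler_pXn2r ?nnegrE// ?(le_trans _ (wM _ Ox))// wM.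
Qed.

Lemma square_integrable_int (u : E -> R) : square_integrable Omega u ->
  leb.-integrable Omega (fun x => (u x)%:E).
Proof.
move=> su.
have s1 : square_integrable Omega (cst 1).
  by apply: (square_integrable_bounded (M := 1)) => // x _; rewrite normr1.
have := square_integrable_mul su s1.
by under eq_fun do rewrite mulr1.
Qed.

Lemma square_integrableB (u w : E -> R) :
  square_integrable Omega u -> square_integrable Omega w ->
  square_integrable Omega (fun x => u x - w x).
Proof.
move=> /square_integrableP[mu u2] /square_integrableP[mw w2].
apply/square_integrableP; split; first exact: measurable_funB.
apply: (le_integrable mO _ _ (integrableZl mO 2 (integrableD mO u2 w2))).
  by apply/measurable_EFinP; apply: measurable_funX; exact: measurable_funB.
move=> x _; rewrite /= lee_fin [leLHS]ger0_norm ?sqr_ge0//.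
apply: le_trans (ler_norm _).
by have := sqr_ge0 (u x + w x); nra.
Qed.

Lemma integral_Rintegral (f : E -> R) :
  leb.-integrable Omega (fun x => (f x)%:E) ->
  (\int[leb]_(x in Omega) (f x)%:E = (\int[leb]_(x in Omega) f x)%R%:E)%E.
Proof. by move=> i; rewrite fineK//; exact: integrable_fin_num. Qed.

(** Young's inequality, in place of Cauchy-Schwarz, to bound the pairing with
    a fixed test function. *)
Lemma Rintegral_young (u phi : E -> R) (t : R) : 0 < t ->
  square_integrable Omega u -> square_integrable Omega phi ->
  `|\int[leb]_(x in Omega) (u x * phi x)| <=
  t^-1 * \int[leb]_(x in Omega) (u x ^+ 2) +
  t * \int[leb]_(x in Omega) (phi x ^+ 2).
Proof.
move=> t0 su sphi; have [_ u2] := (square_integrableP u).1 su.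
have [_ p2] := (square_integrableP phi).1 sphi.
have up := square_integrable_mul su sphi.
apply: (le_trans (le_normr_Rintegral mO up)).
have iu : leb.-integrable Omega (EFin \o (fun x => t^-1 * u x ^+ 2)).
  by have := integrableZl mO t^-1 u2.
have ip : leb.-integrable Omega (EFin \o (fun x => t * phi x ^+ 2)).
  by have := integrableZl mO t p2.
rewrite -(RintegralZl t^-1 mO u2) -(RintegralZl t mO p2) -(RintegralD mO iu ip).
apply: le_Rintegral => //.
- by have := integrable_abse up.
- by have := integrableD mO iu ip.
move=> x _.
have [a b] : exists s : R, s ^+ 2 = t.
  by exists (Num.sqrt t); rewrite sqr_sqrtr ?ltW.
have a0 : a != 0 by apply/eqP => a0; move: t0; rewrite -b a0 expr0n ltxx.
have := sqr_ge0 (u x / a - phi x * a); have := sqr_ge0 (u x / a + phi x * a).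
rewrite sqrrD sqrrB -b.
have -> : u x / a * (phi x * a) = u x * phi x by field.
have -> : (u x / a) ^+ 2 = (a ^+ 2)^-1 * u x ^+ 2 by field.
have -> : (phi x * a) ^+ 2 = a ^+ 2 * phi x ^+ 2 by ring.
have := mulr_ge0 (sqr_ge0 a) (sqr_ge0 (phi x)).
have := mulr_ge0 (_ : 0 <= (a ^+ 2)^-1) (sqr_ge0 (u x)).
rewrite invr_ge0 sqr_ge0 => /(_ isT).
by move=> *; rewrite ler_norml; apply/andP; split; lra.
Qed.

End L2_facts.

(** * Asymptotics of the energy *)

Section energy_asymptotics.
Context {R : realType} {n : nat}.
Hypothesis n0 : (0 < n)%N.
Local Notation E := 'rV[R]_n.
Local Notation leb := (@lebesgue_rV R n).
Local Notation d := (n%:R : R).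
Variables (Omega : set E) (r M a0 a1 a2 : R) (v v' : E -> R).
Hypotheses (mO : measurable Omega) (r0 : 0 < r) (Or : Omega `<=` eball n r).
Hypothesis mv' : measurable_fun setT v'.
Hypothesis vM : forall y, `|v' y| <= M.
Hypothesis vv' : {ae leb, forall x, ~ Omega x -> v x = v' x}.
Hypothesis t0 : mass_tends (fun _ : E => 1) a0.
Hypothesis t1 : mass_tends v' a1.
Hypothesis t2 : mass_tends (fun y => v' y ^+ 2) a2.

Local Notation I f := (\int[leb]_(x in Omega) f%R x).
Local Notation vol := (fine (leb Omega)).

Lemma at_right_seq (s_ : nat -> R) (P : R -> Prop) : (forall j, 0 < s_ j) ->
  s_ @ \oo --> (0 : R) -> (\forall s \near (0 : R)^'+, P s) ->
  \forall j \near \oo, P (s_ j).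
Proof.
move=> s0 cs HP; have : \forall j \near \oo, 0 < s_ j -> P (s_ j) := cs _ HP.
by apply: filterS => j; exact.
Qed.

(** The functional F_0 on L^2(Omega), as a real number. *)
Definition limit_energy (u : E -> R) : R :=
  a0 * I (fun x => u x ^+ 2) - 2 * a1 * I u + a2 * vol.

Lemma integral_quadratic (A B C : R) (u : E -> R) : square_integrable Omega u ->
  leb.-integrable Omega (fun x => (A * u x ^+ 2 + B * u x + C)%:E) /\
  I (fun x => A * u x ^+ 2 + B * u x + C) =
  A * I (fun x => u x ^+ 2) + B * I u + C * vol.
Proof.
move=> su; have [mu u2] := (square_integrableP Omega u).1 su.
have u1 := square_integrable_int mO Or su.
have iA : leb.-integrable Omega (EFin \o (fun x => A * u x ^+ 2)).
  by have := integrableZl mO A u2.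
have iB : leb.-integrable Omega (EFin \o (fun x => B * u x)).
  by have := integrableZl mO B u1.
have iC := integrable_cst_bounded mO Or C.
have iAB : leb.-integrable Omega (EFin \o (fun x => A * u x ^+ 2 + B * u x)).
  by have := integrableD mO iA iB.
split; first by have := integrableD mO iAB iC.
rewrite (RintegralD mO iAB iC) (RintegralD mO iA iB).
by rewrite (RintegralZl A mO u2) (RintegralZl B mO u1) Rintegral_cst.
Qed.

Lemma quad_perturbed (e a : R) : quad a0 a1 a2 a + e * (1 + a ^+ 2) =
  (a0 + e) * a ^+ 2 + - (2 * a1) * a + (a2 + e).
Proof. by rewrite /quad; ring. Qed.

Lemma integral_quad (e : R) (u : E -> R) : square_integrable Omega u ->
  leb.-integrable Omega (fun x => (quad a0 a1 a2 (u x) + e * (1 + u x ^+ 2))%:E)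
  /\ (\int[leb]_(x in Omega)
       (quad a0 a1 a2 (u x) + e * (1 + u x ^+ 2))%:E =
     (limit_energy u + e * (vol + I (fun x => u x ^+ 2)))%:E)%E.
Proof.
move=> su; have [iq Iq] := integral_quadratic (a0 + e) (- (2 * a1)) (a2 + e) su.
under eq_fun do rewrite quad_perturbed; split => //.
rewrite integral_Rintegral// Iq /limit_energy; congr EFin; ring.
Qed.

Lemma measurable_far_energy (w : E -> R) s rho : Omega `<=` eball n rho ->
  measurable_fun Omega w ->
  measurable_fun Omega (fun x => s%:E * \int[leb]_(y in outside rho)
    ((w x - v' y) ^+ 2 * riesz (d + 2 * s) (x - y))%:E)%E.
Proof.
move=> Orho mw; apply: emeasurable_funM => //.
have mi := measurable_interaction s (measurable_patch mO mv' mw).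
apply: eq_measurable_fun; last first.
  apply: measurable_funTS.
  exact: (measurable_tonelli_inner leb (@measurable_outside R n rho) mi
    (interaction_ge0 s _)).
by move=> x; rewrite inE => Ox /=; rewrite interaction_far.
Qed.

(** Monotonicity of the integral when g is integrable but of any sign and G is
    nonnegative, possibly of infinite integral. *)
Lemma integral_le_ge0 (g : E -> R) (G : E -> \bar R) :
  leb.-integrable Omega (fun x => (g x)%:E) -> measurable_fun Omega G ->
  (forall x, Omega x -> 0 <= G x)%E ->
  (forall x, Omega x -> (g x)%:E <= G x)%E ->
  (\int[leb]_(x in Omega) (g x)%:E <= \int[leb]_(x in Omega) G x)%E.
Proof.
move=> ig mG G0 gG; have ip := integrable_funepos mO ig.
apply: (@le_trans _ _ (\int[leb]_(x in Omega) ((fun x => (g x)%:E)^\+ x))%E).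
  apply: le_integral => // x _; by rewrite funeposE le_max lexx.
apply: ge0_le_integral => //; first exact: measurable_int ip.
by move=> x Ox; rewrite funeposE ge_max gG//= G0.
Qed.

(** The far part alone already gives the limit energy, pointwise in x. The
    range of s depends on e but not on w, which allows w to vary with s. *)
Lemma energy_lower (e : R) : 0 < e ->
  \forall s \near (0 : R)^'+, forall w, square_integrable Omega w ->
  ((limit_energy w - e * (vol + I (fun x => w x ^+ 2)))%:E <= F_on Omega v s w)%E.
Proof.
move=> e0.
have [rho [rho1 rrho Hs]] := far_limit n0 r0 mv' vM t0 t1 t2 e0.
have Orho : Omega `<=` eball n rho.
  by move=> x /Or; rewrite /eball/= => xr; exact: lt_le_trans rrho.
near=> s => w sw; have [mw _] := sw.
have s0 : 0 < s by near: s; exact: nbhs_right_gt.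
have far : forall (x : E) a, eucl_norm x < r ->
    ((quad a0 a1 a2 a - e * (1 + a ^+ 2))%:E <=
    s%:E * \int[leb]_(y in outside rho)
      ((a - v' y) ^+ 2 * riesz (d + 2 * s) (x - y))%:E <=
    (quad a0 a1 a2 a + e * (1 + a ^+ 2))%:E)%E by near: s.
apply: le_trans (F_on_ge mO mv' vv' s0 Orho mw).
have [iq Iq] := integral_quad (- e) sw.
rewrite -[X in _ - X]opprK -mulNr opprK -Iq.
apply: integral_le_ge0 => //; first exact: measurable_far_energy.
- move=> x _; rewrite mule_ge0 ?lee_fin ?(ltW s0)//.
  by apply: integral_ge0 => y _; rewrite lee_fin mulr_ge0 ?sqr_ge0 ?riesz_ge0.
- by move=> x /Or xr; rewrite mulNr; have /andP[] := far x (w x) xr.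
Unshelve. all: by end_near. Qed.

(** On a compact set the extension coincides almost everywhere with a bounded
    function. *)
Lemma L2loc_patch (w : E -> R) : measurable_fun (~` Omega) v ->
  measurable_fun Omega w -> (exists Mw : R, forall x, `|w x| <= Mw) ->
  L2loc_Q Omega v (patch v Omega w).
Proof.
move=> mv mw [Mw wM].
have mp : measurable_fun setT (patch v Omega w).
  have -> : setT = Omega `|` ~` Omega by rewrite setUv.
  apply/measurable_funU => //; first exact: measurableC.
  split.
  - apply: eq_measurable_fun mw => x; rewrite inE => Ox.
    by rewrite /patch mem_set.
  - apply: eq_measurable_fun mv => x; rewrite inE => nOx.
    by rewrite /patch memNset.
have mp' := measurable_patch mO mv' mw.
split; last by apply: aeW => x nOx; rewrite /patch memNset.
split => // K cK.
have mK : measurable K.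
  apply: closed_measurable_rV.
  by apply: (compact_closed _ cK); exact: norm_hausdorff.
have Kfin := bounded_set_fin_measure mK (compact_bounded cK).
pose B := (Num.max M Mw) ^+ 2.
have pB x : `|patch v' Omega w x| ^+ 2 <= B.
  have B0 : 0 <= Num.max M Mw by rewrite le_max (le_trans _ (vM 0)).
  rewrite ler_pXn2r ?nnegrE//.
  by rewrite /patch; case: ifP => _; rewrite le_max ?wM ?vM ?orbT.
rewrite (_ : (\int[leb]_(x in K) _)%E =
    (\int[leb]_(x in K) (`|patch v' Omega w x| ^+ 2)%:E)%E); last first.
  apply: ae_eq_integral => //.
  - apply/measurable_EFinP; apply: measurable_funTS.
    by apply: measurable_funX; exact: measurableT_comp.
  - apply/measurable_EFinP; apply: measurable_funTS.
    by apply: measurable_funX; exact: measurableT_comp.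
  - apply: filterS vv' => x vx _; rewrite /patch; case: ifPn => // /negP xO.
    by rewrite vx// => Ox; apply: xO; exact: mem_set.
apply: (@le_lt_trans _ _ (\int[leb]_(x in K) cst B%:E x)%E).
  apply: ge0_le_integral => //.
    apply/measurable_EFinP; apply: measurable_funTS.
    by apply: measurable_funX; exact: measurableT_comp.
  by move=> x _; rewrite lee_fin.
rewrite [ltLHS](integral_cst leb mK).
by rewrite lte_mul_pinfty// lee_fin sqr_ge0.
Qed.

(** Extended by v', a tame w changes under a translation only where w does or
    where the boundary is crossed. The near part is therefore bounded, and
    killed by the factor s. *)
Lemma energy_upper (w : E -> R) (Cx e : R) : measurable_fun (~` Omega) v ->
  0 <= Cx ->
  (forall z : E, leb [set x | Omega x /\ ~ Omega (x + z)%R] <=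
    (Cx * eucl_norm z)%:E)%E ->
  tame Omega w -> 0 < e ->
  \forall s \near (0 : R)^'+,
  (F_on Omega v s w <=
    (limit_energy w + e * (vol + I (fun x => (w x ^+ 2)%R)) + e)%:E)%E.
Proof.
move=> mv Cx0 HCx gw e0; have [mwT bw [C C0 Cw]] := gw; have [Mw wM] := bw.
have mw : measurable_fun Omega w by exact: measurable_funTS.
have sw : square_integrable Omega w.
  by apply: (square_integrable_bounded mO Or mw) => x _; exact: wM.
have [rho [rho1 rrho Hs]] := far_limit n0 r0 mv' vM t0 t1 t2 e0.
have Orho : Omega `<=` eball n rho.
  by move=> x /Or; rewrite /eball/= => xr; exact: lt_le_trans rrho.
have mp' := measurable_patch mO mv' mw.
pose B := Num.max M Mw.
have pB x : `|patch v' Omega w x| <= B.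
  by rewrite /patch; case: ifP => _; rewrite le_max ?wM ?vM ?orbT.
have ts : translation_stable Omega (patch v' Omega w).
  exists (C + Cx); first exact: addr_ge0.
  move=> z; rewrite mulrDl EFinD; apply: le_trans (leeD (Cw z) (HCx z)).
  have m1 := measurable_jump mO z mwT.
  have m2 : measurable [set x | Omega x /\ ~ Omega (x + z)].
    apply: (measurableI _ _ mO); apply: measurableC.
    exact: (measurable_preimageT (measurable_translation z) mO).
  apply: le_trans (measureU2 leb m1 m2).
  apply: le_measure; rewrite ?inE.
  - exact: (measurable_jump mO z mp').
  - exact: measurableU.
  - move=> x [Ox H]; have [Oxz|nOxz] := pselect (Omega (x + z)); last by right.
    by left; split => //; move: H; rewrite /patch !mem_set.
have [Cn Cn0 near] := near_bound n0 mO Or rrho rho1 mp' pB ts.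
near=> s.
have s0 : 0 < s by near: s; exact: nbhs_right_gt.
have s4 : s <= 4^-1 by near: s; apply: nbhs_right_le; rewrite invr_gt0.
have sC : s * Cn <= e.
  have : s <= e / (Cn + 1).
    by near: s; apply: nbhs_right_le; rewrite divr_gt0// ltr_wpDl.
  by rewrite ler_pdivlMr ?ltr_wpDl//; nra.
have far : forall (x : E) a, eucl_norm x < r ->
    ((quad a0 a1 a2 a - e * (1 + a ^+ 2))%:E <=
    s%:E * \int[leb]_(y in outside rho)
      ((a - v' y) ^+ 2 * riesz (d + 2 * s) (x - y))%:E <=
    (quad a0 a1 a2 a + e * (1 + a ^+ 2))%:E)%E by near: s.
apply: (le_trans (F_on_le mO mv' vv' s0 Orho (L2loc_patch mv mw bw) mw)).
rewrite [leRHS]EFinD; apply: leeD.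
  have [iq <-] := integral_quad e sw.
  apply: ge0_le_integral => //.
  - move=> x _; rewrite mule_ge0 ?lee_fin ?(ltW s0)//.
    by apply: integral_ge0 => y _; rewrite lee_fin mulr_ge0 ?sqr_ge0 ?riesz_ge0.
  - exact: measurable_far_energy.
  - exact: measurable_int iq.
  - by move=> x /Or xr; have /andP[] := far x (w x) xr.
apply: (@le_trans _ _ (s%:E * Cn%:E)%E); last by rewrite -EFinM lee_fin.
apply: lee_wpmul2l; first by rewrite lee_fin ltW.
by apply: near; rewrite s0.
Unshelve. all: by end_near. Qed.

End energy_asymptotics.

(** * The two inequalities of Gamma-convergence *)

Section gamma_limit.
Context {R : realType} {n : nat}.
Hypothesis n0 : (0 < n)%N.
Local Notation E := 'rV[R]_n.
Local Notation leb := (@lebesgue_rV R n).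
Variables (Omega : set E) (r M a0 a1 a2 : R) (v v' : E -> R).
Hypotheses (mO : measurable Omega) (r0 : 0 < r) (Or : Omega `<=` eball n r).
Hypothesis mv' : measurable_fun setT v'.
Hypothesis vM : forall y, `|v' y| <= M.
Hypothesis vv' : {ae leb, forall x, ~ Omega x -> v x = v' x}.
Hypothesis t0 : mass_tends (fun _ : E => 1) a0.
Hypothesis t1 : mass_tends v' a1.
Hypothesis t2 : mass_tends (fun y => v' y ^+ 2) a2.
Hypothesis a0_gt0 : 0 < a0.

Local Notation I f := (\int[leb]_(x in Omega) f%R x).
Local Notation vol := (fine (leb Omega)).
Local Notation LE := (limit_energy Omega a0 a1 a2).

Lemma near_invn (e : R) : 0 < e -> \forall k \near \oo, k.+1%:R^-1 <= e.
Proof.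
move=> e0; have := near_infty_natSinv_lt (PosNum e0).
by apply: filterS => k /= /ltW.
Qed.

Lemma integral_sqr_dist (u w : E -> R) :
  square_integrable Omega u -> square_integrable Omega w ->
  I (fun x => (u x - w x) ^+ 2) =
  I (fun x => u x ^+ 2) - 2 * I (fun x => w x * u x) + I (fun x => w x ^+ 2).
Proof.
move=> su sw.
have [_ u2] := (square_integrableP Omega u).1 su.
have [_ w2] := (square_integrableP Omega w).1 sw.
have wu := square_integrable_mul mO sw su.
have i1 : leb.-integrable Omega (EFin \o (fun x => 2 * (w x * u x))).
  by have := integrableZl mO 2 wu.
have i2 : leb.-integrable Omega (EFin \o (fun x => u x ^+ 2 - 2 * (w x * u x))).
  by have := integrableB mO u2 i1.
rewrite -(RintegralZl 2 mO wu) -(RintegralB mO u2 i1) -(RintegralD mO i2 w2).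
by apply: eq_Rintegral => x _; ring.
Qed.

Lemma Rintegral_sqr_ge0 (f : E -> R) : 0 <= I (fun x => f x ^+ 2).
Proof. by apply: Rintegral_ge0 => x _; exact: sqr_ge0. Qed.

Lemma Rintegral_mul1 (f : E -> R) :
  \int[leb]_(x in Omega) (f x * cst 1 x) = I f.
Proof. by apply: eq_Rintegral => x _; rewrite /cst mulr1. Qed.

Lemma Rintegral_mulxx (f : E -> R) :
  \int[leb]_(x in Omega) (f x * f x) = I (fun x => f x ^+ 2).
Proof. by apply: eq_Rintegral => x _; rewrite expr2. Qed.

(** The inequality int u_j^2 >= 2 int u_j u - int u^2 replaces lower
    semicontinuity of the norm: it involves the weakly convergent pairing
    only, and applies with the factor a0 - e >= 0. *)
Lemma energy_liminf (s_ : nat -> R) (u_ : nat -> E -> R) (u : E -> R) (eta : R) :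
  (forall j, 0 < s_ j) -> s_ @ \oo --> (0 : R) -> weakL2_cvg Omega u_ u ->
  0 < eta ->
  \forall j \near \oo, ((LE u - eta)%:E <= F_on Omega v (s_ j) (u_ j))%E.
Proof.
move=> s0 cs [su_ su wk] eta0.
set U2 := I (fun x => u x ^+ 2).
have U20 : 0 <= U2 by exact: Rintegral_sqr_ge0.
have vol0 : 0 <= vol by rewrite fine_ge0.
pose D := 2 * (vol + U2 + 1).
have D0 : 0 < D by rewrite /D; lra.
(* e <= a0 keeps the coefficient of int u_j^2 nonnegative after the error is
   subtracted; the other bound makes the error on the limit at most eta/2. *)
pose e := Num.min a0 (eta / D).
have e0 : 0 < e by rewrite lt_min a0_gt0 divr_gt0.
have ea0 : e <= a0 by rewrite ge_min lexx.
have eD : e * (vol + U2) <= eta / 2.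
  have : e <= eta / D by rewrite ge_min lexx orbT.
  rewrite ler_pdivlMr// /D; nra.
(* Tolerance on the two weakly convergent quantities, which enter with the
   factors 2 a0 and 2 |a1|. *)
pose h := eta / (4 * (a0 + `|a1| + 1)).
have den0 : 0 < 4 * (a0 + `|a1| + 1).
  by have := normr_ge0 a1; lra.
have h0 : 0 < h by exact: divr_gt0.
have hE : h * (4 * (a0 + `|a1| + 1)) = eta by rewrite divfK// gt_eqF.
have s1 : square_integrable Omega (cst 1 : E -> R).
  by apply: (square_integrable_bounded mO Or (M := 1)) => // x _; rewrite normr1.
have low := energy_lower n0 mO r0 Or mv' vM vv' t0 t1 t2 e0.
have lowj := at_right_seq s0 cs low.
have c1 : \forall j \near \oo, `|I u - I (u_ j)| <= h.
  have /cvgrPdist_le/(_ _ h0) := wk _ s1.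
  by apply: filterS => j; rewrite !Rintegral_mul1.
have c2 : \forall j \near \oo, `|U2 - I (fun x => u_ j x * u x)| <= h.
  have /cvgrPdist_le/(_ _ h0) := wk _ su.
  by apply: filterS => j; rewrite Rintegral_mulxx.
near=> j.
have lj : forall w, square_integrable Omega w ->
  ((LE w - e * (vol + I (fun x => w x ^+ 2)))%:E <= F_on Omega v (s_ j) w)%E.
  by near: j.
apply: le_trans (lj _ (su_ j)); rewrite lee_fin.
have d1 : `|I u - I (u_ j)| <= h by near: j.
have d2 : `|U2 - I (fun x => u_ j x * u x)| <= h by near: j.
have := integral_sqr_dist su (su_ j).
have := Rintegral_sqr_ge0 (fun x => u x - u_ j x).
rewrite -/U2 /limit_energy -/U2.
set W2 := I (fun x => u_ j x ^+ 2); set WU := I (fun x => u_ j x * u x).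
set S := I (fun x => (u x - u_ j x) ^+ 2) => S0 SE.
have : `|a1 * (I u - I (u_ j))| <= `|a1| * h by rewrite normrM ler_wpM2l.
have : (a0 - e) * (2 * WU - U2) <= (a0 - e) * W2.
  by rewrite ler_wpM2l ?subr_ge0//; lra.
have : (a0 - e) * (2 * (U2 - WU)) <= a0 * (2 * h).
  apply: (@le_trans _ _ ((a0 - e) * (2 * h))).
    rewrite ler_wpM2l ?subr_ge0// ler_pM2l//.
    by apply: le_trans d2; exact: ler_norm.
  by rewrite ler_wpM2r; lra.
rewrite ler_norml => h3 h4 /andP[h5 h6].
move: hE h3 h4 h5 h6 eD; lra.
Unshelve. all: by end_near. Qed.

Lemma strong_weak (w_ : nat -> E -> R) (u : E -> R) :
  (forall j, square_integrable Omega (w_ j)) -> square_integrable Omega u ->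
  (forall e, 0 < e ->
    \forall j \near \oo, I (fun x => (u x - w_ j x) ^+ 2) <= e) ->
  weakL2_cvg Omega w_ u.
Proof.
move=> sw su cw; split => // phi sphi.
apply/cvgrPdist_le => e e0.
set P2 := I (fun x => phi x ^+ 2).
have P20 : 0 <= P2 by exact: Rintegral_sqr_ge0.
pose t := e / (2 * (P2 + 1)).
have t0' : 0 < t by rewrite divr_gt0// mulr_gt0// ltr_wpDl.
have tP : t * P2 <= e / 2.
  have tE : t * (2 * (P2 + 1)) = e by rewrite divfK// gt_eqF// mulr_gt0// ltr_wpDl.
  by move: tE t0'; nra.
have et : 0 < t * (e / 2) by rewrite mulr_gt0// divr_gt0.
near=> j.
have dj : I (fun x => (u x - w_ j x) ^+ 2) <= t * (e / 2) by near: j; exact: cw.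
rewrite -(RintegralB mO (square_integrable_mul mO su sphi)
  (square_integrable_mul mO (sw j) sphi)).
have -> : I (fun x => u x * phi x - w_ j x * phi x) =
    I (fun x => (u x - w_ j x) * phi x).
  by apply: eq_Rintegral => x _; rewrite mulrBl.
apply: (le_trans (Rintegral_young mO t0' (square_integrableB mO su (sw j)) sphi)).
rewrite -/P2.
have : t^-1 * I (fun x => (u x - w_ j x) ^+ 2) <= e / 2.
  by rewrite ler_pdivrMl.
lra.
Unshelve. all: by end_near. Qed.

(** Continuity of the limit energy for strong convergence, in terms of
    pairings that are available for a weakly convergent sequence. *)
Lemma limit_energy_le (u w : E -> R) (h : R) :
  square_integrable Omega u -> square_integrable Omega w ->
  `|I u - I w| <= h -> `|I (fun x => u x ^+ 2) - I (fun x => w x * u x)| <= h ->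
  I (fun x => (u x - w x) ^+ 2) <= h ->
  LE w <= LE u + 3 * (a0 + `|a1|) * h.
Proof.
move=> su sw h1 h2 h3; have := integral_sqr_dist su sw.
move: h1 h2 h3; rewrite /limit_energy.
set U2 := I (fun x => u x ^+ 2); set W2 := I (fun x => w x ^+ 2).
set WU := I (fun x => w x * u x).
set S := I (fun x => (u x - w x) ^+ 2) => h1 h2 h3 SE.
have h0 : 0 <= h by exact: le_trans h1.
have : `|a1 * (I u - I w)| <= `|a1| * h by rewrite normrM ler_wpM2l.
have : a0 * (S - 2 * (U2 - WU)) <= a0 * (3 * h).
  rewrite ler_pM2l//; move: h2; rewrite ler_norml => /andP[? ?]; lra.
have a1h : 0 <= `|a1| * h by rewrite mulr_ge0.
have -> : S - 2 * (U2 - WU) = W2 - U2 by rewrite SE; ring.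
rewrite ler_norml => h4 /andP[h5 h6]; lra.
Qed.

Hypothesis mv : measurable_fun (~` Omega) v.
Variable Cx : R.
Hypothesis Cx0 : 0 <= Cx.
Hypothesis HCx : forall z : E, (leb [set x | Omega x /\ ~ Omega (x + z)%R] <=
    (Cx * eucl_norm z)%:E)%E.

(** For each tame approximation w_k of u the energies converge as s tends
    to 0; letting k grow slowly along the sequence s_j gives the recovery
    sequence. *)
Lemma energy_limsup (s_ : nat -> R) (u : E -> R) :
  (forall j, 0 < s_ j) -> s_ @ \oo --> (0 : R) -> square_integrable Omega u ->
  exists2 u_, weakL2_cvg Omega u_ u & forall eta : R, 0 < eta ->
  \forall j \near \oo, (F_on Omega v (s_ j) (u_ j) <= (LE u + eta)%:E)%E.
Proof.
move=> s0 cs su.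
have [mu au] := approximable_L2 mO Or su.
have /choice[w_ wP] : forall k : nat, exists w, tame Omega w /\
    (\int[leb]_(x in Omega) ((u x - w x) ^+ 2)%:E <= (k.+1%:R^-1)%:E)%E.
  move=> k; have k0 : 0 < k.+1%:R^-1 :> R by rewrite invr_gt0.
  by have [w gw uw] := au _ k0; exists w.
have sw k : square_integrable Omega (w_ k).
  have [[mw [Mw wM] _] _] := wP k.
  by apply: (square_integrable_bounded mO Or (measurable_funTS mw)) => x _;
    exact: wM.
have dw k : I (fun x => (u x - w_ k x) ^+ 2) <= k.+1%:R^-1.
  have [_] := wP k; rewrite -lee_fin.
  have [_ i2] := (square_integrableP Omega _).1 (square_integrableB mO su (sw k)).
  by rewrite (integral_Rintegral mO i2).
have strong e : 0 < e ->
    \forall k \near \oo, I (fun x => (u x - w_ k x) ^+ 2) <= e.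
  by move=> e0; apply: filterS (near_invn e0) => k; exact: le_trans (dw k).
have [_ _ wk] := strong_weak sw su strong.
pose P k j := (F_on Omega v (s_ j) (w_ k) <= (LE (w_ k) + k.+1%:R^-1)%:E)%E.
have [kappa kinf kP] : exists2 kappa : nat -> nat,
    (forall k, \forall j \near \oo, (k <= kappa j)%N) &
    \forall j \near \oo, P (kappa j) j.
  apply: (@diagonal_selection P) => k.
  have [gw _] := wP k.
  set W2 := I (fun x => w_ k x ^+ 2).
  have W20 : 0 <= W2 by exact: Rintegral_sqr_ge0.
  have vol0 : 0 <= vol by rewrite fine_ge0.
  have D0 : 0 < vol + W2 + 1 by lra.
  have e0 : 0 < k.+1%:R^-1 / (vol + W2 + 1) by rewrite divr_gt0 ?invr_gt0.
  have up := energy_upper n0 mO r0 Or mv' vM vv' t0 t1 t2 mv Cx0 HCx gw e0.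
  apply: filterS (at_right_seq s0 cs up) => j; rewrite /P => /le_trans; apply.
  rewrite lee_fin -addrA lerD2l -/W2 -[X in _ + X <= _]mulr1 -mulrDr.
  by rewrite divfK// gt_eqF.
exists (fun j => w_ (kappa j)).
  apply: (strong_weak (fun j => sw (kappa j)) su) => e e0.
  have [K _ KP] := strong e e0.
  by apply: filterS (kinf K) => j Kj; exact: KP.
move=> eta eta0.
pose h := eta / (2 * (3 * (a0 + `|a1|) + 1)).
have den0 : 0 < 2 * (3 * (a0 + `|a1|) + 1).
  by rewrite mulr_gt0// ltr_wpDl// mulr_ge0// addr_ge0// ltW.
have h0 : 0 < h by exact: divr_gt0.
have hE : h * (2 * (3 * (a0 + `|a1|) + 1)) = eta by rewrite divfK// gt_eqF.
have s1 : square_integrable Omega (cst 1 : E -> R).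
  by apply: (square_integrable_bounded mO Or (M := 1)) => // x _; rewrite normr1.
have [K KP] : exists K, forall k, (K <= k)%N ->
    LE (w_ k) + k.+1%:R^-1 <= LE u + eta.
  suff [K _ KP] : \forall k \near \oo, LE (w_ k) + k.+1%:R^-1 <= LE u + eta.
    by exists K => k Kk; exact: KP.
  near=> k.
  have c1 : `|I u - I (w_ k)| <= h.
    near: k; have /cvgrPdist_le/(_ _ h0) := wk _ s1.
    by apply: filterS => j; rewrite !Rintegral_mul1.
  have c2 : `|I (fun x => u x ^+ 2) - I (fun x => w_ k x * u x)| <= h.
    near: k; have /cvgrPdist_le/(_ _ h0) := wk _ su.
    by apply: filterS => j; rewrite Rintegral_mulxx.
  have c3 : I (fun x => (u x - w_ k x) ^+ 2) <= h by near: k; exact: strong.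
  have c4 : k.+1%:R^-1 <= h by near: k; exact: near_invn.
  have := limit_energy_le su (sw k) c1 c2 c3.
  move=> LEw; apply: (le_trans (lerD LEw c4)).
  have -> : eta = 2 * (3 * (a0 + `|a1|) * h + h) by rewrite -[LHS]hE; ring.
  rewrite -addrA lerD2l ler_peMl ?ler1n// addr_ge0 ?(ltW h0)//.
  by rewrite mulr_ge0 ?(ltW h0)// mulr_ge0// addr_ge0// ltW.
near=> j.
have Pj : P (kappa j) j by near: j.
have Kj : (K <= kappa j)%N by near: j; exact: kinf.
by apply: (le_trans Pj); rewrite lee_fin KP.
Unshelve. all: by end_near. Qed.

End gamma_limit.

(** * Gamma-convergence *)

Section gamma_convergence.
Context {R : realType} {n : nat}.
Hypothesis n0 : (0 < n)%N.
Local Notation E := 'rV[R]_n.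
Local Notation leb := (@lebesgue_rV R n).

Lemma F0E (Omega : set E) (r a0 a1 a2 : R) (v u : E -> R) :
  measurable Omega -> Omega `<=` eball n r -> square_integrable Omega u ->
  alpha (fun y => zero_ext Omega v y ^+ 0) = a0%:E ->
  alpha (fun y => zero_ext Omega v y ^+ 1) = a1%:E ->
  alpha (fun y => zero_ext Omega v y ^+ 2) = a2%:E ->
  F0 Omega v u = (limit_energy Omega a0 a1 a2 u)%:E.
Proof.
move=> mO Or su e0 e1 e2; rewrite /F0 asboolT//.
have [_ u2] := (square_integrableP Omega u).1 su.
have u1 := square_integrable_int mO Or su.
have i2 := integral_Rintegral mO u2; have i1 := integral_Rintegral mO u1.
have i0 := integral_Rintegral mO (integrable_cst_bounded mO Or 1).
rewrite 3!big_ord_recr big_ord0 /= add0e e0 e1 e2.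
rewrite -[X in (_ + _ * X)%E]/(\int[leb]_(x in Omega) (cst 1 x)%:E)%E.
rewrite i2 -[X in (_ + _ * X + _)%E]/(\int[leb]_(x in Omega) (u x)%:E)%E i1 i0.
rewrite Rintegral_cst// -!EFinM -!EFinD; congr EFin; rewrite /limit_energy.
by rewrite bin0 bin1 binn expr0 expr1 sqrrN expr1n; ring.
Qed.

(** The boundary enters through the bound on the points that exit under a
    translation. The data is replaced by the truncation v' of its extension by
    zero, whose masses are the same, and alpha(v) is obtained as alpha(v+) -
    alpha(v-). *)
Lemma gamma_convergence (Omega : set E) (v : E -> R) (Cx : R) :
  open Omega -> bounded_set Omega -> 0 <= Cx ->
  (forall z : E, (leb [set x | Omega x /\ ~ Omega (x + z)%R] <=
    (Cx * eucl_norm z)%:E)%E) ->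
  admissible Omega v -> Gamma_cvg_weakL2 Omega (F_on Omega v) (F0 Omega v).
Proof.
move=> oO bO Cx0 HCx [[mv [M0 vM0]] hp hn h2].
have mO := open_measurable_rV oO.
have [r r0 Or] := bounded_set_eball bO.
pose z := zero_ext Omega v.
have mz : measurable_fun setT z.
  exact: (measurable_patch (measurableC mO) (measurable_cst _) mv).
pose M := `|M0|; pose v' y := Num.max (- M) (Num.min M (z y)).
have MM : - M <= M by have := normr_ge0 M0; rewrite -/M; lra.
have vM y : `|v' y| <= M.
  by rewrite ler_norml /v' le_max lexx ge_max MM ge_min lexx.
have mv' : measurable_fun setT v'.
  apply: measurable_maxr => //; apply: measurable_minr => //.
have v'E t : `|t| <= M -> Num.max (- M) (Num.min M t) = t.
  by rewrite ler_norml => /andP[tM Mt]; rewrite (min_idPr Mt); exact/max_idPr.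
have zv' : {ae leb, forall y, z y = v' y}.
  apply: filterS vM0 => y vy; rewrite /v' v'E// /z /zero_ext /patch.
  case: ifPn => [/set_mem/vy|_]; last by rewrite normr0 normr_ge0.
  by move=> /le_trans; apply; exact: ler_norm.
have vv' : {ae leb, forall x, ~ Omega x -> v x = v' x}.
  by apply: filterS zv' => y <- Oy; rewrite /z /zero_ext /patch mem_set.
have massE (f : R -> R) : measurable_fun setT f ->
    mass (fun y => f (z y)) = mass (fun y => f (v' y)).
  move=> mf; apply/funext => s; apply: mass_ae_eq.
  - exact: measurableT_comp mf mz.
  - exact: measurableT_comp mf mv'.
  - by apply: filterS zv' => y ->.
have [a0 a0_gt0 t0] := @mass_tends1 R n n0.
have mfp : measurable_fun setT (fun t : R => Num.max t 0) by exact: measurable_maxr.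
have mfn : measurable_fun setT (fun t : R => Num.max (- t) 0).
  by apply: measurable_maxr => //; exact: measurable_funN.
have mf2 : measurable_fun setT (fun t : R => t ^+ 2) by exact: measurable_funX.
have M00 : 0 <= M by exact: normr_ge0.
have bp y : `|Num.max (v' y) 0| <= M.
  have := vM y; case: (leP (v' y) 0) => //; rewrite normr0//.
have bn y : `|Num.max (- v' y) 0| <= M.
  have := vM y; case: (leP (- v' y) 0); rewrite ?normr0 ?normrN//.
have b2 y : `|v' y ^+ 2| <= M ^+ 2.
  by rewrite normrX ler_pXn2r ?nnegrE.
have [ap tp] : exists a, mass_tends (fun y => Num.max (v' y) 0) a.
  apply: (has_alpha_mass_tends n0 (measurableT_comp mfp mv') bp).
  by rewrite /has_alpha -(massE _ mfp).
have [an tn] : exists a, mass_tends (fun y => Num.max (- v' y) 0) a.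
  apply: (has_alpha_mass_tends n0 (measurableT_comp mfn mv') bn).
  by rewrite /has_alpha -(massE _ mfn).
have [a2 t2] : exists a, mass_tends (fun y => v' y ^+ 2) a.
  apply: (has_alpha_mass_tends n0 (measurableT_comp mf2 mv') b2).
  by rewrite /has_alpha -(massE _ mf2).
pose a1 := 1 * ap + -1 * an.
have t1 : mass_tends v' a1.
  have := mass_tends_lincomb n0 1 (-1) (measurableT_comp mfp mv') bp
    (measurableT_comp mfn mv') bn tp tn.
  congr (mass_tends _ _); apply/funext => y /=.
  by case: (leP (v' y) 0) => v0; case: (leP (- v' y) 0) => v1; lra.
have al0 : alpha (fun y => zero_ext Omega v y ^+ 0) = a0%:E.
  exact: (mass_tends_alpha t0).
have al1 : alpha (fun y => zero_ext Omega v y ^+ 1) = a1%:E.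
  by rewrite /alpha (massE (fun t => t) (@measurable_id _ _ _)) -/(alpha _);
    exact: (mass_tends_alpha t1).
have al2 : alpha (fun y => zero_ext Omega v y ^+ 2) = a2%:E.
  by rewrite /alpha (massE _ mf2); exact: (mass_tends_alpha t2).
have F0u u : square_integrable Omega u ->
    F0 Omega v u = (limit_energy Omega a0 a1 a2 u)%:E.
  by move=> su; exact: (F0E mO Or su al0 al1 al2).
move=> s_ s01 cs; have s0 j : 0 < s_ j by have /andP[] := s01 j.
split => [u_ u wk|u su].
  have [_ su _] := wk; rewrite F0u//; apply: limn_einf_ge => e e0.
  exact: (energy_liminf n0 mO r0 Or mv' vM vv' t0 t1 t2 a0_gt0 s0 cs wk e0).
have [u_ wk H] := energy_limsup n0 mO r0 Or mv' vM vv' t0 t1 t2 a0_gt0 mv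
  Cx0 HCx s0 cs su.
exists u_ => //; rewrite F0u//; apply: limn_esup_le => e e0; exact: H.
Qed.

End gamma_convergence.

Unset Implicit Arguments.

Theorem theorem3p4 (R : realType) (n : nat) (Omega : set 'rV[R]_n.+1)
    (v : 'rV[R]_n.+1 -> R) :
  bounded_domain Omega -> lipschitz_boundary Omega -> admissible Omega v ->
  Gamma_cvg_weakL2 Omega (F_on Omega v) (F0 Omega v).
Proof.
move=> [oO _ _ bO] lO adm; have [C C0 HC] := exits_bound oO bO lO.
exact: (gamma_convergence (ltn0Sn n) oO bO C0 HC adm).
Qed.
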